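(* Let $F,G$ be bounded complexes of graded $R$-bimodules. Suppose that either (a) $F\in K^b(\mathcal{F}_\Delta)$ is $\Delta$-exact and $G\in K^b(\mathcal{B})$, or (b) $F\in K^b(\mathcal{B})$ and $G\in K^b(\mathcal{F}_\nabla)$ is $\nabla$-exact. Then $\mathrm{Hom}_K(F,G)=0$.
   Context: **Setting.** $(W,\mathcal{S})$ is a Coxeter system with Bruhat order $\le$ and set of reflections $\mathcal{T}=\bigcup_{x\in W}x\mathcal{S}x^{-1}$. $V$ is a fixed finite-dimensional reflection faithful representation of $W$ over a field $k$ of characteristic $\neq 2$: it is faithful, and $V^w$ is a hyperplane if and only if $w\in\mathcal{T}$. $R=\mathrm{Sym}(V^* )$ is the ring of regular functions on $V$, graded with $\deg V^*=2$, with its $W$-action; $R^s$ denotes the $s$-invariants. **Graded bimodules.** Bimodules are $\mathbb{Z}$-graded $(R,R)$-bimodules over $k$, with degree-zero morphisms; $M(n)_i=M_{n+i}$; tensor product over $R$ is written by juxtaposition. For an additive category $\mathcal{A}$, $K^b(\mathcal{A})$ is the homotopy category of bounded complexes. $K=K^b$ of graded $R$-bimodules, and $\mathrm{Hom}_K(A,B)=\bigoplus_{j\in\mathbb{Z}}\mathrm{hom}_K(A,B(j))$, where $\mathrm{hom}_K$ denotes morphisms in $K$. **Soergel bimodules.** $B_s=R\otimes_{R^s}R(1)$ for $s\in\mathcal{S}$. $\mathcal{B}$ is the full subcategory of graded bimodules isomorphic to finite direct sums of graded shifts of direct summands of bimodules $B_sB_t\cdots B_u$ with $s,t,\dots,u\in\mathcal{S}$.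 **Supports.** $\mathrm{Gr}(x)=\{(xv,v)\mid v\in V\}\subseteq V\times V$ and $\mathrm{Gr}(A)=\bigcup_{x\in A}\mathrm{Gr}(x)$ for $A\subseteq W$. $R_x$ is the graded bimodule of regular functions on $\mathrm{Gr}(x)$: $R_x\cong R$ as a left module, with right action $m\cdot r=m\,x(r)$. A graded bimodule $M$ is viewed as a quasi-coherent sheaf on $V\times V=\mathrm{Spec}(R\otimes_k R)$, and $\Gamma_AM=\{m\in M\mid \mathrm{supp}\,m\subseteq\mathrm{Gr}(A)\}$. Write $\ge x$ for $\{y\in W\mid y\ge x\}$, and similarly $>x,\le x,<x$. Put $\Gamma_{\ge x/>x}M=\Gamma_{\ge x}M/\Gamma_{>x}M$ and $\Gamma_{\le x/<x}M=\Gamma_{\le x}M/\Gamma_{<x}M$; these functors are applied termwise to complexes. **Flags.** $\mathcal{F}_\Delta$ (resp. $\mathcal{F}_\nabla$) is the full subcategory of graded bimodules $M$, finitely generated as bimodules and with support in $\mathrm{Gr}(A)$ for some finite $A\subseteq W$, such that for all $x\in W$ the bimodule $\Gamma_{\ge x/>x}M$ (resp. $\Gamma_{\le x/<x}M$) is isomorphic to a direct sum of shifts of $R_x$. **Exactness.** A bounded complex $A$ of graded bimodules is $\Delta$-exact if $A^i\in\mathcal{F}_\Delta$ for all $i$ and $\Gamma_{\ge x/>x}A$ is homotopic to zero for all $x\in W$. It is $\nabla$-exact if $A^i\in\mathcal{F}_\nabla$ for all $i$ and $\Gamma_{\le x/<x}A$ is homotopic to zero for all $x\in W$. *)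

(* Defs.v *)
From HB Require Import structures.
From mathcomp Require Import all_boot all_order all_algebra.
From mathcomp Require Import zify boolp.
From mathcomp Require Import mpoly.

Set Implicit Arguments.
Unset Strict Implicit.
Unset Printing Implicit Defensive.
Import Order.TTheory GRing.Theory Num.Theory.
Local Open Scope ring_scope.

Section Coxeter.

Variables (W : groupType) (S : {pred W}).
Local Open Scope group_scope.

Definition is_word (l : seq W) (x : W) : Prop :=
  all (mem S) l /\ x = \prod_(s <- l) s.

(* The last clause is the universal property of the presentation
   < S | (st)^m = 1 whenever st has order m >; orders need not be finite. *)
Definition coxeter_system : Prop :=
  [/\ forall s, s \in S -> s <> 1 /\ s * s = 1,
      forall x, exists l, is_word l x
    & forall (H : groupType) (f : W -> H),
        (forall (s t : W) (m : nat), s \in S -> t \in S ->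
           (s * t) ^+ m = 1 -> (f s * f t) ^+ m = 1) ->
        exists phi : W -> H,
          (forall x y, phi (x * y) = phi x * phi y) /\ {in S, phi =1 f}].

Definition reflection (t : W) : Prop :=
  exists x s, s \in S /\ t = x * s * x^-1.

Definition has_length (x : W) (m : nat) : Prop :=
  (exists l, is_word l x /\ size l = m) /\
  (forall l, is_word l x -> (m <= size l)%N).

Inductive bruhat_le (x : W) : W -> Prop :=
| Bruhat_refl : bruhat_le x x
| Bruhat_step (y t : W) (m m' : nat) : bruhat_le x y -> reflection t ->
    has_length y m -> has_length (t * y) m' -> (m < m')%N ->
    bruhat_le x (t * y).

(* The sets {y | y >= x}, {y | y > x}, {y | y <= x} and {y | y < x}. *)
Definition bruhat_ge (x y : W) : Prop := bruhat_le x y.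
Definition bruhat_gt (x y : W) : Prop := bruhat_le x y /\ y <> x.
Definition bruhat_below (x y : W) : Prop := bruhat_le y x.
Definition bruhat_lt (x y : W) : Prop := bruhat_le y x /\ y <> x.

End Coxeter.

Section ReflectionFaithful.

Variables (k : fieldType) (W : groupType) (S : {pred W}) (V : vectType k).

Definition representation (rho : W -> 'End(V)) : Prop :=
  rho 1%g = \1%VF /\ forall x y, rho (x * y)%g = (rho x \o rho y)%VF.

Definition reflection_faithful (rho : W -> 'End(V)) : Prop :=
  [/\ representation rho, injective rho
    & forall w, (\dim (fixedSpace (rho w))).+1 = \dim {:V} <-> reflection S w].

End ReflectionFaithful.

(* Graded (R,R)-bimodules over k, for R = k[X_0, .., X_(n-1)] with deg X_i = 2,
   are modules over R (x)_k R = k[X_0, .., X_(2n-1)]: the first n variables act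
   on the left and the last n on the right.  The grading is given by the
   projections gpr i of the module onto its homogeneous components, so that
   homogeneous of degree i means fixed by gpr i. *)
Section GradedBimodules.

Variables (k : fieldType) (n : nat).

Record gbimod := GBimod {
  gcarrier :> lmodType {mpoly k[n + n]};
  gpr : int -> gcarrier -> gcarrier;
  gprB : forall i m m', gpr i (m - m') = gpr i m - gpr i m';
  gpr_gpr : forall i j m, gpr i (gpr j m) = if i == j then gpr i m else 0;
  gprZ : forall (e : nat) (f : {mpoly k[n + n]}) i m, f \is e.-homog ->
    gpr (i + e.*2%:Z) (f *: m) = f *: gpr i m;
  gpr_sum : forall m, exists s : seq int, uniq s /\ m = \sum_(i <- s) gpr i m
}.

Definition linj (r : {mpoly k[n]}) : {mpoly k[n + n]} :=
  r \mPo [tuple 'X_(lshift n i) | i < n].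
Definition rinj (r : {mpoly k[n]}) : {mpoly k[n + n]} :=
  r \mPo [tuple 'X_(rshift n i) | i < n].

Definition lact (M : gbimod) (r : {mpoly k[n]}) (m : M) : M := linj r *: m.
Definition ract (M : gbimod) (m : M) (r : {mpoly k[n]}) : M := rinj r *: m.

Record ghom (M N : gbimod) := GHom {
  gfun :> {linear M -> N};
  gfunP : forall i m, gpr i (gfun m) = gfun (gpr i m)
}.

Definition giso (M N : gbimod) : Prop :=
  exists (f : ghom M N) (g : ghom N M), cancel f g /\ cancel g f.

(* M(d)_i = M_(d + i) *)
Section Shift.
Variables (M : gbimod) (d : int).

Let spr (i : int) (m : M) : M := gpr (d + i) m.

Fact shift_prB i m m' : spr i (m - m') = spr i m - spr i m'.
Proof. exact: gprB. Qed.

Fact shift_pr_pr i j m : spr i (spr j m) = if i == j then spr i m else 0.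
Proof. by rewrite /spr gpr_gpr (inj_eq (addrI d)). Qed.

Fact shift_prZ (e : nat) (f : {mpoly k[n + n]}) i m : f \is e.-homog ->
  spr (i + e.*2%:Z) (f *: m) = f *: spr i m.
Proof. by move=> fe; rewrite /spr addrA gprZ. Qed.

Fact shift_pr_sum m :
  exists s : seq int, uniq s /\ m = \sum_(i <- s) spr i m.
Proof.
have [s [us {1}->]] := gpr_sum m.
exists [seq i - d | i <- s]; split.
  by rewrite map_inj_uniq //; apply: addIr.
by rewrite big_map; apply: eq_bigr => i _; rewrite /spr addrC subrK.
Qed.

Definition gshift : gbimod :=
  GBimod shift_prB shift_pr_pr shift_prZ shift_pr_sum.

End Shift.

Fact gshift_homP (M N : gbimod) (d : int) (f : ghom M N)
    (i : int) (m : gshift M d) :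
  @gpr (gshift N d) i ((f : {linear M -> N}) m) = f (gpr i m).
Proof. exact: (gfunP f (d + i) m). Qed.

Definition gshift_hom (M N : gbimod) (d : int) (f : ghom M N) :
    ghom (gshift M d) (gshift N d) :=
  @GHom (gshift M d) (gshift N d) (gfun f) (@gshift_homP M N d f).

(* M is the direct sum (the coproduct) of an arbitrary family. *)
Definition is_direct_sum (I : Type) (N : I -> gbimod) (M : gbimod) : Prop :=
  exists iota : forall i, ghom (N i) M,
  forall (P : gbimod) (phi : forall i, ghom (N i) P),
  exists psi : ghom M P, (forall i m, psi (iota i m) = phi i m) /\
    forall psi' : ghom M P,
      (forall i m, psi' (iota i m) = phi i m) -> psi' =1 psi.

Definition direct_summand (M N : gbimod) : Prop :=
  exists M' : gbimod, is_direct_sum (fun b : bool => if b then M else M') N.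

(* T is the tensor product of M and N over the subring A of R, with the left
   action of M, the right action of N and the total grading. *)
Definition is_tensor (A : {mpoly k[n]} -> Prop) (M N T : gbimod) : Prop :=
  let biadditive (Z : zmodType) (b : M -> N -> Z) :=
    (forall m m' x, b (m + m') x = b m x + b m' x) /\
    (forall m x x', b m (x + x') = b m x + b m x') in
  let balanced (Z : zmodType) (b : M -> N -> Z) :=
    forall a m x, A a -> b (ract m a) x = b m (lact a x) in
  exists phi : M -> N -> T,
  [/\ biadditive T phi /\ balanced T phi,
      forall r m x, phi (lact r m) x = lact r (phi m x),
      forall r m x, phi m (ract x r) = ract (phi m x) r,
      forall i j m x, gpr i m = m -> gpr j x = x ->
        gpr (i + j) (phi m x) = phi m x
    & forall (Z : zmodType) (b : M -> N -> Z),
        biadditive Z b -> balanced Z b ->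
        exists u : {additive T -> Z}, (forall m x, u (phi m x) = b m x) /\
          forall u' : {additive T -> Z},
            (forall m x, u' (phi m x) = b m x) -> u' =1 u].

Definition finitely_generated (M : gbimod) : Prop :=
  exists l : seq M, forall m : M,
  exists c : M -> {mpoly k[n + n]}, m = \sum_(x <- l) c x *: x.

Lemma gpr0 (M : gbimod) i : gpr i (0 : M) = 0.
Proof. by rewrite -{1}(subrr (0 : M)) gprB subrr. Qed.

Lemma gprN (M : gbimod) i (m : M) : gpr i (- m) = - gpr i m.
Proof. by rewrite -sub0r gprB gpr0 sub0r. Qed.

Lemma gprD (M : gbimod) i (m m' : M) : gpr i (m + m') = gpr i m + gpr i m'.
Proof. by rewrite -{1}(opprK m') (gprB i m (- m')) gprN opprK. Qed.

Lemma gpr_bigsum (M : gbimod) i (J : Type) (s : seq J) (P : pred J)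
    (F : J -> M) :
  gpr i (\sum_(j <- s | P j) F j) = \sum_(j <- s | P j) gpr i (F j).
Proof. exact: (big_morph _ (@gprD M i) (@gpr0 M i)). Qed.

Lemma gpr_shiftZ (M : gbimod) (e : nat) (f : {mpoly k[n + n]}) i (m : M) :
  f \is e.-homog -> gpr i (f *: m) = f *: gpr (i - e.*2%:Z) m.
Proof. by move=> fe; rewrite -{1}(subrK e.*2%:Z i) gprZ. Qed.

Record gsubmod (M : gbimod) := GSubmod {
  gsub_mem : {pred M};
  gsub_closed : submod_closed gsub_mem;
  gsub_gpr : forall i m, m \in gsub_mem -> gpr i m \in gsub_mem
}.

Section SubQuotient.
Variables (M : gbimod) (U : gsubmod M).

Definition gsub_pred : {pred M} := gsub_mem U.

HB.instance Definition _ := GRing.isSubmodClosed.Build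
  {mpoly k[n + n]} M gsub_pred (gsub_closed U).

Record gsub_car := GSubCar { gsub_val :> M; _ : gsub_val \in gsub_pred }.
HB.instance Definition _ := [isSub for gsub_val].
HB.instance Definition _ := [Choice of gsub_car by <:].
HB.instance Definition _ := [SubChoice_isSubLmodule of gsub_car by <:].

Definition gsub_pr (i : int) (m : gsub_car) : gsub_car :=
  GSubCar (gsub_gpr i (valP m)).

Fact gsub_prB i m m' : gsub_pr i (m - m') = gsub_pr i m - gsub_pr i m'.
Proof. by apply: val_inj; rewrite /= gprB. Qed.

Fact gsub_pr_pr i j m :
  gsub_pr i (gsub_pr j m) = if i == j then gsub_pr i m else 0.
Proof. by apply: val_inj; rewrite /= gpr_gpr; case: eqP. Qed.

Fact gsub_prZ (e : nat) (f : {mpoly k[n + n]}) i m : f \is e.-homog ->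
  gsub_pr (i + e.*2%:Z) (f *: m) = f *: gsub_pr i m.
Proof. by move=> fe; apply: val_inj; rewrite /= gprZ. Qed.

Fact gsub_pr_sum m :
  exists s : seq int, uniq s /\ m = \sum_(i <- s) gsub_pr i m.
Proof.
have [s [us Es]] := gpr_sum (gsub_val m).
exists s; split=> //; apply: val_inj; rewrite /= {1}Es.
by elim: s {us Es} => [|i s IH]; rewrite ?big_nil ?big_cons //= IH.
Qed.

Definition gsub : gbimod :=
  @GBimod gsub_car gsub_pr gsub_prB gsub_pr_pr gsub_prZ gsub_pr_sum.

Definition gquo_car : Type := {ideal_quot gsub_pred}.
HB.instance Definition _ := GRing.Zmodule.on gquo_car.

Definition gquo_pi (m : M) : gquo_car := (\pi_({ideal_quot gsub_pred}) m)%qT.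

Lemma gquo_eq m m' : (gquo_pi m == gquo_pi m') = (m - m' \in gsub_pred).
Proof. by rewrite [RHS]Quotient.idealrBE. Qed.

Lemma gquo_surj (q : gquo_car) : exists m, q = gquo_pi m.
Proof. by exists (repr q); rewrite /gquo_pi reprK. Qed.

Fact gquo_piB : {morph gquo_pi : m m' / m - m'}.
Proof. by move=> m m'; rewrite /gquo_pi !piE. Qed.
HB.instance Definition _ := GRing.isZmodMorphism.Build M gquo_car gquo_pi
  gquo_piB.

Definition gquo_lift (f : M -> M) (q : gquo_car) : gquo_car :=
  gquo_pi (f (repr (q : {ideal_quot gsub_pred}))).

Lemma gquo_liftE (f : M -> M) :
  (forall m m', f (m - m') = f m - f m') ->
  (forall m, m \in gsub_pred -> f m \in gsub_pred) ->
  forall m, gquo_lift f (gquo_pi m) = gquo_pi (f m).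
Proof.
move=> fB fU m; apply/eqP; rewrite gquo_eq -fB fU // -gquo_eq.
by rewrite /gquo_pi reprK.
Qed.

Definition gquo_scale (f : {mpoly k[n + n]}) : gquo_car -> gquo_car :=
  gquo_lift (fun m => f *: m).

Lemma gquo_scaleE f m : gquo_scale f (gquo_pi m) = gquo_pi (f *: m).
Proof.
apply: gquo_liftE => [? ?|?]; first exact: scalerBr.
exact: rpredZ.
Qed.

Fact gquo_scaleA f g q : gquo_scale f (gquo_scale g q) = gquo_scale (f * g) q.
Proof. by have [m ->] := gquo_surj q; rewrite !gquo_scaleE scalerA. Qed.

Fact gquo_scale1 : left_id 1 gquo_scale.
Proof. by move=> q; have [m ->] := gquo_surj q; rewrite gquo_scaleE scale1r. Qed.

Fact gquo_scaleDr : right_distributive gquo_scale +%R.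
Proof.
move=> f q q'; have [m ->] := gquo_surj q; have [m' ->] := gquo_surj q'.
by rewrite -raddfD !gquo_scaleE scalerDr raddfD.
Qed.

Fact gquo_scaleDl q : {morph gquo_scale^~ q : f g / f + g}.
Proof.
move=> f g; have [m ->] := gquo_surj q.
by rewrite !gquo_scaleE scalerDl raddfD.
Qed.

HB.instance Definition _ := GRing.Zmodule_isLmodule.Build
  {mpoly k[n + n]} gquo_car gquo_scaleA gquo_scale1 gquo_scaleDr gquo_scaleDl.

Lemma gquo_piZ f m : gquo_pi (f *: m) = f *: gquo_pi m.
Proof. by rewrite -gquo_scaleE. Qed.

Definition gquo_pr (i : int) : gquo_car -> gquo_car := gquo_lift (gpr i).

Lemma gquo_prE i m : gquo_pr i (gquo_pi m) = gquo_pi (gpr i m).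
Proof.
apply: gquo_liftE => [? ?|?]; first exact: gprB.
exact: gsub_gpr.
Qed.

Fact gquo_prB i q q' : gquo_pr i (q - q') = gquo_pr i q - gquo_pr i q'.
Proof.
have [m ->] := gquo_surj q; have [m' ->] := gquo_surj q'.
by rewrite -raddfB !gquo_prE gprB raddfB.
Qed.

Fact gquo_pr_pr i j q :
  gquo_pr i (gquo_pr j q) = if i == j then gquo_pr i q else 0.
Proof.
have [m ->] := gquo_surj q; rewrite !gquo_prE gpr_gpr.
by case: eqP => // _; rewrite raddf0.
Qed.

Fact gquo_prZ (e : nat) (f : {mpoly k[n + n]}) i q : f \is e.-homog ->
  gquo_pr (i + e.*2%:Z) (f *: q) = f *: gquo_pr i q.
Proof.
move=> fe; have [m ->] := gquo_surj q.
by rewrite -gquo_piZ !gquo_prE gprZ // gquo_piZ.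
Qed.

Fact gquo_pr_sum q :
  exists s : seq int, uniq s /\ q = \sum_(i <- s) gquo_pr i q.
Proof.
have [m ->] := gquo_surj q; have [s [us Es]] := gpr_sum m.
exists s; split=> //; rewrite {1}Es raddf_sum.
by apply: eq_bigr => i _; rewrite gquo_prE.
Qed.

Definition gquo : gbimod :=
  @GBimod gquo_car gquo_pr gquo_prB gquo_pr_pr gquo_prZ gquo_pr_sum.

End SubQuotient.

Section SubQuotientMaps.
Variables (M N : gbimod) (f : ghom M N) (U : gsubmod M) (U' : gsubmod N).
Hypothesis fU : forall m, m \in gsub_mem U -> f m \in gsub_mem U'.

Definition gsub_fun (m : gsub U) : gsub U' := GSubCar (fU (valP m)).

Fact gsub_fun_linear : linear gsub_fun.
Proof. by move=> a m m'; apply: val_inj; rewrite /= linearP. Qed.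
HB.instance Definition _ := GRing.isLinear.Build
  {mpoly k[n + n]} (gsub U) (gsub U') _ gsub_fun gsub_fun_linear.

Fact gsub_funP i m : gpr i (gsub_fun m) = gsub_fun (gpr i m).
Proof. by apply: val_inj; rewrite /= gfunP. Qed.

Definition gsub_hom : ghom (gsub U) (gsub U') :=
  @GHom (gsub U) (gsub U') gsub_fun gsub_funP.

Definition gquo_fun (q : gquo U) : gquo U' :=
  gquo_pi U' (f (repr (q : {ideal_quot gsub_pred U}))).

Lemma gquo_funE m : gquo_fun (gquo_pi U m) = gquo_pi U' (f m).
Proof.
apply/eqP; rewrite gquo_eq -linearB fU // -[_ \in _]gquo_eq.
by rewrite /gquo_pi reprK.
Qed.

Fact gquo_fun_linear : linear gquo_fun.
Proof.
move=> a q q'; have [m ->] := gquo_surj q; have [m' ->] := gquo_surj q'.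
have -> : a *: (gquo_pi U m : gquo U) + gquo_pi U m' = gquo_pi U (a *: m + m').
  by rewrite raddfD /= gquo_piZ.
rewrite !gquo_funE linearP.
by rewrite [LHS]raddfD /= gquo_piZ.
Qed.
HB.instance Definition _ := GRing.isLinear.Build
  {mpoly k[n + n]} (gquo U) (gquo U') _ gquo_fun gquo_fun_linear.

Fact gquo_funP i q : gpr i (gquo_fun q) = gquo_fun (gpr i q).
Proof.
have [m ->] := gquo_surj q.
by rewrite gquo_funE /= !gquo_prE gquo_funE gfunP.
Qed.

Definition gquo_hom : ghom (gquo U) (gquo U') :=
  @GHom (gquo U) (gquo U') gquo_fun gquo_funP.

End SubQuotientMaps.

Record complex := Complex {
  cobj :> int -> gbimod;
  cd : forall i, ghom (cobj i) (cobj (i + 1));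
  cd_cd : forall i (m : cobj i), cd (i + 1) (cd i m) = 0;
  cbounded : exists b : nat, forall i : int, (b < `|i|)%N ->
    forall m : cobj i, m = 0
}.

Record chain_map (A B : complex) := ChainMap {
  cmap :> forall i, ghom (A i) (B i);
  cmapP : forall i (m : A i), cmap (i + 1) (cd A i m) = cd B i (cmap i m)
}.

(* The homotopy is indexed as h i : A^(i+1) -> B^i, which avoids transporting
   along i - 1 + 1 = i. *)
Definition homotopic (A B : complex) (f g : chain_map A B) : Prop :=
  exists h : forall i, ghom (A (i + 1)) (B i),
  forall i (m : A (i + 1)),
    f (i + 1) m - g (i + 1) m = cd B i (h i m) + h (i + 1) (cd A (i + 1) m).

Fact chain_id_homP (M : gbimod) i (m : M) :
  gpr i ((idfun : {linear M -> M}) m) = (idfun : {linear M -> M}) (gpr i m).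
Proof. by []. Qed.
Definition ghom_id (M : gbimod) : ghom M M := GHom (@chain_id_homP M).

Definition chain_id (A : complex) : chain_map A A :=
  @ChainMap A A (fun i => ghom_id (A i)) (fun _ _ => erefl).

Fact ghom0P (M N : gbimod) i (m : M) :
  gpr i ((\0 : {linear M -> N}) m) = (\0 : {linear M -> N}) (gpr i m).
Proof. exact: gpr0. Qed.
Definition ghom0 (M N : gbimod) : ghom M N := GHom (@ghom0P M N).

Fact chain0P (A B : complex) i (m : A i) :
  ghom0 (A (i + 1)) (B (i + 1)) (cd A i m) = cd B i (ghom0 (A i) (B i) m).
Proof. by rewrite /= linear0. Qed.
Definition chain0 (A B : complex) : chain_map A B := ChainMap (@chain0P A B).

Definition homotopic_to_zero (A : complex) : Prop :=
  homotopic (chain_id A) (chain0 A A).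

Section ShiftComplex.
Variables (A : complex) (d : int).

Fact cshift_cd_cd i (m : gshift (A i) d) :
  gshift_hom d (cd A (i + 1)) (gshift_hom d (cd A i) m) = 0.
Proof. exact: cd_cd. Qed.

Fact cshift_bounded : exists b : nat, forall i : int, (b < `|i|)%N ->
  forall m : gshift (A i) d, m = 0.
Proof. exact: cbounded. Qed.

(* The grading shift A(d), applied termwise. *)
Definition cshift : complex := Complex cshift_cd_cd cshift_bounded.

End ShiftComplex.

(* Hom_K(A,B) is the direct sum over d of the groups hom_K(A,B(d)) of chain
   maps modulo homotopy. *)
Definition HomK_zero (A B : complex) : Prop :=
  forall (d : int) (f : chain_map A (cshift B d)),
    homotopic f (chain0 A (cshift B d)).

Definition termwise (C : gbimod -> Prop) (A : complex) : Prop :=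
  forall i, C (A i).

(* If f kills m, some power of each homogeneous component of f does. *)
Lemma homog_component_nilpotent (M : gbimod) (F : nat -> {mpoly k[n + n]}) :
  (forall e, F e \is e.-homog) ->
  forall (a N : nat) (lo : int) (m : M),
    (forall i, (i < lo) || (lo + a%:Z <= i) -> gpr i m = 0) ->
    (\sum_(e < N) F e) *: m = 0 ->
  forall e, (e < N)%N -> exists K, F e ^+ K *: m = 0.
Proof.
move=> Fh; elim=> [|a IHa].
  move=> N lo m m0 _ e _; exists 0%N.
  have [s [_ ->]] := gpr_sum m.
  by rewrite big1 ?scaler0 // => i _; rewrite m0 // addr0 ltNge orNb.
elim=> [|N IHN] // lo m m0 Fm0.
have FN0 : F N *: gpr (lo + a%:Z) m = 0.
  have := congr1 (gpr (lo + a%:Z + N.*2%:Z)) Fm0.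
  rewrite gpr0 scaler_suml gpr_bigsum big_ord_recr /= gprZ //.
  rewrite big1 ?add0r // => e _.
  rewrite (gpr_shiftZ _ _ (Fh e)) m0 ?scaler0 //.
  by apply/orP; right; have := ltn_ord e; lia.
have FNm : forall i, (i < lo + N.*2%:Z) || (lo + N.*2%:Z + a%:Z <= i) ->
    gpr i (F N *: m) = 0.
  move=> i hi; rewrite (gpr_shiftZ _ _ (Fh N)).
  have [->|ne] := eqVneq (i - N.*2%:Z) (lo + a%:Z); first exact: FN0.
  by rewrite m0 ?scaler0 //; move: hi ne; lia.
have FFNm : (\sum_(e < N.+1) F e) *: (F N *: m) = 0.
  by rewrite scalerA mulrC -scalerA Fm0 scaler0.
move=> e; rewrite ltnS leq_eqVlt => /orP[/eqP->|ltN].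
  have [K HK] := IHa _ _ _ FNm FFNm N (ltnSn N).
  by exists K.+1; rewrite exprSr -scalerA.
have [K HK] := IHa _ _ _ FNm FFNm e (ltnW ltN).
have [||K' HK'] := IHN (lo + (e * K).*2%:Z) (F e ^+ K *: m) _ _ e ltN.
- move=> i hi; rewrite (gpr_shiftZ _ _ (dhomogMn _ (Fh e))) m0 ?scaler0 //.
  by move: hi; lia.
- rewrite scalerA mulrC -scalerA.
  move: Fm0; rewrite big_ord_recr /= scalerDl => /eqP; rewrite addr_eq0.
  by move=> /eqP->; rewrite scalerN HK oppr0.
by exists (K' + K)%N; rewrite exprD -scalerA.
Qed.

End GradedBimodules.

Section SoergelBimodules.

Variables (k : fieldType) (W : groupType) (S : {pred W}) (V : vectType k).
Variable rho : W -> 'End(V).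

Local Notation n := (\dim {:V}).
Local Notation R := {mpoly k[n]}.
Local Notation RR := {mpoly k[n + n]}.

(* R = Sym(V^* ), where 'X_i is the i-th coordinate function on V in the basis
   vbasis {:V}.  The action is (x . r)(v) = r(x^-1 v). *)
Definition act (x : W) (r : R) : R :=
  r \mPo [tuple \sum_(j < n)
    coord (vbasis {:V}) i (rho x^-1%g (vbasis {:V})`_j) *: 'X_j | i < n].

(* Restriction of functions on V * V to Gr(x), a function on Gr(x) being seen
   as an element of R through the first projection Gr(x) -> V: it is the map
   r (x) r' |-> r * (x . r'). *)
Definition res_Gr (x : W) (f : RR) : R :=
  f \mPo [tuple match split i with
                | inl j => 'X_j
                | inr j => act x 'X_j
                end | i < n + n].

(* The phantom arguments let the module structure be inferred from the type. *)
Definition Rx_carrier of (W -> 'End(V)) & W : Type := R.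

Section Rx.
Variable x : W.

Local Notation Rx_car := (Rx_carrier rho x).
HB.instance Definition _ := GRing.Zmodule.on Rx_car.

Definition Rx_scale (f : RR) (m : Rx_car) : Rx_car := res_Gr x f * (m : R).

Fact Rx_scaleA f g m : Rx_scale f (Rx_scale g m) = Rx_scale (f * g) m.
Proof. by rewrite /Rx_scale /res_Gr rmorphM /= mulrA. Qed.
Fact Rx_scale1 : left_id 1 Rx_scale.
Proof. by move=> m; rewrite /Rx_scale /res_Gr rmorph1 mul1r. Qed.
Fact Rx_scaleDr : right_distributive Rx_scale +%R.
Proof. by move=> f m m'; rewrite /Rx_scale mulrDr. Qed.
Fact Rx_scaleDl m : {morph Rx_scale^~ m : f g / f + g}.
Proof. by move=> f g; rewrite /Rx_scale /res_Gr raddfD mulrDl. Qed.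

HB.instance Definition _ := GRing.Zmodule_isLmodule.Build
  RR Rx_car Rx_scaleA Rx_scale1 Rx_scaleDr Rx_scaleDl.

Definition Rx_pr (i : int) (m : Rx_car) : Rx_car :=
  match i with
  | Posz e => if odd e then 0 else pihomog mdeg e./2 (m : R)
  | Negz _ => 0
  end.

Fact Rx_prB i m m' : Rx_pr i (m - m') = Rx_pr i m - Rx_pr i m'.
Proof.
case: i => i /=; last by rewrite subr0.
by case: odd; rewrite ?subr0 // pihomogB.
Qed.

Fact Rx_pr_pr i j m :
  Rx_pr i (Rx_pr j m) = if i == j then Rx_pr i m else 0.
Proof.
case: i j => i [] j /=; rewrite ?if_same //; last first.
  by case: odd; rewrite ?pihomog0.
have [oi|ei] := boolP (odd i); first by rewrite if_same.
have [oj|ej] := boolP (odd j).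
  rewrite pihomog0; case: eqP => // -[] Eij.
  by rewrite -Eij (negPf ei) in oj.
have [Eij|neij] := eqVneq (Posz i) (Posz j).
  by case: Eij => ->; rewrite pihomog_id.
apply: pihomog_ne0 (pihomogP _ _ _).
apply: contraNneq neij => Eij; apply/eqP; congr Posz.
by rewrite -[i]odd_double_half -[j]odd_double_half (negPf ei) (negPf ej) Eij.
Qed.

Lemma act_X_homog (i : 'I_n) : act x 'X_i \is 1.-homog.
Proof.
rewrite /act comp_mpolyXU -tnth_nth tnth_mktuple.
by apply: rpred_sum => j _; apply: dhomogZ; rewrite dhomogX; apply/eqP/mdeg1.
Qed.

Lemma res_Gr_homog (e : nat) (f : RR) : f \is e.-homog ->
  res_Gr x f \is e.-homog.
Proof.
move=> /dhomogP fe; rewrite /res_Gr comp_mpolyEX big_seq_cond.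
apply: rpred_sum => m /andP[/fe me _]; apply: dhomogZ.
rewrite comp_mpolyX -me [X in X.-homog]mdegE.
apply: (big_ind2 (fun (p : R) (d : nat) => p \is d.-homog)) => [||i _].
- exact: dhomog1.
- by move=> p d q d' pd qd'; apply: dhomogM.
rewrite -[X in X.-homog]mul1n; apply: dhomogMn; rewrite tnth_mktuple.
by case: split => j; [rewrite dhomogX; apply/eqP/mdeg1|apply: act_X_homog].
Qed.

Lemma pihomogM (e d : nat) (p q : R) : p \is e.-homog ->
  pihomog mdeg (d + e) (p * q) = p * pihomog mdeg d q.
Proof.
move=> pe; rewrite {1}(pihomog_partitionE (leqnn (mmeasure mdeg q))).
rewrite mulr_sumr raddf_sum /=.
have hom (c : nat) : p * pihomog mdeg c q \is (e + c).-homog.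
  by apply: dhomogM pe _; apply: pihomogP.
have other (c : nat) : c != d ->
    pihomog mdeg (d + e) (p * pihomog mdeg c q) = 0.
  move=> ne; apply: pihomog_ne0 (hom c).
  by rewrite [(d + e)%N]addnC eqn_add2l.
have [ltd|led] := ltnP d (mmeasure mdeg q).
  rewrite (bigD1 (Ordinal ltd)) //= big1 ?addr0 => [|c nec]; last first.
    by apply: other; apply: contraNneq nec => Ec; apply/eqP/val_inj.
  by rewrite [(d + e)%N]addnC; apply: pihomog_dE (hom d).
rewrite big1 => [|c _]; last first.
  by apply: other; rewrite neq_ltn (leq_trans (ltn_ord c) led).
rewrite pihomogE big_seq_cond big1 ?mulr0 // => m /andP[mq /eqP md].
have := mmeasure_mnm_lt mdeg mq; rewrite md => lt.
by move: led; rewrite leqNgt lt.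
Qed.

Lemma pihomogM_lt (e d : nat) (p q : R) : p \is e.-homog -> (d < e)%N ->
  pihomog mdeg d (p * q) = 0.
Proof.
move=> pe lt; rewrite (pihomog_partitionE (leqnn (mmeasure mdeg q))).
rewrite mulr_sumr raddf_sum /= big1 // => c _.
have hom : p * pihomog mdeg c q \is (e + c).-homog.
  by apply: dhomogM pe _; apply: pihomogP.
by rewrite (pihomog_ne0 _ hom) // gtn_eqF // ltn_addr.
Qed.

Fact Rx_prZ (e : nat) (f : RR) i m : f \is e.-homog ->
  Rx_pr (i + e.*2%:Z) (f *: m) = f *: Rx_pr i m.
Proof.
move=> /res_Gr_homog fe.
have scE (m' : Rx_car) : f *: m' = (res_Gr x f * (m' : R) : Rx_car) by [].
case: i => i.
  rewrite -PoszD /Rx_pr oddD odd_double addbF; case: odd; first by rewrite scaler0.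
  by rewrite halfD odd_double andbF add0n doubleK !scE pihomogM.
rewrite [X in _ = f *: X]/= scaler0.
have [le|lt] := leqP e.*2 i.
  have -> : Negz i + e.*2%:Z = Negz (i - e.*2) by lia.
  by [].
have -> : Negz i + e.*2%:Z = Posz (e.*2 - i.+1) by lia.
rewrite /Rx_pr; case: odd => //; rewrite scE (pihomogM_lt _ fe) //.
by move: lt; lia.
Qed.

Fact Rx_pr_sum m :
  exists s : seq int, uniq s /\ m = \sum_(i <- s) Rx_pr i m.
Proof.
pose b := mmeasure mdeg (m : R).
exists [seq (d.*2)%:Z | d <- iota 0 b]; split.
  rewrite map_inj_uniq ?iota_uniq // => d d' [].
  exact: double_inj.
rewrite big_map -[b]subn0 big_mkord {1}(pihomog_partitionE (leqnn b)).
by apply: eq_bigr => d _; rewrite /Rx_pr odd_double doubleK.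
Qed.

Definition Rx : gbimod k n :=
  @GBimod k n Rx_car Rx_pr Rx_prB Rx_pr_pr Rx_prZ Rx_pr_sum.

End Rx.

(* R itself is the case x = 1 of R_x. *)
Definition regular : gbimod k n := Rx 1%g.

Definition invariant (s : W) (r : R) : Prop := act s r = r.

Definition is_Bs (s : W) (M : gbimod k n) : Prop :=
  exists T, is_tensor (invariant s) regular regular T /\ giso M (gshift T 1).

(* The empty word gives the unit R of the tensor product. *)
Inductive bott_samelson : seq W -> gbimod k n -> Prop :=
| BS_nil M : giso M regular -> bott_samelson [::] M
| BS_cons s l B N M : s \in S -> is_Bs s B -> bott_samelson l N ->
    is_tensor (fun _ => True) B N M -> bott_samelson (s :: l) M.

Definition soergel (M : gbimod k n) : Prop :=
  exists (I : finType) (N : I -> gbimod k n) (d : I -> int),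
    (forall i, exists l B, bott_samelson l B /\ direct_summand (N i) B) /\
    is_direct_sum (fun i => gshift (N i) (d i)) M.

(* supp m is contained in Gr(A), as sets of points of Spec (R (x)_k R): a prime
   in supp m, i.e. containing the annihilator of m, contains the ideal of some
   Gr(x) with x in A. *)
Definition supported (A : W -> Prop) (M : gbimod k n) (m : M) : Prop :=
  forall P : prime_idealr RR, (forall f : RR, f *: m = 0 -> f \in P) ->
  exists x, A x /\ forall f : RR, res_Gr x f = 0 -> f \in P.

Section Gamma.
Variables (A : W -> Prop) (M : gbimod k n).

Definition Gamma_mem : {pred M} := [pred m | `[< supported A m >]].

Fact Gamma_closed : submod_closed Gamma_mem.
Proof.
split=> [|a u v /asboolP uA /asboolP vA].
  apply/asboolP => P annP; have := annP 1 (scaler0 _ 1).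
  by rewrite idealr1.
apply/asboolP => P annP.
have [uP|/existsNP[f /not_implyP[fu fP]]] :=
  pselect (forall f : RR, f *: u = 0 -> f \in P); first exact: uA.
have [vP|/existsNP[g /not_implyP[gv gP]]] :=
  pselect (forall f : RR, f *: v = 0 -> f \in P); first exact: vA.
have : f * g \in P.
  apply: annP; rewrite scalerDr -(scalerA f g v) gv scaler0 addr0.
  by rewrite scalerA mulrAC mulrC [f * _]mulrC mulrA -scalerA fu scaler0.
by rewrite prime_idealrM => /orP[].
Qed.

Fact Gamma_gpr i m : m \in Gamma_mem -> gpr i m \in Gamma_mem.
Proof.
move=> /asboolP mA; apply/asboolP => P annP; apply: mA => f fm.
have [s [_ Es]] := gpr_sum m.
have [a [lo supp]] : exists (a : nat) (lo : int), forall j,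
    (j < lo) || (lo + a%:Z <= j) -> gpr j m = 0.
  pose b := (\max_(j <- s) `|j|.+1)%N.
  exists b.*2, (- b%:Z) => j hj.
  rewrite Es gpr_bigsum big_seq big1 // => j' js; rewrite gpr_gpr.
  case: eqP => // Ej; subst j'.
  have := @leq_bigmax_seq _ s xpredT (fun j : int => `|j|.+1)%N j js isT.
  by rewrite -/b; move: hj; lia.
pose F (d : nat) := pihomog mdeg d f.
have Fh d : F d \is d.-homog by apply: pihomogP.
have Ef : f = \sum_(d < mmeasure mdeg f) F d by apply: pihomog_partitionE.
rewrite Ef; apply: rpred_sum => d _.
have Fm : (\sum_(d < mmeasure mdeg f) F d) *: m = 0 by rewrite -Ef.
have [K HK] := homog_component_nilpotent Fh supp Fm (ltn_ord d).
have : F d ^+ K \in P.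
  by apply: annP; rewrite -(gprZ _ _ (dhomogMn K (Fh d))) HK gpr0.
elim: K {HK} => [|K IH]; first by rewrite expr0 idealr1.
by rewrite exprS prime_idealrM => /orP[].
Qed.

Definition Gamma_sub : gsubmod M := GSubmod Gamma_closed Gamma_gpr.

Definition Gamma : gbimod k n := gsub Gamma_sub.

End Gamma.
Arguments Gamma_mem A M _ : clear implicits.

(* Gamma_(A/B) M = Gamma_A M / Gamma_B M, for B contained in A. *)
Section GammaQuotient.
Variables A B : W -> Prop.

Section Objects.
Variable M : gbimod k n.

Definition GammaQ_mem : {pred Gamma A M} :=
  [pred m | gsub_val m \in Gamma_mem B M].

Fact GammaQ_closed : submod_closed GammaQ_mem.
Proof.
have [B0 BD] := Gamma_closed B M.
by split=> [|a u v]; [apply: B0|apply: BD].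
Qed.

Fact GammaQ_gpr i m : m \in GammaQ_mem -> gpr i m \in GammaQ_mem.
Proof. exact: Gamma_gpr. Qed.

Definition GammaQ_sub : gsubmod (Gamma A M) :=
  GSubmod GammaQ_closed GammaQ_gpr.

Definition GammaQ : gbimod k n := gquo GammaQ_sub.

End Objects.
Arguments GammaQ_mem M _ : clear implicits.

Section Maps.
Variables (M N : gbimod k n) (f : ghom M N).

Fact Gamma_map (C : W -> Prop) (m : M) :
  m \in Gamma_mem C M -> f m \in Gamma_mem C N.
Proof.
move=> /asboolP mC; apply/asboolP => P annP; apply: mC => g gm.
by apply: annP; rewrite -linearZ gm linear0.
Qed.

Definition Gamma_hom : ghom (Gamma A M) (Gamma A N) :=
  gsub_hom (U := Gamma_sub A M) (U' := Gamma_sub A N) (@Gamma_map A).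

Fact GammaQ_map (m : Gamma A M) :
  m \in GammaQ_mem M -> Gamma_hom m \in GammaQ_mem N.
Proof. exact: Gamma_map. Qed.

Definition GammaQ_hom : ghom (GammaQ M) (GammaQ N) :=
  gquo_hom (U := GammaQ_sub M) (U' := GammaQ_sub N) GammaQ_map.

End Maps.

Section Complexes.
Variable F : complex k n.

Fact GammaQ_cd_cd i (m : GammaQ (F i)) :
  GammaQ_hom (cd F (i + 1)) (GammaQ_hom (cd F i) m) = 0.
Proof.
have [u ->] := gquo_surj m.
have homE M N (f : ghom M N) (v : Gamma A M) : GammaQ_hom f (gquo_pi (GammaQ_sub M) v) =
    gquo_pi (GammaQ_sub N) (Gamma_hom f v).
  exact: (@gquo_funE _ _ _ _ (Gamma_hom f) (GammaQ_sub M) (GammaQ_sub N)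
    (@GammaQ_map M N f) v).
rewrite !homE (_ : Gamma_hom _ _ = 0) ?raddf0 //.
by apply: val_inj; apply: cd_cd.
Qed.

Fact GammaQ_bounded : exists b : nat, forall i : int, (b < `|i|)%N ->
  forall m : GammaQ (F i), m = 0.
Proof.
have [b Hb] := cbounded F; exists b => i bi m.
have [u ->] := gquo_surj m.
rewrite (_ : u = 0) ?raddf0 //.
by apply: val_inj; apply: Hb.
Qed.

Definition GammaQ_complex : complex k n := Complex GammaQ_cd_cd GammaQ_bounded.

End Complexes.
End GammaQuotient.

Definition sum_of_shifts_of_Rx (x : W) (M : gbimod k n) : Prop :=
  exists (I : Type) (d : I -> int), is_direct_sum (fun i => gshift (Rx x) (d i)) M.

Definition finite_support (M : gbimod k n) : Prop :=
  exists A : seq W, forall m : M, supported (fun x => x \in A) m.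

Definition Delta_flag (M : gbimod k n) : Prop :=
  [/\ finitely_generated M, finite_support M
    & forall x, sum_of_shifts_of_Rx x
        (GammaQ (bruhat_ge S x) (bruhat_gt S x) M)].

Definition Nabla_flag (M : gbimod k n) : Prop :=
  [/\ finitely_generated M, finite_support M
    & forall x, sum_of_shifts_of_Rx x
        (GammaQ (bruhat_below S x) (bruhat_lt S x) M)].

Definition Delta_exact (F : complex k n) : Prop :=
  termwise Delta_flag F /\
  forall x, homotopic_to_zero
    (GammaQ_complex (bruhat_ge S x) (bruhat_gt S x) F).

Definition Nabla_exact (F : complex k n) : Prop :=
  termwise Nabla_flag F /\
  forall x, homotopic_to_zero
    (GammaQ_complex (bruhat_below S x) (bruhat_lt S x) F).

End SoergelBimodules.

(* Main.v *)
From HB Require Import structures.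
From mathcomp Require Import all_boot all_order all_algebra fingroup perm.
From mathcomp Require Import zify ring boolp.
From mathcomp Require classical_sets.
From mathcomp Require Import mpoly.
Require Import Defs.

Set Implicit Arguments.
Unset Strict Implicit.
Unset Printing Implicit Defensive.

(** A chain map F -> G(d) is contracted one degree at a time.  In case (a) each
    step asks that a bimodule map F^(i+1) -> G^j which kills the image of F^i
    factors through the differential of F^(i+1) ([ext_exact]); in case (b) that a
    map F^j -> G^(i+1) with values in the cycles lifts to G^i ([lift_exact]).
    A factorization that ignores the gradings is enough: its degree-zero part is
    again one ([graded_factor_right], [graded_factor_left]).  Boundedness starts
    the recursion, which goes upwards in case (a) and downwards in case (b).

    Write A = R (x)_k R.  Both properties pass to retracts and to finite direct
    sums of the Soergel bimodule, so the latter may be taken to be a product of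
    bimodules B_s.  The functor B_s (x)_R - is realised as a doubling D_s, with
    D_s N = N + N as a group and A acting through its decomposition into
    s-invariants and alpha_s times s-invariants ([dmod], [tensor_iso]).  It is its
    own left and right adjoint, so that the property for the pair (X, D_s N)
    follows from the one for (D_s X, N).  After finitely many doublings of the
    complex the Soergel bimodule is R itself, the functions on Gr(1).

    This requires a property of complexes that is stable under doubling.  It is
    the following ([arranged]): there is a list L of elements of W such that the
    complex is supported on Gr(L) and, whenever L = L1 ++ x :: C, the sections
    supported on Gr(x :: C) modulo those supported on Gr(C) form an exact complex
    with termwise a dual basis over the right action of R; moreover any two
    entries of L that differ by a reflection occur by increasing length in
    case (a) and by decreasing length in case (b).  Two entries x, y that do not
    differ by a reflection can be exchanged when they are adjacent: Gr(x) meets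
    Gr(y) in codimension at least two, which provides two coprime functions on
    Gr(y) that come from functions vanishing on Gr(x), and against a dual basis
    such a pair can be cancelled ([supp_on_split], [good_chain_swap]).  Hence all
    arrangements of a finite subset of W are equally good, and Coxeter
    combinatorics supplies two useful ones.  For a simple reflection s there is an
    arrangement in which x and sx are neighbours ([block_arrangement]); there the
    two subquotients of D_s X that belong to the block of x are both isomorphic to
    the subquotient of X for the whole block ([good_double]), so that D_s X is
    arranged again.  And the unit of W can be put at the front, or at the back in
    case (b) ([sorted_list]); then the subquotient at Gr(1) is a quotient, resp. a
    subobject, of the complex, and this settles the case of R
    ([ext_exact_graph], [lift_exact_graph]).

    A Delta- or nabla-exact complex is arranged: the subquotients of the flag for
    the Bruhat order are compared with those of a list sorted by length
    ([good_chain_flag]).  The comparison takes place modulo the torsion of the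
    right action of R, because a Delta-flag may have torsion: if W is infinite,
    the trivial bimodule k has Gamma_(>= x) k = Gamma_(> x) k = k for all x.  A
    nabla-flag has none ([flag_torsion0]). *)

(** * Coxeter groups: reflections, length and arrangements *)

Section ReflectionGroup.
Local Open Scope group_scope.
Variable W : groupType.

(** The semidirect product of W with the group of all functions W -> Z/2, on
    which W acts through conjugation of the argument.  A homomorphism from W to it
    that is the identity on W is a cocycle, and the one that sends s to (s, [t = s])
    counts modulo 2 how often the reflection t is met by a word. *)
Definition rgrp : Type := (W * (W -> bool))%type.
HB.instance Definition _ := Choice.on rgrp.

Definition rgrp_mul (a b : rgrp) : rgrp :=
  (a.1 * b.1, fun t => a.2 t (+) b.2 (a.1^-1 * t * a.1)).
Definition rgrp_one : rgrp := (1, fun _ => false).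
Definition rgrp_inv (a : rgrp) : rgrp := (a.1^-1, fun t => a.2 (a.1 * t * a.1^-1)).

Fact rgrp_mulA : associative rgrp_mul.
Proof.
move=> [x f] [y g] [z h]; rewrite /rgrp_mul /= mulgA; congr pair.
by apply: funext => t; rewrite addbA invgM !mulgA.
Qed.
Fact rgrp_mul1 : left_id rgrp_one rgrp_mul.
Proof.
move=> [x f]; rewrite /rgrp_mul /= mul1g; congr pair.
by apply: funext => t; rewrite invg1 mul1g mulg1.
Qed.
Fact rgrp_mulr1 : right_id rgrp_one rgrp_mul.
Proof.
move=> [x f]; rewrite /rgrp_mul /= mulg1; congr pair.
by apply: funext => t; rewrite addbF.
Qed.
Fact rgrp_mulV : left_inverse rgrp_one rgrp_inv rgrp_mul.
Proof.
move=> [x f]; rewrite /rgrp_mul /= mulVg; congr pair.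
by apply: funext => t; rewrite invgK addbb.
Qed.
Fact rgrp_mulVr : right_inverse rgrp_one rgrp_inv rgrp_mul.
Proof.
move=> [x f]; rewrite /rgrp_mul /= mulgV; congr pair.
by apply: funext => t; rewrite !mulgA mulgV mul1g -mulgA mulgV mulg1 addbb.
Qed.
HB.instance Definition _ := isGroup.Build rgrp rgrp_mulA rgrp_mul1 rgrp_mulr1
  rgrp_mulV rgrp_mulVr.

Definition rgen (s : W) : rgrp := (s, fun t => t == s).

(** The reflections met by (st)^m are the (st)^j s for j < 2m. *)
Lemma rgen_expg s t m : s * s = 1 -> t * t = 1 ->
  (rgen s * rgen t) ^+ m = ((s * t) ^+ m,
     fun u => odd (count (fun j => u == (s * t) ^+ j * s) (iota 0 m.*2))) :> rgrp.
Proof.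
move=> ss tt; have sV : s^-1 = s by apply: mulg1_eq.
have tV : t^-1 = t by apply: mulg1_eq.
have conj j : (s * t) ^+ j * s = s * (s * t) ^- j.
  elim: j => [|j IH]; first by rewrite expg0 invg1 mulg1 mul1g.
  by rewrite [in LHS]expgS -mulgA IH expgSr invgM invgM sV tV !mulgA.
elim: m => [|m IH] //.
rewrite expgSr IH; apply: (congr2 pair); first by rewrite [RHS]expgSr.
apply: funext => u; rewrite doubleS -addn2 iotaD count_cat oddD.
apply: (congr2 addb) => //; rewrite add0n /= addn0 oddD; set g := s * t.
have cj (a b v : W) : (a^-1 * v * a == b) = (v == a * b * a^-1).
  apply/eqP/eqP => [<-|->]; first by rewrite !mulgA mulgV mul1g -mulgA mulgV mulg1.
  by rewrite !mulgA mulVg mul1g -mulgA mulVg mulg1.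
rewrite !oddb !cj; congr (_ (+) _); congr (_ == _).
  by rewrite -addnn expgnDr -!mulgA conj.
rewrite sV (_ : s * t * s = g * s) // mulgA -expgSr.
by rewrite -mulgA -conj mulgA -expgnDr addSn addnn.
Qed.

(** If (st)^m = 1, the reflections (st)^j s with m <= j < 2m repeat those with
    j < m, so that the count is even. *)
Lemma rgen_rel s t m : s * s = 1 -> t * t = 1 -> (s * t) ^+ m = 1 ->
  (rgen s * rgen t) ^+ m = 1.
Proof.
move=> ss tt st; rewrite rgen_expg // st; congr pair; apply: funext => u.
rewrite -addnn iotaD add0n count_cat -{2}[m]addn0 iotaDl count_map.
set a := count _ _; set b := count _ _; suff -> : b = a by rewrite addnn odd_double.
by apply: eq_count => j /=; rewrite expgnDr st mul1g.
Qed.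

End ReflectionGroup.

Section CoxeterTheory.
Local Open Scope group_scope.
Variables (W : groupType) (S : {pred W}).
Hypothesis hS : coxeter_system S.

Lemma gen_involutive s : s \in S -> s * s = 1.
Proof. by case: hS => h _ _ /h[]. Qed.

Lemma gen_inv s : s \in S -> s^-1 = s.
Proof. by move=> /gen_involutive; apply: mulg1_eq. Qed.

Lemma ex_word x : exists l, is_word S l x.
Proof. by case: hS. Qed.

Lemma is_word_cons s l x : is_word S (s :: l) x <->
  s \in S /\ exists2 y, is_word S l y & x = s * y.
Proof.
rewrite /is_word /= big_cons; split=> [[/andP[sS lS] ->]|[sS [y [lS ->] ->]]].
  by split=> //; exists (\prod_(i <- l) i).
by split=> //; apply/andP.
Qed.

Lemma cocycle : exists N : W -> W -> bool,
  (forall x y t, N (x * y) t = N x t (+) N y (x^-1 * t * x)) /\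
  (forall s t, s \in S -> N s t = (t == s)).
Proof.
case: hS => _ _ /(_ (rgrp W) (@rgen W))[].
  move=> s t m sS tS; apply: rgen_rel; exact: gen_involutive.
move=> phi [phiM phiS].
have phi1 x : (phi x).1 = x.
  have [l] := ex_word x; elim: l x => [|s l IH] x.
    move=> [_ ->]; rewrite big_nil.
    have := congr1 fst (phiM 1 1); rewrite mulg1 /= => E.
    by apply: (mulgI (phi 1).1); rewrite -E mulg1.
  by move=> /is_word_cons[sS [y /IH Ey ->]]; rewrite phiM /= Ey phiS.
exists (fun x => (phi x).2); split=> [x y t|s t sS]; last by rewrite phiS.
by rewrite phiM /= phi1.
Qed.

(** The parity of the length, obtained from the presentation by sending all
    generators to the transposition of two points. *)
Lemma sign_hom : exists sg : W -> bool,
  (forall x y, sg (x * y) = sg x (+) sg y) /\ (forall s, s \in S -> sg s).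
Proof.
case: hS => _ _ /(_ {perm bool} (fun _ => tperm true false))[].
  by move=> s t m _ _ _; rewrite (_ : _ * _ = 1) ?expg1n // tperm2.
move=> phi [phiM phiS]; exists (fun x => odd_perm (phi x)); split=> [x y|s sS].
  by rewrite phiM odd_permM.
by rewrite phiS // odd_tperm.
Qed.

Definition len x := ex_minn (P := fun n => `[< exists l, is_word S l x /\ size l = n >])
  (let: ex_intro l hl := ex_word x in
   ex_intro _ (size l) (asboolT (ex_intro _ l (conj hl erefl)))).

Lemma lenP x : has_length S x (len x).
Proof.
rewrite /len; case: ex_minnP => m /asboolP hm min; split=> // l hl.
by apply: min; apply/asboolP; exists l.
Qed.

Lemma len_uniq x m : has_length S x m -> m = len x.
Proof.
move=> [[l [hl sl]] min]; have [[l' [hl' sl']] min'] := lenP x.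
by apply/eqP; rewrite eqn_leq -{1}sl' min //= -sl min'.
Qed.

Lemma len_le l x : is_word S l x -> (len x <= size l)%N.
Proof. by case: (lenP x) => _; apply. Qed.

Lemma len1 : len 1 = 0%N.
Proof. by apply/eqP; rewrite -leqn0; apply: (@len_le [::]); split; rewrite ?big_nil. Qed.

Lemma len_gen_le s x : s \in S -> (len (s * x) <= (len x).+1)%N.
Proof.
move=> sS; have [[l [hl <-]] _] := lenP x; apply: (@len_le (s :: l)).
by apply/is_word_cons; split=> //; exists x.
Qed.

Lemma reflectionV t : reflection S t -> t^-1 = t.
Proof.
by move=> [x [s [sS ->]]]; rewrite !invgM invgK (gen_inv sS) mulgA.
Qed.

(** The cocycle N x t is the parity of the number of prefixes l1 ++ [:: s] of a
    word of x with l1 s l1^-1 = t.  As soon as it is odd there is such a prefix, and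
    deleting its last letter from the word multiplies x by t. *)
Lemma strong_exchange t l x : reflection S t -> is_word S l x ->
  (len (t * x) < len x)%N ->
  exists l1 s l2, l = l1 ++ s :: l2 /\ is_word S (l1 ++ l2) (t * x).
Proof.
have [N [NM NS]] := cocycle.
have exch u m y : is_word S m y -> N y u ->
    exists l1 s l2, m = l1 ++ s :: l2 /\ is_word S (l1 ++ l2) (u * y).
  elim: m y u => [|s m IH] y u.
    move=> [_ ->]; rewrite big_nil; have := NM 1 1 u.
    by rewrite mulg1 invg1 mul1g mulg1 addbb => ->.
  move=> /is_word_cons[sS [z hz ->]]; rewrite NM NS //.
  have [->|ne] := eqVneq u s => /= h.
    by exists [::], s, m; rewrite mulgA (gen_involutive sS) mul1g.
  have [l1 [r [l2 [-> h2]]]] := IH _ _ hz h.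
  exists (s :: l1), r, l2; split=> //; apply/is_word_cons; split=> //.
  by exists (s^-1 * u * s * z) => //; rewrite !mulgA mulgV mul1g.
have Nle u y : N y u -> (len (u * y) < len y)%N.
  move=> h; have [[m [hm <-]] _] := lenP y.
  have [l1 [s [l2 [-> h2]]]] := exch _ _ _ hm h.
  by apply: leq_ltn_trans (len_le h2) _; rewrite !size_cat /= addnS.
move=> rt hl lt; apply: exch => //; apply: contraLR lt => nN.
have tV := reflectionV rt.
have Ntt : N t t.
  case: rt => x0 [s [sS Et]].
  have E1 := NM x0 x0^-1 t; have E2 := NM (x0 * s) x0^-1 t; have E3 := NM x0 s t.
  have cx : x0^-1 * t * x0 = s by rewrite Et !mulgA mulVg mul1g -mulgA mulVg mulg1.
  have N1 : N 1 t = false.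
    have := NM 1 1 t; by rewrite mulg1 invg1 mul1g mulg1 addbb.
  move: E1; rewrite mulgV N1 cx => E1.
  have cxs : (x0 * s)^-1 * t * (x0 * s) = s.
    transitivity (s^-1 * (x0^-1 * t * x0) * s); first by rewrite invgM !mulgA.
    by rewrite cx mulVg mul1g.
  rewrite {1}Et E2 E3 cx (NS s s sS) eqxx cxs.
  by case: (N x0 t) (N x0^-1 s) E1 => [] [].
(* If the cocycle vanished at (x, t) it would be odd at (t * x, t), so that
   t * x would be longer than t * (t * x) = x. *)
rewrite -leqNgt ltnW //.
have tt : t * t = 1 by rewrite -{1}tV mulVg.
have := @Nle t (t * x); rewrite mulgA tt mul1g; apply.
by rewrite NM Ntt mulVg mul1g (negPf nN).
Qed.

Lemma len_reflection t x : reflection S t -> len (t * x) != len x.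
Proof.
move=> rt; have [sg [sgM sgS]] := sign_hom.
have sg1 : sg 1 = false by have := sgM 1 1; rewrite mulg1 addbb.
have sgl l y : is_word S l y -> sg y = odd (size l).
  elim: l y => [|s l IH] y; first by move=> [_ ->]; rewrite big_nil.
  by move=> /is_word_cons[sS [z /IH E ->]]; rewrite sgM sgS //= E.
have sgE y : sg y = odd (len y) by have [[l [hl <-]] _] := lenP y; apply: sgl.
have : sg (t * x) != sg x.
  case: rt => y [s [sS ->]]; rewrite !sgM (sgS s sS).
  have : sg y (+) sg y^-1 = false by rewrite -sgM mulgV.
  by case: (sg y) (sg y^-1) (sg x) => [] [] [].
by apply: contraNneq; rewrite !sgE => ->.
Qed.

(** In a reflection faithful representation this means, for distinct x and y, that
    the equations of Gr(x) restrict to Gr(y) as multiples of a single linear form. *)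
Definition dep x y := `[< reflection S (y * x^-1) >].

Lemma dep_sym x y : dep x y = dep y x.
Proof.
by apply/asboolP/asboolP => /[dup] /reflectionV <-; rewrite invgM invgK.
Qed.

Lemma dep_len x y : dep x y -> len x != len y.
Proof.
by move=> /asboolP /(len_reflection x); rewrite mulgVK eq_sym.
Qed.

(** A reflection has odd length, the product of two reflections has even length. *)
Lemma dep_triple x y z : dep x y -> dep y z -> dep x z -> False.
Proof.
have [sg [sgM sgS]] := sign_hom.
have sg1 : sg 1 = false by have := sgM 1 1; rewrite mulg1 addbb.
have sgr t : reflection S t -> sg t.
  case=> y' [s [sS ->]]; rewrite !sgM (sgS s sS).
  have : sg y' (+) sg y'^-1 = false by rewrite -sgM mulgV.
  by case: (sg y') (sg y'^-1) => [] [].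
move=> /asboolP/sgr h1 /asboolP/sgr h2 /asboolP/sgr h3.
by move: h3; rewrite -(mulgVK y z) -mulgA sgM h1 h2.
Qed.

Lemma bruhat_len x y : bruhat_le S x y -> x = y \/ (len x < len y)%N.
Proof.
elim=> [|{}y t m m' _ IH _ hm hm' lt]; first by left.
right; rewrite -(len_uniq hm') ; rewrite (len_uniq hm) in lt.
by case: IH => [->|/ltn_trans]; [|apply]; rewrite // -(len_uniq hm).
Qed.

Lemma dep_bruhat x y : dep x y -> (len x < len y)%N -> bruhat_le S x y.
Proof.
move=> /asboolP r lt; rewrite -(mulgVK x y).
apply: (Bruhat_step (m := len x) (m' := len y)) => //.
- exact: Bruhat_refl.
- exact: lenP.
by rewrite mulgVK; apply: lenP.
Qed.

(** The only way in which two blocks [:: x; s * x] and [:: y; s * y], listed by the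
    length of their shorter elements, could put two related elements in the wrong
    order.  Strong exchange in the word s :: l of s * x either gives y = x or a word
    that starts with s, which contradicts that s * y is longer than y. *)
Lemma dep_ascents s x y : s \in S -> (len x < len (s * x))%N ->
  (len y < len (s * y))%N -> dep (s * x) y -> (len y < len (s * x))%N ->
  (len x <= len y)%N -> x = y.
Proof.
move=> sS xs ys /asboolP r lt le; have [[l [hl sl]] _] := lenP x.
have hsl : is_word S (s :: l) (s * x) by apply/is_word_cons; split=> //; exists x.
have [|l1 [r' [l2 [E hw]]]] := strong_exchange r hsl; first by rewrite mulgVK.
move: hw; rewrite mulgVK; case: l1 E => [[_ <-] [_ ->]|s' l1 [Es El]].
  by case: hl.
move=> /is_word_cons[_ [z hz Ey]].
have := len_le hz; have : s * y = z by rewrite Ey mulgA -Es gen_involutive ?mul1g.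
move=> <- h; have : (len (s * y) < len y)%N.
  apply: leq_ltn_trans h _; apply: leq_trans le; rewrite -sl El !size_cat /=.
  by rewrite addnS.
by move/(ltn_trans ys); rewrite ltnn.
Qed.

(** The order in which two elements that differ by a reflection may appear in a
    list: by increasing length in [okD], which suits Delta-flags, and by decreasing
    length in [okN], which suits nabla-flags. *)
Definition okD x y := dep x y ==> (len x < len y)%N.
Definition okN x y := dep x y ==> (len y < len x)%N.

Lemma okDP x y : okD x y -> okD y x -> ~~ dep x y.
Proof.
rewrite /okD [dep y x]dep_sym; case: (dep x y) => //= h /(ltn_trans h).
by rewrite ltnn.
Qed.

Lemma okNP x y : okN x y -> okN y x -> ~~ dep x y.
Proof.
rewrite /okN [dep y x]dep_sym; case: (dep x y) => //= h /(ltn_trans h).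
by rewrite ltnn.
Qed.

Lemma pairwise_rev (T : Type) (r r' : rel T) l : (forall x y, r x y = r' y x) ->
  pairwise r (rev l) = pairwise r' l.
Proof.
move=> E; elim: l => [|x l IH] //; rewrite rev_cons pairwise_rcons IH /= all_rev.
by congr (_ && _); apply: eq_all => y.
Qed.

Definition by_length x y := (len x <= len y)%N.

Lemma sorted_list (X : seq W) : exists L, [/\ uniq (1 :: L), {subset X <= 1 :: L}
  & pairwise by_length (1 :: L)].
Proof.
exists (sort by_length (undup [seq x <- X | x != 1])); split.
- by rewrite /= sort_uniq undup_uniq mem_sort mem_undup mem_filter eqxx.
- move=> x xX; rewrite inE mem_sort mem_undup mem_filter xX andbT.
  by case: eqP.
rewrite /= -sorted_pairwise; last by move=> x y z; apply: leq_trans.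
rewrite sort_sorted; last by move=> x y; apply: leq_total.
by rewrite andbT; apply/allP => y _; rewrite /by_length len1.
Qed.

Lemma lex_arrangement L : pairwise by_length L -> pairwise okD L.
Proof.
apply: sub_pairwise => x y le; apply/implyP => /dep_len ne.
by rewrite ltn_neqAle ne.
Qed.

Section Blocks.
Variable s : W.
Hypothesis sS : s \in S.

Definition sblocks zs := flatten [seq [:: z; s * z] | z <- zs].

Lemma gen_mulK x : s * (s * x) = x.
Proof. by rewrite mulgA gen_involutive ?mul1g. Qed.

Lemma dep_gen x : dep x (s * x).
Proof.
apply/asboolP; rewrite mulgK; exists 1, s; split=> //.
by rewrite invg1 mulg1 mul1g.
Qed.

Lemma sblocks_rev zs : rev (sblocks zs) = sblocks (rev [seq s * z | z <- zs]).
Proof.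
rewrite /sblocks; elim: zs => [|z zs IH] //=.
rewrite !rev_cons IH map_rcons flatten_rcons -cats1 -cats1 -catA /=.
by rewrite gen_mulK.
Qed.

Lemma mem_sblocks zs x : (x \in sblocks zs) = (x \in zs) || (s * x \in zs).
Proof.
elim: zs => [|z zs IH] //=; rewrite !inE IH.
have -> : (x == s * z) = (s * x == z) by apply/eqP/eqP => [->|<-]; rewrite gen_mulK.
by case: (x == z); case: (s * x == z) => //=; rewrite ?orbT.
Qed.

(** List the blocks {z, s * z} by the length of their shorter element z. *)
Lemma block_arrangement (X : seq W) : exists zs, [/\ {subset X <= sblocks zs},
  uniq (sblocks zs) & pairwise okD (sblocks zs)].
Proof.
pose m x := if (len x < len (s * x))%N then x else s * x.
have lenN x : len (s * x) != len x.
  by rewrite eq_sym; apply: dep_len (dep_gen x).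
have mP x : (len (m x) < len (s * m x))%N.
  rewrite /m; case: (ltnP (len x) (len (s * x))) => // h; rewrite gen_mulK.
  by rewrite ltn_neqAle lenN.
pose zs := sort by_length (undup [seq m x | x <- X]).
have zP z : z \in zs -> (len z < len (s * z))%N.
  by rewrite mem_sort mem_undup => /mapP[x _ ->].
have uz : uniq zs by rewrite sort_uniq undup_uniq.
have pz : pairwise by_length zs.
  rewrite -sorted_pairwise; last by move=> x y z; apply: leq_trans.
  by apply: sort_sorted => x y; apply: leq_total.
exists zs; split.
- move=> x xX; rewrite mem_sblocks !mem_sort !mem_undup.
  have : m x \in [seq m x | x <- X] by apply: map_f.
  by rewrite {1}/m; case: ifP => _ ->; rewrite ?orbT.
- elim: (zs) uz zP {pz} => [|z l IH] //= /andP[zl ul] zP.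
  rewrite IH // ?andbT; last by move=> y yl; apply: zP; rewrite inE yl orbT.
  have zz := zP z; rewrite inE eqxx in zz; have {}zz := zz isT.
  have ne : z != s * z by apply: contraTneq zz => <-; rewrite ltnn.
  have nl : s * z \notin l.
    apply/negP => h; have := zP (s * z); rewrite inE h orbT gen_mulK => /(_ isT).
    by move/(ltn_trans zz); rewrite ltnn.
  by rewrite inE !mem_sblocks gen_mulK negb_or ne /= (negPf zl) (negPf nl).
elim: (zs) uz zP pz => [|z l IH] //= /andP[zl ul] zP /andP[zle pl].
rewrite IH // ?andbT; last by move=> y yl; apply: zP; rewrite inE yl orbT.
have zz := zP z; rewrite inE eqxx in zz; have {}zz := zz isT.
rewrite {1}/okD zz implybT /=.
(* Between two blocks the critical pair is the longer element of the earlier block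
   and the shorter element of the later one. *)
have key a b y : (a == z) || (a == s * z) -> y \in l -> (b == y) || (b == s * y) -> okD a b.
  move=> ha yl hb; apply/implyP => dab.
  have zy : (len z <= len y)%N by move/allP: zle => /(_ y yl).
  have yy : (len y < len (s * y))%N by apply: zP; rewrite inE yl orbT.
  have ney : z != y by apply: contraNneq zl => ->.
  rewrite ltnNge leq_eqVlt eq_sym (negPf (dep_len dab)) /=; apply/negP => lt.
  have yb : (len y <= len b)%N by case/orP: hb => /eqP-> //; apply: ltnW.
  have az : (len a <= (len z).+1)%N.
    by case/orP: ha => /eqP->; [apply: leqW|apply: len_gen_le].
  have Ea : a = s * z.
    case/orP: ha => /eqP // Ea; move: lt; rewrite Ea ltnNge.
    by rewrite (leq_trans zy yb).
  have Eb : b = y.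
    case/orP: hb => /eqP // Eb; have : (len y < len z)%N.
      rewrite -ltnS; apply: leq_trans az; apply: leq_ltn_trans lt.
      by rewrite Eb.
    by rewrite ltnNge zy.
  case/eqP: ney; apply: (dep_ascents sS) => //; rewrite -?Ea -?Eb //.
apply/andP; split; apply/allP => b; rewrite mem_sblocks => /orP[] bl.
- by apply: (key _ _ b) => //; rewrite eqxx.
- by apply: (key _ _ (s * b)) => //; rewrite ?eqxx // gen_mulK eqxx orbT.
- by apply: (key _ _ b) => //; rewrite eqxx ?orbT.
by apply: (key _ _ (s * b)) => //; rewrite ?eqxx ?orbT // gen_mulK eqxx orbT.
Qed.

End Blocks.
End CoxeterTheory.

Import Order.TTheory GRing.Theory Num.Theory.
Local Open Scope ring_scope.

(** * Torsion and support of elements along graphs *)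

Lemma eq_big_support (I : eqType) (V : nmodType) (s1 s2 : seq I) (F : I -> V) :
  uniq s1 -> uniq s2 -> (forall i, i \notin s1 -> F i = 0) ->
  (forall i, i \notin s2 -> F i = 0) ->
  \sum_(i <- s1) F i = \sum_(i <- s2) F i.
Proof.
move=> u1 u2 h1 h2.
have E (s : seq I) : \sum_(i <- s) F i = \sum_(i <- [seq i <- s | F i != 0]) F i.
  rewrite big_filter [RHS]big_mkcond; apply: eq_bigr => i _.
  by case: eqP.
rewrite E [RHS]E; apply: perm_big; apply: uniq_perm; rewrite ?filter_uniq //.
move=> i; rewrite !mem_filter; case: eqP => //= ne.
have -> : i \in s1 by apply: contra_notT ne => /h1.
by apply/esym; apply: contra_notT ne => /h2.
Qed.

Lemma dep_choice (I : Type) (T : I -> Type) (P : forall i, T i -> Prop) :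
  (forall i, exists t, P i t) -> exists f : forall i, T i, forall i, P i (f i).
Proof. by move=> h; exists (fun i => sval (cid (h i))) => i; case: cid. Qed.

Section GraphModules.

(* Think of A as the functions on V * V, of R as the functions on V, of inj as
   the right inclusion and of res x as the restriction to the graph of x, which
   is isomorphic to V by the second projection. *)
Variables (A : comNzRingType) (R : idomainType) (W : eqType).
Variables (inj : {rmorphism R -> A}) (res : W -> {rmorphism A -> R}).
Hypothesis resK : forall x r, res x (inj r) = r.
Hypothesis sep : forall x y, x != y -> exists2 f, res x f = 0 & res y f != 0.

Implicit Types (M : lmodType A) (x y : W) (C B L : seq W).

Definition vanishes C (f : A) := forall c, c \in C -> res c f = 0.

Definition torsion M (m : M) := exists2 r, r != 0 & inj r *: m = 0.

(** Support in Gr(C) up to torsion of the right action.  The quantifier over all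
    functions that vanish on the union of the graphs, instead of products of
    functions vanishing on one graph each, makes intersections of supports
    behave ([supp_onI]). *)
Definition supp_on C M (m : M) := forall f, vanishes C f -> torsion (f *: m).

Lemma vanishesM C f g : vanishes C g -> vanishes C (f * g).
Proof. by move=> h c cC; rewrite rmorphM h ?mulr0. Qed.

Lemma vanishes_sub C B f : {subset B <= C} -> vanishes C f -> vanishes B f.
Proof. by move=> sBC h c /sBC/h. Qed.

Lemma vanishesU C C1 C2 f g : {subset C <= C1 ++ C2} -> vanishes C1 f ->
  vanishes C2 g -> vanishes C (f * g).
Proof.
move=> sub h1 h2 c /sub; rewrite mem_cat rmorphM => /orP[/h1|/h2] ->.
  by rewrite mul0r.
by rewrite mulr0.
Qed.

Lemma torsion0 M : torsion (0 : M).
Proof. by exists 1; rewrite ?oner_eq0 // scaler0. Qed.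

Lemma torsionD M (m m' : M) : torsion m -> torsion m' -> torsion (m + m').
Proof.
move=> [r r0 rm] [r' r'0 rm']; exists (r * r'); first by rewrite mulf_neq0.
rewrite scalerDr rmorphM -[X in _ + X]scalerA rm' scaler0 addr0.
by rewrite mulrC -scalerA rm scaler0.
Qed.

Lemma torsionZ M f (m : M) : torsion m -> torsion (f *: m).
Proof.
by move=> [r r0 rm]; exists r; rewrite // scalerA mulrC -scalerA rm scaler0.
Qed.

Lemma torsionB M (m m' : M) : torsion m -> torsion m' -> torsion (m - m').
Proof. by move=> h h'; rewrite -scaleN1r; apply/torsionD/torsionZ. Qed.

Lemma torsion_inj M r (m : M) : r != 0 -> torsion (inj r *: m) -> torsion m.
Proof.
move=> r0 [r' r'0 h]; exists (r' * r); first by rewrite mulf_neq0.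
by rewrite rmorphM -scalerA.
Qed.

Lemma supp_onD C M (m m' : M) : supp_on C m -> supp_on C m' -> supp_on C (m + m').
Proof. by move=> h h' f fC; rewrite scalerDr; apply: torsionD; auto. Qed.

Lemma supp_onZ C M f (m : M) : supp_on C m -> supp_on C (f *: m).
Proof. by move=> h g gC; rewrite scalerA mulrC -scalerA; apply/torsionZ/h. Qed.

Lemma supp_onB C M (m m' : M) : supp_on C m -> supp_on C m' -> supp_on C (m - m').
Proof. by move=> h h'; rewrite -scaleN1r; apply/supp_onD/supp_onZ. Qed.

Lemma supp_on_torsion C M (m : M) : torsion m -> supp_on C m.
Proof. by move=> h f _; apply: torsionZ. Qed.

Lemma supp_on0 C M : supp_on C (0 : M).
Proof. exact/supp_on_torsion/torsion0. Qed.

Lemma supp_on_nil M (m : M) : supp_on [::] m -> torsion m.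
Proof. by move=> /(_ 1); rewrite scale1r; apply. Qed.

Lemma supp_on_sub C C' M (m : M) : {subset C <= C'} -> supp_on C m ->
  supp_on C' m.
Proof. by move=> sub h f fC'; apply: h; apply: vanishes_sub fC'. Qed.

Lemma supp_on_mul C C1 C2 M f (m : M) : {subset C <= C1 ++ C2} -> vanishes C1 f ->
  supp_on C m -> supp_on C2 (f *: m).
Proof.
move=> sub fC1 h g gC2; rewrite scalerA mulrC.
exact/h/(vanishesU sub).
Qed.

Lemma supp_on_rad C M r (m : M) : r != 0 -> supp_on C (inj r *: m) -> supp_on C m.
Proof.
move=> r0 h f /h; rewrite scalerA mulrC -scalerA; exact: torsion_inj.
Qed.

(** The norm argument: the product of the differences inj (res b g) - g over B
    vanishes on Gr(B), and modulo g it is the image of the nonzero product of the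
    res b g. *)
Lemma torsion_mul_inv B M g (m : M) : supp_on B m ->
  (forall b, b \in B -> res b g != 0) -> torsion (g *: m) -> torsion m.
Proof.
move=> mB gB gm.
have inv : vanishes B (\prod_(b <- B) (inj (res b g) - g)).
  elim: B {mB gB} => [|b B IH] c; first by [].
  rewrite inE big_cons rmorphM => /orP[/eqP->|/IH->]; last by rewrite mulr0.
  by rewrite rmorphB resK subrr mul0r.
have [q Eq] : exists q, \prod_(b <- B) (inj (res b g) - g)
    = inj (\prod_(b <- B) res b g) + q * g.
  elim: B {mB gB inv} => [|b B [q Eq]].
    by exists 0; rewrite !big_nil rmorph1 mul0r addr0.
  rewrite !big_cons Eq rmorphM.
  exists (inj (res b g) * q - inj (\prod_(j <- B) res j g) - g * q).
  ring.
have := mB _ inv; rewrite Eq scalerDl => h.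
have : torsion (inj (\prod_(b <- B) res b g) *: m).
  have -> : inj (\prod_(b <- B) res b g) *: m =
     (inj (\prod_(b <- B) res b g) *: m + (q * g) *: m) - (q * g) *: m.
    by rewrite addrK.
  by apply: torsionB h _; rewrite -scalerA; apply: torsionZ.
apply: torsion_inj; rewrite big_seq.
by apply: (big_ind (fun r => r != 0)) => [|? ?|b /gB//]; rewrite ?oner_eq0 // => ? ?; apply: mulf_neq0.
Qed.

Lemma separating C B : (forall b, b \in B -> b \notin C) ->
  exists2 g, vanishes C g & forall b, b \in B -> res b g != 0.
Proof.
have one D y : y \notin D -> exists2 g, vanishes D g & res y g != 0.
  elim: D => [|d D IH] /=; first by exists 1; rewrite // rmorph1 oner_eq0.
  rewrite inE negb_or eq_sym => /andP[/sep[f fd fy] /IH[g gD gy]].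
  exists (f * g); last by rewrite rmorphM mulf_neq0.
  by move=> c; rewrite inE rmorphM => /orP[/eqP->|/gD->]; rewrite ?fd ?mul0r ?mulr0.
elim: B => [|b B IH] h; first by exists 0 => // c _; rewrite rmorph0.
have [|g gC gB] := IH; first by move=> c cB; apply: h; rewrite inE cB orbT.
have [gb|gb] := eqVneq (res b g) 0; last first.
  by exists g => // c; rewrite inE => /orP[/eqP->|/gB].
have bB : b \notin B by apply: contraTN isT => /gB; rewrite gb eqxx.
have bC : b \notin C by apply: h; rewrite inE eqxx.
have [g' g'C g'b] : exists2 g', vanishes (C ++ B) g' & res b g' != 0.
  by apply: one; rewrite mem_cat negb_or bC.
exists (g + g').
  by move=> c cC; rewrite rmorphD gC // g'C ?addr0 // mem_cat cC.
move=> c; rewrite inE rmorphD => /orP[/eqP->|cB]; first by rewrite gb add0r.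
by rewrite [X in _ + X]g'C ?addr0 ?gB // mem_cat cB orbT.
Qed.

Lemma supp_onI C C' D M (m : M) :
  (forall c, c \in C -> c \in C' -> c \in D) ->
  supp_on C m -> supp_on C' m -> supp_on D m.
Proof.
move=> sub mC mC' f fD.
pose C1 := [seq c <- C | c \notin D].
have [g gC' gC1] : exists2 g, vanishes [seq c <- C' | c \notin D] g &
    forall b, b \in C1 -> res b g != 0.
  apply: separating => b; rewrite !mem_filter => /andP[bD bC].
  by rewrite bD /=; apply: contraNN bD; apply: sub.
apply: (torsion_mul_inv (B := C1) (g := g)) => //.
  apply: supp_on_mul mC => [c cC|]; last exact: fD.
  by rewrite mem_cat mem_filter cC andbT orbN.
rewrite scalerA; apply: mC' => c cC'; rewrite rmorphM.
have [cD|cD] := boolP (c \in D); first by rewrite fD ?mulr0.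
by rewrite gC' ?mul0r // mem_filter cD.
Qed.

Lemma supp_on_cons_inv x C M f (m : M) : res x f != 0 -> supp_on (x :: C) m ->
  supp_on C (f *: m) -> supp_on C m.
Proof.
move=> fx mC fm; apply: (supp_on_rad fx).
have -> : inj (res x f) *: m = f *: m - (f - inj (res x f)) *: m.
  by rewrite scalerBl opprB addrC subrK.
apply: supp_onB => //; apply: (supp_on_mul (C := x :: C) (C1 := [:: x])) => //.
by move=> c; rewrite inE => /eqP->; rewrite rmorphB resK subrr.
Qed.

Lemma scale_res x C M f (m : M) : supp_on (x :: C) m ->
  supp_on C (f *: m - inj (res x f) *: m).
Proof.
move=> mC; rewrite -scalerBl; apply: (supp_on_mul (C1 := [:: x])) mC => //.
by move=> c; rewrite inE => /eqP->; rewrite rmorphB resK subrr.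
Qed.

(** * Subquotients with a dual basis, and complexes of such *)

Definition additive_on M (N : M -> Prop) (V : zmodType) (p : M -> V) :=
  forall m m', N m -> N m' -> p (m + m') = p m + p m'.

(** The subquotient N / N' is projective over the right action, in the form of
    a dual basis e_i, p_i.  Subquotients are handled as pairs of predicates on M,
    which avoids quotient types; the maps p_i are total functions that are
    meaningful on N. *)
Definition dual_basis M (N' N : M -> Prop) :=
  exists (I : eqType) (e : I -> M) (p : I -> M -> R),
  [/\ forall i, N (e i),
      forall i, additive_on N (p i),
      forall i r m, N m -> p i (inj r *: m) = r * p i m,
      forall i m, N' m -> p i m = 0
    & forall m, N m -> exists s, [/\ uniq s, forall i, i \notin s -> p i m = 0
        & N' (m - \sum_(i <- s) inj (p i m) *: e i)]].

Record right_submodule M (N : M -> Prop) : Prop := RSub {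
  rsub0 : N 0;
  rsubD : forall m m', N m -> N m' -> N (m + m');
  rsubZ : forall r m, N m -> N (inj r *: m) }.

Lemma rsubN M (N : M -> Prop) m : right_submodule N -> N m -> N (- m).
Proof.
by move=> h Nm; rewrite -scaleN1r -(rmorph1 inj) -rmorphN; apply: rsubZ.
Qed.

Lemma rsubB M (N : M -> Prop) m m' : right_submodule N -> N m -> N m' -> N (m - m').
Proof. by move=> h Nm Nm'; apply: rsubD => //; apply: rsubN. Qed.

Lemma rsub_sum M (N : M -> Prop) (I : eqType) (s : seq I) (F : I -> M) :
  right_submodule N -> (forall i, i \in s -> N (F i)) -> N (\sum_(i <- s) F i).
Proof.
move=> h; elim: s => [|i s IH] hF; first by rewrite big_nil; apply: rsub0.
rewrite big_cons; apply: rsubD; [by []|by apply: hF; rewrite inE eqxx|].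
by apply: IH => j js; apply: hF; rewrite inE js orbT.
Qed.

Lemma rsub_transl M (N : M -> Prop) m m' : right_submodule N -> N (m - m') -> N m' -> N m.
Proof. by move=> h d Nm'; rewrite -(subrK m' m); apply: rsubD. Qed.

Lemma rsub_sub_sym M (N : M -> Prop) m m' : right_submodule N -> N (m - m') -> N (m' - m).
Proof. by move=> h d; rewrite -opprB; apply: rsubN. Qed.

Lemma rsub_trans M (N : M -> Prop) m1 m2 m3 : right_submodule N -> N (m1 - m2) ->
  N (m2 - m3) -> N (m1 - m3).
Proof.
move=> h d d'; have -> : m1 - m3 = (m1 - m2) + (m2 - m3) by rewrite addrA subrK.
exact: rsubD.
Qed.

Lemma rsub_on C M : right_submodule (@supp_on C M).
Proof.
split; [exact: supp_on0|by move=> *; apply: supp_onD|by move=> *; apply: supp_onZ].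
Qed.

Lemma additive_on0 M (N : M -> Prop) (V : zmodType) (p : M -> V) :
  right_submodule N -> additive_on N p -> p 0 = 0.
Proof.
move=> h a; apply: (addrI (p 0)); rewrite -a; try exact: rsub0.
by rewrite !addr0.
Qed.

Lemma additive_onN M (N : M -> Prop) (V : zmodType) (p : M -> V) m :
  right_submodule N -> additive_on N p -> N m -> p (- m) = - p m.
Proof.
move=> h a Nm; apply: (addrI (p m)); rewrite -a //; last exact: rsubN.
by rewrite !subrr (additive_on0 h a).
Qed.

Lemma additive_onB M (N : M -> Prop) (V : zmodType) (p : M -> V) m m' :
  right_submodule N -> additive_on N p -> N m -> N m' -> p (m - m') = p m - p m'.
Proof.
move=> h a Nm Nm'; rewrite a ?(additive_onN h a) //; exact: rsubN.
Qed.

(** Multiplication by b1 is injective, and b1 divides v as soon as it divides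
    b2 * v. *)
Definition coprime_pair (b1 b2 : R) := b1 != 0 /\
  forall u v, b1 * u = b2 * v -> exists w, v = b1 * w.

(** The cancellation of a coprime pair: applied to the coordinates p_i, the
    relation b1 u = b2 v shows that b1 divides each coordinate of v. *)
Lemma dual_basis_coprime M (N' N : M -> Prop) b1 b2 u v :
  right_submodule N -> right_submodule N' -> (forall m, N' m -> N m) -> dual_basis N' N ->
  coprime_pair b1 b2 -> N u -> N v ->
  N' (inj b1 *: u - inj b2 *: v) ->
  exists2 w, N w & N' (v - inj b1 *: w).
Proof.
move=> hN hN' NN [I [e [p [eN pD pZ pN' pS]]]] [b10 cop] Nu Nv d.
have [s [us sv hv]] := pS v Nv.
have /choice[w Ew] i : exists w, p i v = b1 * w.
  apply: (cop (p i u)); rewrite -!pZ //.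
  have := pN' i _ d; rewrite (additive_onB hN (pD i)); try exact: rsubZ.
  by move/eqP; rewrite subr_eq0 => /eqP.
exists (\sum_(i <- s) inj (w i) *: e i).
  by apply: rsub_sum => // i _; apply: rsubZ.
rewrite scaler_sumr; congr N': hv; congr (_ - _); apply: eq_bigr => i _.
by rewrite Ew rmorphM scalerA.
Qed.

Lemma dual_basis_torsionfree M (N' N : M -> Prop) r m :
  right_submodule N' -> dual_basis N' N -> N m -> r != 0 -> N' (inj r *: m) -> N' m.
Proof.
move=> hN' [I [e [p [eN pD pZ pN' pS]]]] Nm r0 Nrm.
have [s [us sv hv]] := pS m Nm.
have p0 i : p i m = 0.
  by have /eqP := pN' i _ Nrm; rewrite pZ // mulf_eq0 (negPf r0) => /eqP.
by move: hv; rewrite big1 ?subr0 // => i _; rewrite p0 rmorph0 scale0r.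
Qed.

(** Complexes without gradings: extensions and lifts of maps are needed only up to
    taking degree-zero parts, and doubling then has no shifts to keep track of. *)
Record ungraded_complex := UCx {
  uob :> int -> lmodType A;
  ud : forall i, {linear uob i -> uob (i + 1)};
  udd : forall i (m : uob i), ud (i + 1) (ud i m) = 0 }.

Definition family (X : ungraded_complex) := forall i, X i -> Prop.

Definition ubounded (X : ungraded_complex) :=
  exists b : nat, forall i : int, (b < `|i|)%N -> forall m : X i, m = 0.

Definition acyclic_on (X : ungraded_complex) (N' N : family X) :=
  forall i (m : X (i + 1)), N _ m -> N' _ (ud X _ m) ->
    exists2 v : X i, N _ v & N' _ (m - ud X _ v).

Definition good (X : ungraded_complex) (N' N : family X) :=
  (forall i, dual_basis (N' i) (N i)) /\ acyclic_on N' N.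

(** The maps f i induce an isomorphism N / N' -> K / K' of complexes of right
    modules.  They need not be additive off N, nor commute with the left action. *)
Record subq_iso (X Y : ungraded_complex) (N' N : family X)
    (K' K : family Y) (f : forall i, X i -> Y i) : Prop := SubqIso {
  si_N' : forall i, right_submodule (N' i); si_N : forall i, right_submodule (N i);
  si_NN : forall i m, N' i m -> N i m;
  si_K' : forall i, right_submodule (K' i); si_K : forall i, right_submodule (K i);
  si_KK : forall i m, K' i m -> K i m;
  si_dN : forall i m, N i m -> N _ (ud X i m);
  si_dN' : forall i m, N' i m -> N' _ (ud X i m);
  si_dK' : forall i m, K' i m -> K' _ (ud Y i m);
  si_fD : forall i, additive_on (N i) (f i);
  si_fZ : forall i r m, N i m -> f i (inj r *: m) = inj r *: f i m;
  si_fd : forall i m, N i m -> f _ (ud X i m) = ud Y i (f i m);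
  si_fN : forall i m, N i m -> K i (f i m);
  si_fN' : forall i m, N i m -> (K' i (f i m) <-> N' i m);
  si_surj : forall i k, K i k -> exists2 m, N i m & K' i (k - f i m) }.

Section Transport.
Variables (X Y : ungraded_complex) (N' N : family X)
  (K' K : family Y) (f : forall i, X i -> Y i).
Arguments f : clear implicits.
Arguments N : clear implicits.
Arguments N' : clear implicits.
Arguments K : clear implicits.
Arguments K' : clear implicits.
Hypothesis iso : subq_iso N' N K' K f.

Let fB i m m' : N i m -> N i m' -> f i (m - m') = f i m - f i m'.
Proof. apply: additive_onB; [exact: (si_N iso)|exact: (si_fD iso)]. Qed.

Let fS i (I : eqType) (s : seq I) (F : I -> X i) : (forall j, N i (F j)) ->
  f i (\sum_(j <- s) F j) = \sum_(j <- s) f i (F j).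
Proof.
move=> NF; elim: s => [|j s IH].
  rewrite !big_nil; exact: (additive_on0 (si_N iso i) (@si_fD _ _ _ _ _ _ _ iso i)).
rewrite !big_cons (si_fD iso) ?IH //.
apply: rsub_sum => //; exact: (si_N iso).
Qed.

Let fE i m m' : N i m -> N i m' -> K' i (f i m - f i m') -> N' i (m - m').
Proof.
move=> Nm Nm'; rewrite -fB //; apply: (si_fN' iso _).1.
by apply: rsubB => //; apply: (si_N iso).
Qed.

Lemma good_push : good N' N -> good K' K.
Proof.
move=> [db ac]; split=> [i|i k Kk Kdk].
  have [I [e [p [eN pD pZ pN' pS]]]] := db i.
  have NP := si_N iso i; have N'P := si_N' iso i.
  have KP := si_K iso i; have K'P := si_K' iso i.
  have /choice[l lP] k : exists m, K i k -> N i m /\ K' i (k - f i m).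
    have [Kk|nK] := pselect (K i k); last by exists 0 => /nK.
    by have [m ? ?] := si_surj iso Kk; exists m.
  have pE j m m' : N i m -> N i m' -> N' i (m - m') -> p j m = p j m'.
    move=> Nm Nm' /(pN' j)/eqP.
    by rewrite (additive_onB NP (pD j)) // subr_eq0 => /eqP.
  exists I, (fun j => f i (e j)), (fun j k => p j (l k)); split.
  - by move=> j; apply: (si_fN iso).
  - move=> j k k' Kk Kk'; have [Nl Dl] := lP _ Kk; have [Nl' Dl'] := lP _ Kk'.
    have [N2 D2] := lP _ (rsubD KP Kk Kk').
    rewrite -pD //; apply: pE => //; first exact: rsubD.
    apply: fE => //; first exact: rsubD.
    rewrite (si_fD iso) //; apply: (rsub_trans K'P (rsub_sub_sym K'P D2)).
    by rewrite opprD addrACA; apply: rsubD.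
  - move=> j r k Kk; have [Nl Dl] := lP _ Kk.
    have [N2 D2] := lP _ (rsubZ KP r Kk).
    rewrite -pZ //; apply: pE => //; first exact: rsubZ.
    apply: fE => //; first exact: rsubZ.
    rewrite (si_fZ iso) //; apply: (rsub_trans K'P (rsub_sub_sym K'P D2)).
    by rewrite -scalerBr; apply: rsubZ.
  - move=> j k K'k; have [Nl Dl] := lP _ (si_KK iso K'k).
    apply: pN'; apply/(si_fN' iso) => //.
    apply: (rsub_transl (m' := k) K'P) => //; exact: rsub_sub_sym.
  move=> k Kk; have [Nl Dl] := lP _ Kk.
  have [s [us s0 sE]] := pS _ Nl; exists s; split=> //.
  have -> : \sum_(j <- s) inj (p j (l k)) *: f i (e j) =
      f i (\sum_(j <- s) inj (p j (l k)) *: e j).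
    rewrite fS => [|j]; last exact: rsubZ.
    by apply: eq_bigr => j _; rewrite (si_fZ iso).
  apply: (rsub_trans K'P Dl).
  have NS : N i (\sum_(j <- s) inj (p j (l k)) *: e j).
    by apply: rsub_sum => // j _; apply: rsubZ.
  by rewrite -fB //; apply/(si_fN' iso) => //; apply: rsubB.
have K'P := si_K' iso.
have [m Nm Dm] := si_surj iso Kk.
have N'dm : N' _ (ud X _ m).
  apply/(si_fN' iso); first exact: (si_dN iso).
  rewrite (si_fd iso) //; apply: (rsub_transl (K'P _) (m' := ud Y _ k)) => //.
  by rewrite -linearB; apply: (si_dK' iso); apply: rsub_sub_sym (K'P _) Dm.
have [v Nv Dv] := ac _ _ Nm N'dm.
exists (f _ v); first exact: (si_fN iso).
apply: (rsub_trans (K'P _) Dm).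
rewrite -(si_fd iso) // -fB //; last exact: (si_dN iso).
apply/(si_fN' iso) => //; apply: rsubB => //; [exact: (si_N iso)|exact: (si_dN iso)].
Qed.

Lemma good_pull : good K' K -> good N' N.
Proof.
move=> [db ac]; split=> [i|i m Nm N'dm].
  have [I [e [p [eN pD pZ pN' pS]]]] := db i.
  have NP := si_N iso i; have N'P := si_N' iso i.
  have KP := si_K iso i; have K'P := si_K' iso i.
  have /choice[e' eP] j : exists m, N i m /\ K' i (e j - f i m).
    by have [m ? ?] := si_surj iso (eN j); exists m.
  exists I, e', (fun j m => p j (f i m)); split.
  - by move=> j; case: (eP j).
  - by move=> j m m' Nm Nm'; rewrite (si_fD iso) // pD //; apply: (si_fN iso).
  - by move=> j r m Nm; rewrite (si_fZ iso) // pZ //; apply: (si_fN iso).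
  - by move=> j m N'm; apply: pN'; apply/(si_fN' iso) => //; apply: (si_NN iso).
  move=> m Nm; have [s [us s0 sE]] := pS _ (si_fN iso Nm).
  exists s; split=> //.
  have NS : N i (\sum_(j <- s) inj (p j (f i m)) *: e' j).
    by apply: rsub_sum => // j _; apply: rsubZ => //; case: (eP j).
  apply: fE => //; rewrite fS => [|j]; last by apply: rsubZ => //; case: (eP j).
  apply: (rsub_trans K'P sE).
  rewrite -sumrB; apply: rsub_sum => // j _; have [Ne De] := eP j.
  by rewrite (si_fZ iso) // -scalerBr; apply: rsubZ.
have Kd : K' _ (ud Y _ (f _ m)).
  rewrite -(si_fd iso) //; apply/(si_fN' iso) => //; exact: (si_dN iso).
have [v Kv Dv] := ac _ _ (si_fN iso Nm) Kd.
have [n Nn Dn] := si_surj iso Kv.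
have K'P := si_K' iso.
exists n => //; apply: fE => //; first exact: (si_dN iso).
rewrite (si_fd iso) //; apply: (rsub_trans (K'P _) Dv).
by rewrite -linearB; apply: (si_dK' iso).
Qed.

End Transport.

(** The long exact sequence for N2 <= N1 <= N0, and the concatenation of dual
    bases: coordinates on N1 / N2 are applied to the remainder t m of m after its
    coordinates on N0 / N1 have been split off. *)
Lemma good_ext (X : ungraded_complex) (N2 N1 N0 : family X) :
  (forall i, right_submodule (N2 i)) -> (forall i, right_submodule (N1 i)) -> (forall i, right_submodule (N0 i)) ->
  (forall i m, N2 i m -> N1 i m) -> (forall i m, N1 i m -> N0 i m) ->
  (forall i m, N1 i m -> N1 _ (ud X i m)) ->
  good N2 N1 -> good N1 N0 -> good N2 N0.
Proof.
move=> h2 h1 h0 N21 N10 dN1 [db2 ac2] [db1 ac1].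
split=> [i|i m Nm N2dm]; last first.
  have [v Nv Dv] := ac1 _ _ Nm (N21 _ _ N2dm).
  have [|w Nw Dw] := ac2 _ _ Dv; first by rewrite linearB udd subr0.
  exists (v + w); first by apply: rsubD => //; apply: N10.
  by rewrite linearD opprD addrA.
have [I' [e' [p' [e'N p'D p'Z p'N' p'S]]]] := db2 i.
have [I [e [p [eN pD pZ pN' pS]]]] := db1 i.
have P0 := h0 i; have P1 := h1 i; have P2 := h2 i.
have /choice[s sP] m : exists s : seq I, N0 i m -> [/\ uniq s,
    forall j, j \notin s -> p j m = 0 & N1 i (m - \sum_(j <- s) inj (p j m) *: e j)].
  have [Nm|nN] := pselect (N0 i m); last by exists [::] => /nN.
  by have [s ?] := pS _ Nm; exists s.
pose t m := m - \sum_(j <- s m) inj (p j m) *: e j.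
have tN m : N0 i m -> N1 i (t m) by move=> /sP[].
have tE m s' : N0 i m -> uniq s' -> (forall j, j \notin s' -> p j m = 0) ->
    t m = m - \sum_(j <- s') inj (p j m) *: e j.
  move=> Nm us' s'0; have [us s0 _] := sP _ Nm; congr (_ - _).
  by apply: eq_big_support => // j /[dup]; [move/s0 ->|move/s'0 ->] => _;
     rewrite rmorph0 scale0r.
have tD m m' : N0 i m -> N0 i m' -> t (m + m') = t m + t m'.
  move=> Nm Nm'; have [us s0 _] := sP _ Nm; have [us' s0' _] := sP _ Nm'.
  have cs j : j \notin undup (s m ++ s m') -> p j m = 0 /\ p j m' = 0.
    by rewrite mem_undup mem_cat negb_or => /andP[/s0 ? /s0' ?].
  rewrite !(@tE _ (undup (s m ++ s m'))) ?undup_uniq //; last first.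
  - by move=> j /cs[? ?]; rewrite pD // addrC; apply/eqP; rewrite addr_eq0 => //; apply/eqP; rewrite (_ : p j m = 0) ?oppr0.
  - exact: rsubD.
  - by move=> j /cs[].
  - by move=> j /cs[].
  rewrite addrACA -opprD -big_split; congr (_ - _); apply: eq_bigr => j _.
  by rewrite pD // rmorphD scalerDl.
have tZ r m : N0 i m -> t (inj r *: m) = inj r *: t m.
  move=> Nm; have [us s0 _] := sP _ Nm.
  rewrite !(@tE _ (s m)) //.
  - rewrite scalerBr scaler_sumr; congr (_ - _); apply: eq_bigr => j _.
    by rewrite pZ // rmorphM scalerA.
  - exact: rsubZ.
  by move=> j /s0 E; rewrite pZ // E mulr0.
have tid m : N1 i m -> t m = m.
  move=> N1m; rewrite (@tE _ [::]) ?big_nil ?subr0 //; first exact: N10.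
  by move=> j _; apply: pN'.
exists (I + I')%type, (fun j => match j with inl j => e j | inr j => e' j end).
exists (fun j m => match j with inl j => p j m | inr j => p' j (t m) end); split.
- by case=> j //; apply: N10.
- by case=> j m m' Nm Nm'; rewrite ?pD // tD // p'D //; apply: tN.
- by case=> j r m Nm; rewrite ?pZ // tZ // p'Z //; apply: tN.
- case=> j m N2m; first by apply: pN'; apply: N21.
  by rewrite tid ?p'N' //; apply: N21.
move=> m Nm; have [us s0 _] := sP _ Nm.
have [s' [us' s'0 s'E]] := p'S _ (tN _ Nm).
exists ([seq inl j | j <- s m] ++ [seq inr j | j <- s']); split.
- rewrite cat_uniq !map_inj_uniq ?us ?us' ?andbT //=; last 2 first.
  + by move=> ? ? [].
  + by move=> ? ? [].
  by apply/hasPn => j /mapP[j' _ ->]; apply/mapP => -[].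
- move=> j; rewrite mem_cat negb_or => /andP[j1 j2]; case: j j1 j2 => j j1 j2.
    by apply: s0; apply: contraNN j1 => ?; apply/mapP; exists j.
  by apply: s'0; apply: contraNN j2 => ?; apply/mapP; exists j.
by rewrite big_cat !big_map /= opprD addrA.
Qed.

(** * Chains of graphs and their rearrangement *)

(** Two functions that vanish on Gr(x) and are coprime on Gr(y), so
    that Gr(x) meets Gr(y) in codimension at least two. *)
Definition unrel x y := exists a1 a2,
  [/\ res x a1 = 0, res x a2 = 0 & coprime_pair (res y a1) (res y a2)].

Lemma unrel_neq x y : unrel x y -> x != y.
Proof.
move=> [a1 [a2 [h1 _ [h2 _]]]]; apply: contraNneq h2 => Exy.
by rewrite -Exy h1 eqxx.
Qed.

Definition sfam (X : ungraded_complex) C : family X := fun i m => supp_on C m.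

Lemma sfam_eq (X : ungraded_complex) C C' : C =i C' -> @sfam X C = @sfam X C'.
Proof.
move=> E; apply: functional_extensionality_dep => i; apply: funext => m.
by apply: propext; split; apply: supp_on_sub => c; rewrite E.
Qed.

Definition good_at (X : ungraded_complex) x C := good (@sfam X C) (@sfam X (x :: C)).

Lemma good_at_eq X x C C' : C =i C' -> good_at X x C -> good_at X x C'.
Proof.
move=> E; rewrite /good_at (sfam_eq _ E) (@sfam_eq X (x :: C) (x :: C')) //.
by move=> c; rewrite !inE E.
Qed.

Lemma supp_on_ud (X : ungraded_complex) C i (m : X i) : supp_on C m -> supp_on C (ud X i m).
Proof.
move=> h f /h[r r0 E]; exists r => //.
by have := congr1 (ud X i) E; rewrite linear0 (linearZ_LR (ud X i)) (linearZ_LR (ud X i)).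
Qed.

(** An inclusion of subquotients is an isomorphism if the smaller pair is the
    intersection with the larger one and the larger one is generated by the
    smaller. *)
Lemma sfam_iso (X : ungraded_complex) C' C D' D : {subset C' <= C} -> {subset D' <= D} ->
  {subset C <= D} -> {subset C' <= D'} ->
  (forall c, c \in C -> c \in D' -> c \in C') ->
  (forall i (k : X i), supp_on D k ->
     exists2 m, supp_on C m & supp_on D' (k - m)) ->
  subq_iso (@sfam X C') (@sfam X C) (@sfam X D') (@sfam X D) (fun i m => m).
Proof.
move=> C'C D'D CD C'D' I sur; split; rewrite /sfam => //.
- by move=> i; apply: rsub_on.
- by move=> i; apply: rsub_on.
- by move=> i m; apply: supp_on_sub.
- by move=> i; apply: rsub_on.
- by move=> i; apply: rsub_on.
- by move=> i m; apply: supp_on_sub.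
- by move=> i m; apply: supp_on_ud.
- by move=> i m; apply: supp_on_ud.
- by move=> i m; apply: supp_on_ud.
- by move=> i m; apply: supp_on_sub.
- move=> i m mC; split; last exact: supp_on_sub.
  exact: supp_onI mC.
Qed.

(** The step that makes neighbours exchangeable.  With a1, a2 as in [unrel], both
    a1 m and a2 m are supported on Gr(y :: C), and modulo Gr(C) they satisfy
    b2 (a1 m) = b1 (a2 m), where b1, b2 are the restrictions of a1, a2 to Gr(y).
    So a1 m = b1 w there for some w, and w is the component of m at y. *)
Lemma supp_on_split x y C M (m : M) : unrel x y ->
  dual_basis (@supp_on C M) (@supp_on (y :: C) M) -> supp_on [:: x, y & C] m ->
  exists2 u, supp_on (y :: C) u & supp_on (x :: C) (m - u).
Proof.
move=> [a1 [a2 [x1 x2 cop]]] db mxy.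
have am a : res x a = 0 -> supp_on (y :: C) (a *: m).
  move=> xa; apply: (supp_on_mul (C1 := [:: x])) mxy => [|c]; last by rewrite inE => /eqP->; exact: xa.
  by move=> c; rewrite !inE.
have sub : forall c, c \in C -> c \in y :: C by move=> c cC; rewrite inE cC orbT.
have [||||w Nw Dw] := dual_basis_coprime (u := a2 *: m) (v := a1 *: m)
    (rsub_on _ M) (rsub_on _ M) _ db cop.
- by move=> n; apply: supp_on_sub.
- exact: am.
- exact: am.
- have := supp_onB (scale_res a2 (am _ x1)) (scale_res a1 (am _ x2)).
  by rewrite !scalerA [a2 * a1]mulrC opprB addrC addrA subrK.
exists w => //.
have y1 : res y a1 != 0 by case: cop.
apply: (supp_on_cons_inv y1).
  apply: supp_onB; first by apply: supp_on_sub mxy => c; rewrite !inE orbCA.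
  by apply: supp_on_sub Nw => c; rewrite !inE => /orP[->|->]; rewrite ?orbT.
have : supp_on C (a1 *: (m - w)).
  rewrite scalerBr; have -> : a1 *: m - a1 *: w = (a1 *: m - inj (res y a1) *: w)
     - (a1 *: w - inj (res y a1) *: w) by rewrite opprB addrA subrK.
  apply: supp_onB Dw _; exact: scale_res.
by apply: supp_on_sub => c cC; rewrite inE cC orbT.
Qed.

Lemma good_at_cons X x y C : unrel x y -> good_at X y C -> good_at X y (x :: C).
Proof.
move=> xy g; have ne := unrel_neq xy.
apply: good_push (g); apply: sfam_iso => [||||c|i k h].
- by move=> c cC; rewrite inE cC orbT.
- by move=> c cC; rewrite inE cC orbT.
- by move=> c; rewrite !inE => /orP[->|->]; rewrite ?orbT.
- by move=> c cC; rewrite inE cC orbT.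
- rewrite !inE => /orP[/eqP->|//]; by rewrite eq_sym (negPf ne).
apply: (supp_on_split xy); first exact: g.1.
by apply: supp_on_sub h => c; rewrite !inE orbCA.
Qed.

Lemma good_at_uncons X x y C : unrel x y -> good_at X y C ->
  good_at X x (y :: C) -> good_at X x C.
Proof.
move=> xy g g'; have ne := unrel_neq xy.
apply: good_pull (g'); apply: sfam_iso => [||||c|i k h].
- by move=> c cC; rewrite inE cC orbT.
- by move=> c cC; rewrite inE cC orbT.
- by move=> c; rewrite !inE => /orP[->|->]; rewrite ?orbT.
- by move=> c cC; rewrite inE cC orbT.
- by rewrite !inE => /orP[/eqP->|//]; rewrite (negPf ne).
have [u Nu Du] := supp_on_split xy (g.1 i) h.
by exists (k - u); rewrite // opprB addrC subrK.
Qed.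

Fixpoint good_chain X L :=
  if L is x :: C then good_at X x C /\ good_chain X C else True.

Definition supp_all (X : ungraded_complex) L := forall i (m : X i), supp_on L m.

Lemma good_chain_swap X x y C : unrel x y ->
  good_chain X [:: x, y & C] -> good_chain X [:: y, x & C].
Proof.
move=> xy [gx [gy gC]]; split; first exact: good_at_cons.
by split=> //; apply: good_at_uncons gx.
Qed.

Lemma good_chain_bubble X L1 z L3 : (forall w, w \in L1 -> unrel w z) ->
  good_chain X (L1 ++ z :: L3) -> good_chain X (z :: L1 ++ L3).
Proof.
elim: L1 => [|w L1 IH] //= h [gw g].
apply: good_chain_swap; first by apply: h; rewrite inE eqxx.
split; last by apply: IH g => v vL; apply: h; rewrite inE vL orbT.
by apply: good_at_eq gw => c; rewrite inE !mem_cat inE orbCA.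
Qed.

Section Arrangements.
Variable ok : rel W.
Hypothesis okP : forall x y, x != y -> ok x y -> ok y x -> unrel x y.

(** Bubble sort: every pair that has to be exchanged is allowed in both orders,
    hence is unrelated. *)
Lemma good_chain_perm X L L2 : uniq L -> pairwise ok L -> pairwise ok L2 ->
  perm_eq L L2 -> good_chain X L -> good_chain X L2.
Proof.
elim: L2 L => [|z L2 IH] L //= uL pL /andP[zL2 pL2] pE g.
have zL : z \in L by rewrite (perm_mem pE) inE eqxx.
case/splitPr: zL uL pL pE g => L1 L3 uL pL pE g.
have pE' : perm_eq (L1 ++ L3) L2.
  by rewrite -(perm_cons z) -(perm_catCA L1 [:: z] L3) /=.
have h w : w \in L1 -> unrel w z.
  move=> wL; apply: okP.
  - move: uL; rewrite cat_uniq /= negb_or => /and3P[_ /andP[zL1 _] _].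
    by apply: contraNneq zL1 => <-.
  - move: pL; rewrite pairwise_cat => /and3P[/allrelP/(_ w z wL)+ _ _].
    by rewrite inE eqxx; apply.
  have wL2 : w \in L2 by rewrite -(perm_mem pE') mem_cat wL.
  by move/allP: zL2; apply.
have [gz gL] := good_chain_bubble h g; split.
  by apply: good_at_eq gz; apply: perm_mem.
apply: IH gL => //.
- by move: uL; rewrite -(perm_uniq (permEl (perm_catCA [::z] L1 L3))) => /andP[].
move: pL; rewrite !pairwise_cat pairwise_cons allrel_consr.
by case/and3P=> /andP[_ ->] -> /andP[_ ->].
Qed.

End Arrangements.

Lemma supp_on_filter L C M (m : M) : supp_on L m ->
  supp_on C m <-> supp_on [seq c <- C | c \in L] m.
Proof.
move=> mL; split=> [mC|]; last by apply: supp_on_sub => c; rewrite mem_filter => /andP[].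
by apply: supp_onI mL mC => c cL cC; rewrite mem_filter cL.
Qed.

Lemma sfam_filter (X : ungraded_complex) L C : supp_all X L ->
  @sfam X [seq c <- C | c \in L] = @sfam X C.
Proof.
move=> h; apply: functional_extensionality_dep => i; apply: funext => m.
by apply: propext; split=> /(supp_on_filter C (h i m)).
Qed.

Lemma good_refl (X : ungraded_complex) (N : family X) : (forall i, right_submodule (N i)) -> good N N.
Proof.
move=> h; split=> [i|i m Nm _]; last first.
  by exists 0; [exact: rsub0|rewrite linear0 subr0].
exists void, (@of_void _), (fun j _ => of_void _ j).
split; try by case.
by move=> m Nm; exists [::]; split; [by []|by case|rewrite big_nil subr0].
Qed.

(** Graphs off the support contribute zero subquotients. *)
Lemma good_chain_filter X L L2 : supp_all X L ->
  good_chain X [seq x <- L2 | x \in L] -> good_chain X L2.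
Proof.
move=> h; elim: L2 => [|x C IH] //=; case: ifP => [xL [g /IH ?]|xL /IH ?]; split=> //.
  rewrite /good_at -(sfam_filter _ h) -[X in good _ X](sfam_filter _ h) /= xL.
  by [].
rewrite /good_at -(sfam_filter _ h) -[X in good _ X](sfam_filter _ h) /= xL.
by apply: good_refl => i; apply: rsub_on.
Qed.

Section MkLinear.
Variables (M N : lmodType A) (f : M -> N).
Hypothesis f_lin : linear f.
Definition linear_of & linear f := f.
HB.instance Definition _ := GRing.isLinear.Build A M N _ (linear_of f_lin) f_lin.
Definition mklin : {linear M -> N} := linear_of f_lin.
End MkLinear.

(** * Extension and lifting of maps at one graph *)

Definition ext_exact (X : ungraded_complex) (N : lmodType A) :=
  forall i (phi : {linear X (i + 1) -> N}), (forall m : X i, phi (ud X i m) = 0) ->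
  exists psi : {linear X (i + 1 + 1) -> N}, forall m, phi m = psi (ud X (i + 1) m).

Definition lift_exact (N : lmodType A) (X : ungraded_complex) :=
  forall i (phi : {linear N -> X (i + 1)}), (forall m, ud X (i + 1) (phi m) = 0) ->
  exists psi : {linear N -> X i}, forall m, phi m = ud X i (psi m).

(** The functions on Gr(x), as a module with one generator. *)
Definition graph_module x (N : lmodType A) := exists2 n0 : N,
  forall n, exists f, n = f *: n0 & forall f, f *: n0 = 0 <-> res x f = 0.

Lemma graph_module_torsion x (N : lmodType A) (n : N) : graph_module x N -> torsion n -> n = 0.
Proof.
move=> [n0 gen ann] [r r0]; have [f ->] := gen n.
rewrite scalerA => /ann; rewrite rmorphM resK => /eqP.
by rewrite mulf_eq0 (negPf r0) => /eqP/ann.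
Qed.

Lemma graph_module_kill x (N : lmodType A) f (n : N) : graph_module x N -> res x f = 0 ->
  f *: n = 0.
Proof.
move=> [n0 gen ann] fx; have [g ->] := gen n.
by rewrite scalerA; apply/ann; rewrite rmorphM fx mul0r.
Qed.

Lemma graph_module_scale x (N : lmodType A) f (n : N) : graph_module x N ->
  f *: n = inj (res x f) *: n.
Proof.
move=> gN; apply/eqP; rewrite -subr_eq0 -scalerBl; apply/eqP.
by apply: graph_module_kill gN _; rewrite rmorphB resK subrr.
Qed.

Definition right_linear (M N : lmodType A) (f : M -> N) :=
  (forall m m', f (m + m') = f m + f m') /\
  (forall r m, f (inj r *: m) = inj r *: f m).

Section ExtGraph.
Variables (X : ungraded_complex) (x : W) (C : seq W).
Hypothesis xC : x \notin C.
Hypothesis bX : ubounded X.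
Hypothesis sX : supp_all X (x :: C).
Hypothesis gX : good_at X x C.

(** A right-linear contraction of X modulo the sections on Gr(C), in one degree.
    The condition is imposed on the cycles modulo these sections. *)
Definition contraction j (sigma : X (j + 1) -> X j) :=
  [/\ right_linear sigma, forall u, supp_on C u -> sigma u = 0
    & forall u, supp_on C (ud X (j + 1) u) -> supp_on C (u - ud X j (sigma u))].

(** On a dual basis e_i: the contraction in the next degree corrects e_i to a cycle
    modulo the sections on Gr(C), and sigma sends e_i to a preimage of this cycle
    under the differential. *)
Lemma contraction_step j sigma' : contraction (j := j + 1) sigma' ->
  exists sigma, contraction (j := j) sigma.
Proof.
move=> [[sD sZ] s0 sE].
have [I [e [p [_ pD pZ pN' pS]]]] := gX.1 (j + 1).
pose pr (u : X (j + 1)) := u - sigma' (ud X _ u).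
have prB u v : pr (u - v) = pr u - pr v.
  have sN w : sigma' (- w) = - sigma' w.
    by rewrite -scaleN1r -(rmorph1 inj) -rmorphN sZ rmorphN rmorph1 scaleN1r.
  by rewrite /pr linearB sD sN opprD addrACA -opprD.
have prS (s : seq I) (c : I -> R) :
   pr (\sum_(i <- s) inj (c i) *: e i) = \sum_(i <- s) inj (c i) *: pr (e i).
  elim: s => [|i s IH].
    by rewrite !big_nil /pr linear0 s0 ?subrr //; apply: supp_on0.
  rewrite !big_cons -IH /pr linearD (linearZ_LR (ud X _)) sD sZ scalerBr.
  by rewrite opprD addrACA.
have /choice[w wE] i : exists w : X j, supp_on C (pr (e i) - ud X j w).
  have [|v _ Dv] := gX.2 _ (pr (e i)) (sX _); last by exists v.
  rewrite /sfam /pr linearB; apply: sE; rewrite udd; exact: supp_on0.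
have /choice[s sP] u : exists s, [/\ uniq s, forall i, i \notin s -> p i u = 0
        & supp_on C (u - \sum_(i <- s) inj (p i u) *: e i)].
  by apply: pS; apply: sX.
have sumE u s' (F : I -> X j) : uniq s' -> (forall i, i \notin s' -> p i u = 0) ->
    \sum_(i <- s u) inj (p i u) *: F i = \sum_(i <- s') inj (p i u) *: F i.
  move=> us' s'0; have [us su _] := sP u.
  by apply: eq_big_support => // i; [move/su|move/s'0] => ->; rewrite rmorph0 scale0r.
exists (fun u => \sum_(i <- s u) inj (p i u) *: w i); split.
- split=> [u v|r u].
    have [us su _] := sP u; have [us' sv _] := sP v.
    have uu := undup_uniq (s u ++ s v).
    have cs i : i \notin undup (s u ++ s v) -> p i u = 0 /\ p i v = 0.
      by rewrite mem_undup mem_cat negb_or => /andP[/su ? /sv ?].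
    rewrite !(@sumE _ (undup (s u ++ s v))) //; try by move=> i /cs[].
      rewrite -big_split; apply: eq_bigr => i _.
      by rewrite pD ?rmorphD ?scalerDl //; apply: sX.
    by move=> i /cs[pu pv]; rewrite pD ?pu ?pv ?addr0 //; apply: sX.
  have [us su _] := sP u; rewrite (@sumE _ (s u)) //.
    rewrite scaler_sumr; apply: eq_bigr => i _.
    by rewrite pZ ?rmorphM ?scalerA //; apply: sX.
  by move=> i /su pu; rewrite pZ ?pu ?mulr0 //; apply: sX.
- by move=> u uC; rewrite big1 // => i _; rewrite pN' // rmorph0 scale0r.
move=> u du; have [us su Du] := sP u.
have Pu : pr u = u by rewrite /pr s0 ?subr0.
have P0 v : supp_on C v -> pr v = v.
  by move=> vC; rewrite /pr s0 ?subr0 //; apply: supp_on_ud.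
have h := rsub_on C (X (j + 1)).
apply: (rsub_trans h Du).
rewrite -(subKr u (\sum_(i <- s u) _)) -{1}Pu -(P0 _ Du) -prB subKr prS.
rewrite linear_sum -sumrB; apply: rsub_sum => // i _.
by rewrite (linearZ_LR (ud X j)) -scalerBr; apply: supp_onZ.
Qed.

(** Downward induction from a degree above which X vanishes. *)
Lemma contraction_exists j : exists sigma, contraction (j := j) sigma.
Proof.
have [b hb] := bX.
suff main (n : nat) k : b%:Z - n%:Z <= k -> exists sigma, contraction (j := k) sigma.
  by apply: (main (b + `|j|)%N); lia.
elim: n k => [|n IH] k hk.
  exists (fun _ => 0); split=> //.
  - by split=> [? ?|? ?]; rewrite ?addr0 ?scaler0.
  by move=> u _; rewrite linear0 subr0 (hb _ _ u); [exact: supp_on0|lia].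
have [|s' /contraction_step//] := IH (k + 1); lia.
Qed.

(** A map to N kills the sections on Gr(C), as N is torsion free and x is not
    in C.  Hence it can be composed with the contraction, and the composite is linear
    also on the left, because A acts on both sides of it through Gr(x). *)
Lemma ext_exact_graph N : graph_module x N -> ext_exact X N.
Proof.
move=> gN i phi phid.
have phi0 (m : X (i + 1)) : supp_on C m -> phi m = 0.
  move=> mC; have [f fC fx] : exists2 f, vanishes C f & res x f != 0.
    have [b|f fC fx] := @separating C [:: x]; first by rewrite inE => /eqP->.
    by exists f => //; apply: fx; rewrite inE.
  apply: (graph_module_torsion gN); apply: (torsion_inj fx).
  rewrite -(graph_module_scale _ _ gN).
  have [r r0 E] := mC _ fC; exists r => //.
  by rewrite scalerA -linearZ -scalerA E linear0.
have [s [[sD sZ] s0 sE]] := contraction_exists (i + 1).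
have lin : linear (fun u => phi (s u)).
  move=> f u v; rewrite sD linearD; congr (_ + _).
  have -> : f *: u = inj (res x f) *: u + (f *: u - inj (res x f) *: u).
    by rewrite [RHS]addrC subrK.
  rewrite sD (s0 (f *: u - _)) ?addr0; last by apply: scale_res; apply: sX.
  by rewrite sZ linearZ /= -(graph_module_scale _ _ gN).
exists (mklin lin) => m /=.
have [||v _ Dv] := gX.2 i (m - s (ud X _ m)); first exact: sX.
  rewrite /sfam linearB; apply: sE; rewrite udd; exact: supp_on0.
have := phi0 _ Dv; rewrite linearB phid subr0 linearB => /eqP.
by rewrite subr_eq0 => /eqP.
Qed.

End ExtGraph.

(** The image of the generator of N is killed by the functions that vanish on
    Gr(x), so it is a cycle supported on Gr(x).  By exactness there it is the
    boundary of some v supported on Gr(x), and without torsion v is killed by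
    these functions as well. *)
Lemma lift_exact_graph (X : ungraded_complex) x (N : lmodType A) : (forall i (m : X i), torsion m -> m = 0) ->
  good_at X x [::] -> graph_module x N -> lift_exact N X.
Proof.
move=> tX [_ ac] [n0 gen ann] i phi dphi.
have kill f : res x f = 0 -> f *: phi n0 = 0.
  by move=> /ann E; rewrite -linearZ E linear0.
have sup (m : X (i + 1)) : (forall f, res x f = 0 -> f *: m = 0) ->
    supp_on [:: x] m.
  by move=> h f fx; rewrite h ?fx ?inE //; apply: torsion0.
have [||v vx Dv] := ac _ (phi n0); first exact: sup.
  by rewrite dphi; apply: supp_on0.
have Ev : phi n0 = ud X i v.
  by apply/eqP; rewrite -subr_eq0; apply/eqP/tX/supp_on_nil.
have vkill f : res x f = 0 -> f *: v = 0.
  by move=> fx; apply/tX/vx => c; rewrite inE => /eqP->.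
have /choice[g gE] := gen.
have lin : linear (fun n => g n *: v).
  move=> f n n'; apply/eqP; rewrite -subr_eq0 scalerA -scalerDl -scalerBl.
  by apply/eqP/vkill/ann; rewrite scalerBl scalerDl -scalerA -!gE subrr.
exists (mklin lin) => n /=; rewrite (linearZ_LR (ud X i)) -Ev -linearZ.
by rewrite {1}(gE n).
Qed.

Lemma ext_exact_retract X (N B : lmodType A) (io : {linear N -> B})
  (p : {linear B -> N}) : cancel io p -> ext_exact X B -> ext_exact X N.
Proof.
move=> ioK h i phi phid.
have [m|psi E] := h i (io \o phi); first by rewrite /= phid linear0.
by exists (p \o psi) => m; rewrite /= -E /= ioK.
Qed.

Lemma lift_exact_retract X (N B : lmodType A) (io : {linear N -> B})
  (p : {linear B -> N}) : cancel io p -> lift_exact B X -> lift_exact N X.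
Proof.
move=> ioK h i phi dphi.
have [m|psi E] := h i (phi \o p); first exact: dphi.
by exists (psi \o io) => m; rewrite /= -E /= ioK.
Qed.

Lemma ext_exact_sum X (B : lmodType A) (I : finType) (N : I -> lmodType A)
  (io : forall i, {linear N i -> B}) (p : forall i, {linear B -> N i}) :
  (forall b, b = \sum_i io i (p i b)) -> (forall i, ext_exact X (N i)) ->
  ext_exact X B.
Proof.
move=> E h i phi phid.
have /dep_choice[psi psiE] j : exists psi : {linear X (i + 1 + 1) -> N j},
    forall m, p j (phi m) = psi (ud X (i + 1) m).
  by have [m|psi psiE] := h j i (p j \o phi); [rewrite /= phid linear0|exists psi].
have lin : linear (fun m => \sum_j io j (psi j m)).
  move=> f u v; rewrite scaler_sumr -big_split; apply: eq_bigr => j _.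
  by rewrite linearP linearP.
by exists (mklin lin) => m /=; rewrite (E (phi m)); apply: eq_bigr => j _; rewrite psiE.
Qed.

Lemma lift_exact_sum X (B : lmodType A) (I : finType) (N : I -> lmodType A)
  (io : forall i, {linear N i -> B}) (p : forall i, {linear B -> N i}) :
  (forall b, b = \sum_i io i (p i b)) -> (forall i, lift_exact (N i) X) ->
  lift_exact B X.
Proof.
move=> E h i phi dphi.
have /dep_choice[psi psiE] j : exists psi : {linear N j -> X i},
    forall m, phi (io j m) = ud X i (psi m).
  by have [m|psi psiE] := h j i (phi \o io j); [exact: dphi|exists psi].
have lin : linear (fun m => \sum_j psi j (p j m)).
  move=> f u v; rewrite scaler_sumr -big_split; apply: eq_bigr => j _.
  by rewrite linearP linearP.
exists (mklin lin) => m /=; rewrite {1}(E m) !linear_sum.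
by apply: eq_bigr => j _; rewrite psiE.
Qed.

(** * Doubling along a reflection *)

(** The pair (a, b) stands for 1 (x) a + alpha (x) b in A (x) M, the tensor
    product being over the subring of sL-invariants. *)
Definition dcar (M : lmodType A) : Type := (M * M)%type.
HB.instance Definition _ M := GRing.Zmodule.copy (dcar M) (M * M)%type.

Section Doubling.

Variables (tw : W -> W) (sL : {rmorphism A -> A}) (alpha : A).
(* sL is the action of a simple reflection on the left variables, alpha its
   equation and tw the left multiplication by it. *)
Hypothesis sL_dec : forall f, exists uv : A * A,
  [/\ sL uv.1 = uv.1, sL uv.2 = uv.2 & f = uv.1 + alpha * uv.2].
Hypothesis sL_uniq : forall u v, sL u = u -> sL v = v -> u + alpha * v = 0 ->
  u = 0 /\ v = 0.
Hypothesis sL_alpha : sL alpha = - alpha.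
Hypothesis sL_inj : forall r, sL (inj r) = inj r.
Hypothesis twK : involutive tw.
Hypothesis res_tw : forall x f, res (tw x) f = 0 -> res x (sL f) = 0.
Hypothesis res_tw_alpha : forall x, res (tw x) alpha = - res x alpha.
Hypothesis res_alpha2 : forall x, res x alpha + res x alpha != 0.

(** The coefficients of f in the basis 1, alpha over the invariants. *)
Definition evn f := (sval (cid (sL_dec f))).1.
Definition odc f := (sval (cid (sL_dec f))).2.

Lemma sL_evn f : sL (evn f) = evn f.
Proof. by rewrite /evn; case: cid => uv []. Qed.

Lemma sL_odc f : sL (odc f) = odc f.
Proof. by rewrite /odc; case: cid => uv []. Qed.

Lemma evn_odc f : f = evn f + alpha * odc f.
Proof. by rewrite /evn /odc; case: cid => uv []. Qed.

Lemma evn_odc_uniq f u v : sL u = u -> sL v = v -> f = u + alpha * v ->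
  evn f = u /\ odc f = v.
Proof.
move=> su sv E; have [|||e o] := @sL_uniq (evn f - u) (odc f - v).
- by rewrite rmorphB sL_evn su.
- by rewrite rmorphB sL_odc sv.
- by have := evn_odc f; rewrite {1}E => H; rewrite mulrBr addrACA -opprD -H subrr.
by split; apply/eqP; rewrite -subr_eq0 ?e ?o.
Qed.

Lemma evn_inv u : sL u = u -> evn u = u /\ odc u = 0.
Proof. by move=> su; apply: evn_odc_uniq; rewrite ?rmorph0 ?mulr0 ?addr0. Qed.

Lemma evn_alpha : evn alpha = 0 /\ odc alpha = 1.
Proof. by apply: evn_odc_uniq; rewrite ?rmorph0 ?rmorph1 ?mulr1 ?add0r. Qed.

Lemma evn_odcD f g : evn (f + g) = evn f + evn g /\ odc (f + g) = odc f + odc g.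
Proof.
apply: evn_odc_uniq; rewrite ?rmorphD ?sL_evn ?sL_odc //.
by rewrite {1}(evn_odc f) {1}(evn_odc g) mulrDr addrACA.
Qed.

Lemma evn_odcM f g : evn (f * g) = evn f * evn g + alpha ^+ 2 * (odc f * odc g) /\
  odc (f * g) = evn f * odc g + odc f * evn g.
Proof.
apply: evn_odc_uniq.
- by rewrite expr2 rmorphD !rmorphM !sL_evn /= !sL_alpha mulrNN !sL_odc.
- by rewrite rmorphD !rmorphM !sL_evn !sL_odc.
by rewrite {1}(evn_odc f) {1}(evn_odc g); ring.
Qed.

Definition dscale M f (m : dcar M) : dcar M :=
  (evn f *: m.1 + (alpha ^+ 2 * odc f) *: m.2, odc f *: m.1 + evn f *: m.2).

Section DoubleModule.
Variable M : lmodType A.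

Fact dscaleA f g (m : dcar M) : dscale f (dscale g m) = dscale (f * g) m.
Proof.
have [E O] := evn_odcM f g; rewrite /dscale E O /=.
rewrite !scalerDr !scalerA; congr pair; rewrite addrACA -!scalerDl;
  congr (_ *: _ + _ *: _); ring.
Qed.

Fact dscale1 : left_id 1 (@dscale M).
Proof.
case=> a b; have [E O] := evn_inv (rmorph1 sL).
by rewrite /dscale E O /= mulr0 !scale0r !scale1r addr0 add0r.
Qed.

Fact dscaleDr : right_distributive (@dscale M) +%R.
Proof. by move=> f [a b] [a' b']; rewrite /dscale /= !scalerDr; congr pair; rewrite addrACA. Qed.

Fact dscaleDl (m : dcar M) : {morph (@dscale M)^~ m : f g / f + g}.
Proof.
move=> f g; have [E O] := evn_odcD f g.
by rewrite /dscale E O mulrDr !scalerDl; congr pair; rewrite addrACA.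
Qed.

Definition dmod : lmodType A := HB.pack_for (lmodType A) (dcar M)
  (GRing.Zmodule_isLmodule.Build A (dcar M) dscaleA dscale1 dscaleDr dscaleDl).

Lemma dscaleE f (m : dmod) : f *: m =
  (evn f *: m.1 + (alpha ^+ 2 * odc f) *: m.2, odc f *: m.1 + evn f *: m.2).
Proof. by []. Qed.

Lemma dscale_inv f (m : dmod) : sL f = f -> f *: m = (f *: m.1, f *: m.2).
Proof.
move=> /evn_inv[E O]; rewrite dscaleE E O mulr0 !scale0r addr0 add0r; by [].
Qed.

Lemma dscale_alpha (m : dmod) : alpha *: m = (alpha ^+ 2 *: m.2, m.1).
Proof.
have [E O] := evn_alpha.
by rewrite dscaleE E O mulr1 !scale0r scale1r addr0 add0r.
Qed.

Lemma torsion_double (m : dmod) : torsion m <-> torsion m.1 /\ torsion m.2.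
Proof.
split=> [[r r0]|[[r r0 h1] [r' r'0 h2]]].
  by rewrite dscale_inv // => -[h1 h2]; split; exists r.
exists (r * r'); first exact: mulf_neq0.
rewrite dscale_inv // rmorphM -[X in (_, X)]scalerA h2 scaler0.
by rewrite mulrC -scalerA h1 scaler0.
Qed.

End DoubleModule.

Definition stable C := forall c, c \in C -> tw c \in C.

Lemma vanishes_evn C f : stable C -> vanishes C f ->
  vanishes C (evn f) /\ vanishes C (odc f).
Proof.
move=> st fC.
have h c : c \in C -> res c (evn f) = 0 /\ res c (odc f) = 0.
  move=> cC; have h1 := fC _ cC; have := res_tw (fC _ (st _ cC)).
  rewrite {1}(evn_odc f) rmorphD rmorphM sL_alpha sL_evn sL_odc mulNr rmorphB rmorphM.
  move: h1; rewrite {1}(evn_odc f) rmorphD rmorphM.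
  set u := res c (evn f); set v := res c (odc f) => h1 h2.
  have v0 : v = 0.
    have : (res c alpha + res c alpha) * v = 0.
      have -> : (res c alpha + res c alpha) * v =
        (u + res c alpha * v) - (u - res c alpha * v) by ring.
      by rewrite h1 h2 subrr.
    by move/eqP; rewrite mulf_eq0 (negPf (res_alpha2 c)) => /eqP.
  by move: h1; rewrite v0 mulr0 addr0.
by split=> c /h[].
Qed.

(** A function vanishes on a union of graphs stable under tw if and only if both of
    its coefficients do: restrict it to Gr(x) and to Gr(tw x) and solve for the
    coefficients, which is possible as res x alpha is not its own negative. *)
Lemma supp_on_double C M (m : dmod M) : stable C ->
  supp_on C m <-> supp_on C m.1 /\ supp_on C m.2.
Proof.
move=> st; split=> [h|[h1 h2] f fC]; last first.
  have [fe fo] := vanishes_evn st fC; apply/torsion_double; rewrite dscaleE /=.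
  split; apply: torsionD; try exact: h1; try exact: h2.
  by apply: h2; apply: vanishesM.
suff hh f : vanishes C f -> torsion (f *: m.1) /\ torsion (f *: m.2).
  by split=> f /hh[].
move=> fC; have [fe fo] := vanishes_evn st fC.
have /torsion_double := h _ fe; rewrite dscale_inv ?sL_evn //= => -[e1 e2].
have /torsion_double := h _ fo; rewrite dscale_inv ?sL_odc //= => -[o1 o2].
by rewrite {1 2}(evn_odc f) !scalerDl -!scalerA; split; apply: torsionD => //;
  apply: torsionZ.
Qed.

Section DoubleComplex.
Variable X : ungraded_complex.

Definition dud_fun i (m : dmod (X i)) : dmod (X (i + 1)) :=
  (ud X i m.1, ud X i m.2).

Fact dud_linear i : linear (@dud_fun i).
Proof.
move=> f m m'; rewrite /dud_fun !dscaleE /=; congr pair;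
  by rewrite !linearD /= !(linearZ_LR (ud X i)).
Qed.

Fact dud_dud i (m : dmod (X i)) :
  mklin (@dud_linear (i + 1)) (mklin (@dud_linear i) m) = 0.
Proof. by congr pair; apply: udd. Qed.

Definition dcx : ungraded_complex := UCx dud_dud.

Lemma dud_E i (m : dcx i) : ud dcx i m = (ud X i m.1, ud X i m.2).
Proof. by []. Qed.

Lemma dcx_bounded : ubounded X -> ubounded dcx.
Proof. by move=> [b hb]; exists b => i /hb h [m1 m2]; rewrite (h m1) (h m2). Qed.

Lemma dcx_supp_all L : stable L -> supp_all X L -> supp_all dcx L.
Proof. by move=> st h i m; apply/supp_on_double. Qed.

Variables (z : W) (C : seq W).
Hypothesis st : stable C.

Let D := [:: z, tw z & C].
Let beta : R := res z alpha.

Let stD : stable D.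
Proof.
move=> c; rewrite /D !inE => /or3P[/eqP->|/eqP->|/st->]; rewrite ?twK ?eqxx ?orbT //.
Qed.

Let sub1 : {subset C <= tw z :: C}.
Proof. by move=> c cC; rewrite inE cC orbT. Qed.

Let sub2 : {subset tw z :: C <= D}.
Proof. by move=> c cC; rewrite inE cC orbT. Qed.

Let sub0 : {subset C <= D}.
Proof. by move=> c /sub1/sub2. Qed.

Lemma supp_on_beta M (b : M) : supp_on D b ->
  supp_on C ((alpha ^+ 2 - inj beta ^+ 2) *: b).
Proof.
apply: (supp_on_mul (C1 := [:: z; tw z])) => // c.
rewrite !inE => /orP[]/eqP->; rewrite rmorphB !rmorphXn /= resK ?subrr //.
by rewrite res_tw_alpha sqrrN subrr.
Qed.

(** The function alpha + inj beta vanishes on Gr(tw z) and not on Gr(z), where it is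
    2 beta; multiplication by it tests whether there is a component at z. *)
Lemma double_supp_tw M (m : dmod M) : supp_on D m ->
  supp_on (tw z :: C) m <-> supp_on C (m.1 + inj beta *: m.2).
Proof.
move=> mD; have [h1 h2] := (supp_on_double m stD).1 mD.
have E : (alpha + inj beta) *: m =
    (alpha ^+ 2 *: m.2 + inj beta *: m.1, m.1 + inj beta *: m.2).
  by rewrite scalerDl dscale_alpha dscale_inv.
split=> [h|h].
  have : supp_on C ((alpha + inj beta) *: m).
    apply: (supp_on_mul (C1 := [:: tw z])) h => // c; rewrite inE => /eqP->.
    by rewrite rmorphD resK res_tw_alpha addNr.
  by rewrite E => /(supp_on_double _ st)[].
apply: (@supp_on_cons_inv z _ _ (alpha + inj beta)) => //.
  by rewrite rmorphD resK.
apply: supp_on_sub sub1 _; rewrite E; apply/supp_on_double => //=; split=> //.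
have -> : alpha ^+ 2 *: m.2 + inj beta *: m.1 =
   inj beta *: (m.1 + inj beta *: m.2) + (alpha ^+ 2 - inj beta ^+ 2) *: m.2.
  rewrite scalerDr scalerBl !scalerA -expr2 [LHS]addrC -addrA; congr (_ + _).
  by rewrite addrC subrK.
by apply: supp_onD (supp_on_beta h2); apply: supp_onZ.
Qed.

(** The subquotient at z of the doubled complex is the subquotient of X for the
    whole block {z, tw z}: restrict (a, b) to Gr(z), where alpha is beta. *)
Lemma double_iso_top : subq_iso (@sfam dcx (tw z :: C)) (@sfam dcx D)
  (@sfam X C) (@sfam X D) (fun i m => m.1 + inj beta *: m.2).
Proof.
split; rewrite /sfam => //.
- by move=> i; apply: rsub_on.
- by move=> i; apply: rsub_on.
- by move=> i m; apply: supp_on_sub.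
- by move=> i; apply: rsub_on.
- by move=> i; apply: rsub_on.
- by move=> i m; apply: supp_on_sub.
- by move=> i m; apply: supp_on_ud.
- by move=> i m; apply: supp_on_ud.
- by move=> i m; apply: supp_on_ud.
- by move=> i m m' _ _; rewrite scalerDr addrACA.
- by move=> i r m _; rewrite dscale_inv //= scalerDr !scalerA mulrC.
- by move=> i m _; rewrite dud_E /= linearD /= (linearZ_LR (ud X i)).
- by move=> i m /(supp_on_double _ stD)[h1 h2]; apply: supp_onD => //; apply: supp_onZ.
- by move=> i m h; split=> /(double_supp_tw h).
move=> i k kD; exists ((k, 0) : dmod (X i)).
  by apply/supp_on_double => //=; split=> //; apply: supp_on0.
by rewrite /= scaler0 addr0 subrr; apply: supp_on0.
Qed.

(** The subquotient at tw z is the one for the whole block as well: modulo Gr(C) its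
    elements are the pairs (- beta b, b). *)
Lemma double_iso_bot : subq_iso (@sfam dcx C) (@sfam dcx (tw z :: C))
  (@sfam X C) (@sfam X D) (fun i m => m.2).
Proof.
split; rewrite /sfam => //.
- by move=> i; apply: rsub_on.
- by move=> i; apply: rsub_on.
- by move=> i m; apply: supp_on_sub.
- by move=> i; apply: rsub_on.
- by move=> i; apply: rsub_on.
- by move=> i m; apply: supp_on_sub.
- by move=> i m; apply: supp_on_ud.
- by move=> i m; apply: supp_on_ud.
- by move=> i m; apply: supp_on_ud.
- by move=> i r m _; rewrite dscale_inv.
- by move=> i m /(supp_on_sub sub2) /(supp_on_double _ stD)[].
- move=> i m h; have hD := supp_on_sub sub2 h.
  split=> [h2|/(supp_on_double _ st)[] //]; apply/supp_on_double => //; split=> //.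
  have := (double_supp_tw hD).1 h => h1.
  by rewrite -(addrK (inj beta *: m.2) m.1); apply: supp_onB h1 _; apply: supp_onZ.
move=> i k kD; exists ((- (inj beta *: k), k) : dmod (X i)); last first.
  by rewrite /= subrr; apply: supp_on0.
apply/double_supp_tw; last by rewrite /= addNr; apply: supp_on0.
apply/supp_on_double => //=; split=> //.
by rewrite -scaleN1r; do 2!apply: supp_onZ.
Qed.

Lemma good_double : good_at X (tw z) C -> good_at X z (tw z :: C) ->
  good_at dcx (tw z) C /\ good_at dcx z (tw z :: C).
Proof.
move=> g1 g2.
have g : good (@sfam X C) (@sfam X D).
  apply: good_ext g1 g2; rewrite /sfam => i; try exact: rsub_on.
  - by move=> m; apply: supp_on_sub.
  - by move=> m; apply: supp_on_sub.
  by move=> m; apply: supp_on_ud.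
by split; [apply: good_pull double_iso_bot g|apply: good_pull double_iso_top g].
Qed.

End DoubleComplex.

Definition blocks zs := flatten [seq [:: z; tw z] | z <- zs].

Lemma stable_blocks zs : stable (blocks zs).
Proof.
elim: zs => [|z zs IH] c //=; rewrite !inE => /or3P[/eqP->|/eqP->|/IH->];
  by rewrite ?twK ?eqxx ?orbT.
Qed.

Lemma good_chain_double X zs : good_chain X (blocks zs) ->
  good_chain (dcx X) (blocks zs).
Proof.
elim: zs => [|z zs IH] //= [g2 [g1 /IH g]].
by have [? ?] := good_double (@stable_blocks zs) g1 g2.
Qed.

(** * Adjunctions for the doubling *)

Section Adjunction.
Variables M N : lmodType A.

(** Doubling is adjoint to itself; the second component of a pair plays the role of
    the Frobenius trace from A to the invariants. *)
Lemma adj_left (phi : {linear M -> dmod N}) :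
  linear (fun m : dmod M => (phi m.1).2 + alpha *: (phi m.2).2).
Proof.
move=> f m m'; rewrite dscaleE /=.
have inv g (a : M) : sL g = g -> (phi (g *: a)).2 = g *: (phi a).2.
  by move=> sg; rewrite (linearZ_LR phi) dscale_inv.
have sa2 : sL (alpha ^+ 2 * odc f) = alpha ^+ 2 * odc f.
  by rewrite rmorphM sL_odc expr2 rmorphM /= sL_alpha mulrNN.
rewrite !linearD /= !inv ?sL_evn ?sL_odc // addrACA; congr (_ + _).
rewrite !scalerA addrACA -!scalerDl; move: (evn_odc f).
by move: (evn f) (odc f) => u v ->; congr (_ *: _ + _ *: _); ring.
Qed.

(** The inverse direction.  For a linear map into dmod N the second component of the
    image of alpha m is the first component of the image of m, which explains the
    value at (alpha m, 0). *)
Lemma adj_right (psi : {linear dmod M -> N}) :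
  linear (fun m : M => (psi ((alpha *: m, 0) : dmod M), psi ((m, 0) : dmod M)) : dmod N).
Proof.
have inv g (a : M) : sL g = g -> psi ((g *: a, 0) : dmod M) = g *: psi ((a, 0) : dmod M).
  by move=> sg; rewrite -(linearZ_LR psi) dscale_inv //= scaler0.
have add a b : psi ((a + b, 0) : dmod M) = psi ((a, 0) : dmod M) + psi ((b, 0) : dmod M).
  by rewrite -linearD; congr (psi _); congr pair; rewrite /= addr0.
move=> f m m'; rewrite dscaleE.
have sa2 : sL (alpha ^+ 2 * odc f) = alpha ^+ 2 * odc f.
  by rewrite rmorphM sL_odc expr2 rmorphM /= sL_alpha mulrNN.
congr pair => /=.
  have -> : alpha *: (f *: m + m') = evn f *: (alpha *: m)
    + (alpha ^+ 2 * odc f) *: m + alpha *: m'.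
    rewrite scalerDr !scalerA -scalerDl; congr (_ *: _ + _).
    by rewrite {1}(evn_odc f); ring.
  by rewrite !add (inv (evn f)) ?sL_evn // (inv (_ * odc f)).
have -> : f *: m + m' = odc f *: (alpha *: m) + evn f *: m + m'.
  rewrite !scalerA -scalerDl; congr (_ *: _ + _).
  by rewrite {1}(evn_odc f); ring.
by rewrite !add (inv (evn f)) ?sL_evn // (inv (odc f)) ?sL_odc.
Qed.

End Adjunction.

Lemma ext_exact_double X (N : lmodType A) :
  ext_exact (dcx X) N -> ext_exact X (dmod N).
Proof.
move=> h i phi phid.
have [|psi E] := h i (mklin (adj_left phi)).
  by move=> m; rewrite /= /linear_of /= !phid scaler0 addr0.
exists (mklin (adj_right psi)) => m; rewrite /= /linear_of.
have EE (a : X (i + 1)) : psi ((ud X _ a, 0) : dmod _) = (phi a).2.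
  by have /= := E ((a, 0) : dmod _); rewrite /linear_of /= /dud_fun /= !linear0 /= addr0 => <-.
transitivity (((phi (alpha *: m)).2, (phi m).2) : dmod N).
  by rewrite (linearZ_LR phi) dscale_alpha /=; case: (phi m).
by rewrite -!EE (linearZ_LR (ud X (i + 1))).
Qed.

Lemma lift_exact_double X (N : lmodType A) :
  lift_exact N (dcx X) -> lift_exact (dmod N) X.
Proof.
move=> h i phi dphi.
have [|psi E] := h i (mklin (adj_right phi)).
  by move=> m /=; congr pair; apply: dphi.
exists (mklin (adj_left psi)) => m; rewrite /= /linear_of.
have EE n : phi ((n, 0) : dmod N) = ud X _ (psi n).2.
  by have /(congr1 snd) := E n.
have Em : m = ((m.1, 0) : dmod N) + alpha *: ((m.2, 0) : dmod N).
  rewrite dscale_alpha /= scaler0.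
  by case: m => a b; congr pair; rewrite /= ?addr0 ?add0r.
rewrite {1}Em linearD (linearZ_LR phi) !EE.
by rewrite linearD (linearZ_LR (ud X i)).
Qed.

End Doubling.

(** * Covers by products of ideals, and flags *)

Record A_submodule (M : lmodType A) (N : M -> Prop) : Prop := ASub {
  asub0 : N 0;
  asubD : forall m m', N m -> N m' -> N (m + m');
  asubZ : forall f m, N m -> N (f *: m) }.

Lemma asub_rsub M (N : M -> Prop) : A_submodule N -> right_submodule N.
Proof. by move=> [h0 hD hZ]; split=> // r m; apply: hZ. Qed.

Lemma asub_torsion M : A_submodule (@torsion M).
Proof.
by split; [exact: torsion0|move=> *; apply: torsionD|move=> *; apply: torsionZ].
Qed.

Lemma asub_eq0 M f : A_submodule (fun m : M => f *: m = 0).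
Proof.
split=> [|m m' h h'|g m h]; rewrite ?scaler0 // ?scalerDr ?h ?h' ?addr0 //.
by rewrite scalerA mulrC -scalerA h scaler0.
Qed.

Lemma asub_zero M : A_submodule (fun m : M => m = 0).
Proof.
by split=> [|m m' -> ->|f m ->]; rewrite ?addr0 ?scaler0.
Qed.

Lemma asub_scale M (N : M -> Prop) f : A_submodule N -> A_submodule (fun m => N (f *: m)).
Proof.
move=> h; split=> [|m m' hm hm'|g m hm].
- by rewrite scaler0; apply: asub0.
- by rewrite scalerDr; apply: asubD.
by rewrite scalerA mulrC -scalerA; apply: asubZ.
Qed.

Definition prods (Ks : seq (seq A)) : seq A :=
  foldr (fun K acc => [seq f * g | f <- K, g <- acc]) [:: 1] Ks.

Lemma prods_consP K Ks f :
  f \in prods (K :: Ks) <-> exists g h, [/\ g \in K, h \in prods Ks & f = g * h].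
Proof.
split=> [/allpairsP[[g h] [? ? ->]]|[g [h [? ? ->]]]]; first by exists g, h.
by apply/allpairsP; exists (g, h).
Qed.

Lemma mem_prods_cons K Ks g h : g \in K -> h \in prods Ks ->
  g * h \in prods (K :: Ks).
Proof. by move=> gK hK; apply/prods_consP; exists g, h. Qed.

Lemma prods_catP Ks Ks' f : f \in prods (Ks ++ Ks') ->
  exists g h, [/\ g \in prods Ks, h \in prods Ks' & f = g * h].
Proof.
elim: Ks f => [|K Ks IH] f; first by exists 1, f; rewrite mul1r mem_seq1.
rewrite cat_cons => /prods_consP[g [h [gK /IH[u [v [uK vK ->]]] ->]]].
by exists (g * u), v; split=> //; [apply: mem_prods_cons|rewrite mulrA].
Qed.

(** The element m is killed by a finite product of ideals, each generated by a
    finite list from P.  If P consists of the equations of graphs, the support of m is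
    then contained in the union of finitely many of these graphs. *)
Definition cover (P : seq A -> Prop) M (m : M) := exists2 Ks,
  (forall K, K \in Ks -> P K) & forall f, f \in prods Ks -> f *: m = 0.

Lemma coverZ P M f (m : M) : cover P m -> cover P (f *: m).
Proof.
move=> [Ks h1 h2]; exists Ks => // g /h2 E.
by rewrite scalerA mulrC -scalerA E scaler0.
Qed.

Lemma cover0 P M : cover P (0 : M).
Proof. by exists [::] => // f _; rewrite scaler0. Qed.

Lemma cover_seq P M (m : M) (s : seq A) : (forall f, f \in s -> cover P (f *: m)) ->
  exists2 Ks, (forall K, K \in Ks -> P K) &
    forall f g, f \in s -> g \in prods Ks -> g *: (f *: m) = 0.
Proof.
elim: s => [|f s IH] h; first by exists [::].
have [g gs|Ks h1 h2] := IH; first by apply: h; rewrite inE gs orbT.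
have [|Ls h3 h4] := h f; first by rewrite inE eqxx.
exists (Ks ++ Ls) => [K|g k]; first by rewrite mem_cat => /orP[/h1|/h3].
rewrite inE => /orP[/eqP->|gs] /prods_catP[u [v [uK vK ->]]].
  by rewrite -scalerA h4 ?scaler0.
by rewrite mulrC -scalerA h2 ?scaler0.
Qed.

Lemma cover_prods P M (m : M) Ks : (forall K, K \in Ks -> P K) ->
  (forall f, f \in prods Ks -> cover P (f *: m)) -> cover P m.
Proof.
move=> h /cover_seq[Ls h1 h2]; exists (Ls ++ Ks) => [K|f].
  by rewrite mem_cat => /orP[/h1|/h].
by move=> /prods_catP[u [v [uK vK ->]]]; rewrite -scalerA h2.
Qed.

(** Covers compose: it suffices to cover the multiples of m killed by a single
    ideal from P'. *)
Lemma cover_refine P P' M (m : M) : cover P' m ->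
  (forall f K, P' K -> (forall g, g \in K -> g *: (f *: m) = 0) ->
    cover P (f *: m)) -> cover P m.
Proof.
move=> [Ks hK]; elim: Ks m hK => [|K Ks IH] m hK hm h.
  by rewrite -[m]scale1r hm ?mem_seq1 //; apply: cover0.
have [g gK|Ls h1 h2] := @cover_seq P M m K.
  apply: IH => [K' K's|f fK|f K' PK'].
  - by apply: hK; rewrite inE K's orbT.
  - by rewrite scalerA mulrC; apply: hm; apply: mem_prods_cons.
  by rewrite scalerA; apply: h.
apply: (cover_prods h1) => f fL; apply: (h f K); first by apply: hK; rewrite inE eqxx.
by move=> g gK; rewrite scalerA mulrC -scalerA h2.
Qed.

Lemma coverD P M (m m' : M) : cover P m -> cover P m' -> cover P (m + m').
Proof.
move=> [Ks h1 h2] [Ls h3 h4]; exists (Ks ++ Ls) => [K|f].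
  by rewrite mem_cat => /orP[/h1|/h3].
move=> /prods_catP[u [v [uK vK ->]]].
rewrite scalerDr -[X in _ + X]scalerA h4 // scaler0 addr0.
by rewrite mulrC -scalerA h2 ?scaler0.
Qed.

Lemma asub_cover P M : A_submodule (@cover P M).
Proof.
by split; [exact: cover0|move=> *; apply: coverD|move=> *; apply: coverZ].
Qed.

Lemma cover_sub P P' M (m : M) : (forall K, P K -> P' K) -> cover P m -> cover P' m.
Proof. by move=> h [Ks h1 h2]; exists Ks => // K /h1/h. Qed.

Lemma cover_one (P : seq A -> Prop) M K (m : M) : P K -> (forall g, g \in K -> g *: m = 0) -> cover P m.
Proof.
move=> PK h; exists [:: K] => [K'|f]; first by rewrite inE => /eqP->.
by move=> /prods_consP[g [h' [gK h'1 ->]]]; rewrite mulrC -scalerA h ?scaler0.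
Qed.

Section Gamma.
Variable gens : W -> seq A.
Hypothesis gensP : forall x f, exists2 s : seq (A * A),
  (forall c, c \in s -> c.2 \in gens x) & f - inj (res x f) = \sum_(c <- s) c.1 * c.2.
Hypothesis res_gens : forall x g, g \in gens x -> res x g = 0.

Lemma gens_scale M (N : M -> Prop) x f m : A_submodule N ->
  (forall g, g \in gens x -> N (g *: m)) -> N (f *: m - inj (res x f) *: m).
Proof.
move=> h hg; have [s sg E] := gensP x f.
rewrite -scalerBl E scaler_suml; apply: (rsub_sum (asub_rsub h)) => c cs.
by rewrite -scalerA; apply: (asubZ h); apply: hg; apply: sg.
Qed.

Lemma gens_kill M (N : M -> Prop) x f m : A_submodule N -> res x f = 0 ->
  (forall g, g \in gens x -> N (g *: m)) -> N (f *: m).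
Proof.
move=> h fx hg; have := @gens_scale M N x f m h hg.
by rewrite fx rmorph0 scale0r subr0.
Qed.

Lemma gens_sep x y : x != y -> exists2 g, g \in gens x & res y g != 0.
Proof.
move=> /sep[f fx fy]; apply: contrapT => no.
have [s sg E] := gensP x f; move: fy.
rewrite fx rmorph0 subr0 in E; rewrite E rmorph_sum big_seq big1 ?eqxx // => c cs.
rewrite rmorphM; have [->|ne] := eqVneq (res y c.2) 0; first by rewrite mulr0.
by case: no; exists c.2 => //; apply: sg.
Qed.

Definition gen_of (C : W -> Prop) (K : seq A) := exists2 x, C x & K = gens x.
Definition Gam (C : W -> Prop) M (m : M) := cover (gen_of C) m.

(** At Gr(x) a product of equations of other graphs is a nonzero function, and on m
    it acts through this restriction. *)
Lemma Gam_disjoint (C : W -> Prop) x M (m : M) : ~ C x -> Gam C m ->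
  (forall g, g \in gens x -> g *: m = 0) -> torsion m.
Proof.
move=> nC [Ks hK h] kill.
have [F FK Fx] : exists2 F, F \in prods Ks & res x F != 0.
  elim: Ks hK {h} => [|K Ks IH] hK; first by exists 1; rewrite ?rmorph1 ?oner_eq0 // inE.
  have [K' K's|F FK Fx] := IH; first by apply: hK; rewrite inE K's orbT.
  have [|y Cy EK] := hK K; first by rewrite inE eqxx.
  have [|g gy gx] := @gens_sep y x; first by apply: contra_notN nC => /eqP <-.
  exists (g * F); last by rewrite rmorphM mulf_neq0.
  by apply: mem_prods_cons; rewrite ?EK.
exists (res x F) => //; apply/eqP.
have := gens_scale F (asub_zero M) kill.
by rewrite (h _ FK) sub0r => /eqP; rewrite oppr_eq0.
Qed.

Definition pair_of (K : seq A) := exists b1 b2, coprime_pair b1 b2 /\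
  K = [:: inj b1; inj b2].

(** An element supported on the intersection of Gr(x) and Gr(y) in the strict sense
    is killed by the two coprime functions on Gr(y). *)
Lemma cover_pair x y M (m : M) : unrel x y ->
  (forall g, g \in gens x -> g *: m = 0) -> (forall g, g \in gens y -> g *: m = 0) ->
  cover pair_of m.
Proof.
move=> [a1 [a2 [x1 x2 cop]]] hx hy.
apply: (@cover_one _ M [:: inj (res y a1); inj (res y a2)]).
  by exists (res y a1), (res y a2).
have h a : res x a = 0 -> inj (res y a) *: m = 0.
  move=> xa; have E : a *: m = 0 by apply: (gens_kill (asub_zero M) xa).
  have := gens_scale a (asub_zero M) hy.
  by rewrite E sub0r => /eqP; rewrite oppr_eq0 => /eqP.
by move=> g; rewrite !inE => /orP[]/eqP->; apply: h.
Qed.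

Section FlagModule.
Variables (ge gt : W -> W -> Prop).
Hypothesis ge_refl : forall x, ge x x.
Hypothesis gtE : forall x y, gt x y <-> ge x y /\ y <> x.
Hypothesis gt_chain : forall x y z, gt x y -> gt y z ->
  [\/ unrel x y, unrel y z | unrel x z].
Variable L : seq W.

(** What a flag provides: finite support, and subquotients with a dual basis on
    which A acts through Gr(x). *)
Record flag_like (M : lmodType A) : Prop := FlagLike {
  fl_supp : forall m : M, Gam (fun x => x \in L) m;
  fl_basis : forall x, dual_basis (@Gam (gt x) M) (@Gam (ge x) M);
  fl_kill : forall x f (m : M), res x f = 0 -> Gam (ge x) m -> Gam (gt x) (f *: m) }.

Lemma Gam_sub (C C' : W -> Prop) M (m : M) : (forall x, C x -> C' x) ->
  Gam C m -> Gam C' m.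
Proof. by move=> h; apply: cover_sub => K [x Cx ->]; exists x; auto. Qed.

Lemma rsub_Gam (C : W -> Prop) M : right_submodule (@Gam C M).
Proof. exact/asub_rsub/asub_cover. Qed.

Lemma Gam_gt_ge x M (m : M) : Gam (gt x) m -> Gam (ge x) m.
Proof. by apply: Gam_sub => y /gtE[]. Qed.

Lemma Gam_ge_one x M (m : M) : (forall g, g \in gens x -> g *: m = 0) ->
  Gam (ge x) m.
Proof. by apply: cover_one; exists x. Qed.

Section OneModule.
Variable M : lmodType A.
Hypothesis flM : flag_like M.

(** The subquotient at x is torsion free. *)
Lemma torsion_gt x (m : M) : torsion m -> Gam (ge x) m -> Gam (gt x) m.
Proof.
move=> [r r0 rm] h.
apply: (dual_basis_torsionfree (rsub_Gam _ _) (fl_basis flM x) h r0).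
by rewrite rm; apply: cover0.
Qed.

(** A torsion element supported on Gr(x) lies in Gamma_(> x), so it is covered by
    elements supported on Gr(x) and Gr(y) with y > x. *)
Lemma torsion_refine P (m : M) : torsion m ->
  (forall x y (n : M), gt x y -> torsion n -> (forall g, g \in gens x -> g *: n = 0) ->
    (forall g, g \in gens y -> g *: n = 0) -> cover P n) -> cover P m.
Proof.
move=> tm h; apply: (cover_refine (fl_supp flM m)) => f K [x _ ->] kx.
have tn := torsionZ f tm; set n := f *: m in tn kx *.
have := torsion_gt tn (Gam_ge_one kx) => /cover_refine; apply.
move=> g K' [y xy ->] ky; apply: (h x y) => //; first exact: torsionZ.
by move=> g' /kx E; rewrite scalerA mulrC -scalerA E scaler0.
Qed.

(** Moving up twice with [torsion_gt], a torsion element is covered by elements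
    supported on three graphs x < y < z, and two of the three are unrelated. *)
Lemma torsion_cover_pair (m : M) : torsion m -> cover pair_of m.
Proof.
move=> tm; apply: (torsion_refine tm) => x y n xy tn kx ky.
have := torsion_gt tn (Gam_ge_one ky) => /cover_refine; apply.
move=> f K [z yz ->] kz.
have k w : (forall g, g \in gens w -> g *: n = 0) ->
    forall g, g \in gens w -> g *: (f *: n) = 0.
  by move=> h g /h E; rewrite scalerA mulrC -scalerA E scaler0.
have [u|u|u] := gt_chain xy yz.
- exact: (cover_pair u (k _ kx) (k _ ky)).
- exact: (cover_pair u (k _ ky) kz).
exact: (cover_pair u (k _ kx) kz).
Qed.

Lemma torsion_seq (s : seq A) (m : M) : (forall f, f \in s -> torsion (f *: m)) ->
  exists2 r, r != 0 & forall f, f \in s -> f *: (inj r *: m) = 0.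
Proof.
elim: s => [|f s IH] h; first by exists 1; rewrite ?oner_eq0.
have [g gs|r r0 rs] := IH; first by apply: h; rewrite inE gs orbT.
have [|r' r'0 r'f] := h f; first by rewrite inE eqxx.
exists (r * r') => [|g]; first exact: mulf_neq0.
rewrite rmorphM inE => /orP[/eqP->|/rs E].
  by rewrite !scalerA mulrC -mulrA -scalerA -scalerA r'f scaler0.
by rewrite !scalerA mulrA mulrC -!scalerA E scaler0.
Qed.

(** If the square of the ideal of Gr(x) kills n, then n lies in Gamma_(>= x), hence
    f n lies in Gamma_(> x) for f vanishing on Gr(x).  On the other hand f n is killed
    by the ideal of Gr(x), so it is torsion by [Gam_disjoint]. *)
Lemma torsion_square x (n : M) :
  (forall g h, g \in gens x -> h \in gens x -> torsion (g *: (h *: n))) ->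
  forall f, res x f = 0 -> torsion (f *: n).
Proof.
move=> hn f fx.
have [F FK|r r0 rK] := @torsion_seq [seq g * h | g <- gens x, h <- gens x] n.
  by case/allpairsP: FK => -[g h] [gx hx ->]; rewrite -scalerA; apply: hn.
have kk g h : g \in gens x -> h \in gens x -> g *: (h *: (inj r *: n)) = 0.
  by move=> gx hx; rewrite scalerA; apply: rK; apply/allpairsP; exists (g, h).
apply: (torsion_inj r0); rewrite scalerA mulrC -scalerA.
have GG : Gam (ge x) (inj r *: n).
  exists [:: gens x; gens x] => [K|F]; first by rewrite !inE orbb => /eqP->; exists x.
  move=> /prods_consP[g [h [gx /prods_consP[g' [h' [g'x]]]]]].
  by rewrite inE => /eqP-> -> ->; rewrite mulr1 -scalerA; apply: kk.
apply: (@Gam_disjoint (gt x) x); first by case/gtE.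
  exact: (fl_kill flM).
move=> g gx; apply: (@gens_kill M _ x f) (asub_eq0 M g) fx _ => h hx.
exact: kk.
Qed.

(** From products of ideals to the functions vanishing on a union of graphs.  If x
    occurs more than once, [torsion_square] removes a repeated factor. *)
Lemma prods_supp xs (m : M) :
  (forall f, f \in prods [seq gens x | x <- xs] -> torsion (f *: m)) -> supp_on xs m.
Proof.
elim: xs m => [|x xs IH] m h.
  by apply: supp_on_torsion; rewrite -[m]scale1r; apply: h; rewrite inE.
have hg g : g \in gens x -> supp_on xs (g *: m).
  move=> gx; apply: IH => f fK; rewrite scalerA mulrC; apply: h.
  exact: mem_prods_cons.
move=> f fC; set n := f *: m.
have fx : res x f = 0 by apply: fC; rewrite inE eqxx.
have fxs : vanishes xs f by apply: vanishes_sub fC => c cC; rewrite inE cC orbT.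
have n1 : supp_on [:: x] n.
  move=> k kx; apply: (@gens_kill M _ x k) (asub_torsion M) _ _.
    by apply: kx; rewrite inE.
  by move=> g gx; rewrite /n scalerA mulrC -scalerA; apply: hg.
have [xs_x|xs_x] := boolP (x \in xs); last first.
  have [b|k kxs kx] := @separating xs [:: x]; first by rewrite inE => /eqP->.
  apply: (torsion_mul_inv n1 kx).
  apply: (@gens_kill M (fun n => torsion (k *: n)) x f) => //.
    exact/asub_scale/asub_torsion.
  by move=> g gx; apply: hg.
have [b|k kxs kx] := @separating [seq c <- xs | c != x] [:: x].
  by rewrite inE => /eqP->; rewrite mem_filter eqxx.
apply: (torsion_mul_inv n1 kx).
rewrite /n scalerA mulrC -scalerA; apply: (torsion_square (x := x)) => // g g' gx g'x.
rewrite [g' *: _]scalerA [g *: _]scalerA mulrC -scalerA; apply: hg => // c cC.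
rewrite rmorphM; have [->|ne] := eqVneq c x; first by rewrite res_gens ?mul0r.
by rewrite kxs ?mulr0 // mem_filter ne.
Qed.

Lemma Gam_supp (C : W -> Prop) (m : M) : Gam C m ->
  exists2 xs, (forall x, x \in xs -> C x) & supp_on xs m.
Proof.
move=> [Ks hK h].
have [xs xsC EK] : exists2 xs, (forall x, x \in xs -> C x) & Ks = [seq gens x | x <- xs].
  elim: Ks hK {h} => [|K Ks IH] hK; first by exists [::].
  have [K' K's|xs xsC ->] := IH; first by apply: hK; rewrite inE K's orbT.
  have [|x Cx ->] := hK K; first by rewrite inE eqxx.
  by exists (x :: xs) => // y; rewrite inE => /orP[/eqP->|/xsC].
exists xs => //; apply: prods_supp => f; rewrite -EK => /h->; exact: torsion0.
Qed.

Lemma supp_all_L (m : M) : supp_on L m.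
Proof. by have [xs sub] := Gam_supp (fl_supp flM m); apply: supp_on_sub. Qed.

(** Only the entries of L matter for sections supported on Gr(L); the two senses of
    support agree on the subquotients of the flag ([cut_Gam_gt], [cut_split]), but
    not necessarily on the sections themselves. *)
Definition cut (C : W -> Prop) := [seq x <- L | `[< C x >]].

Lemma Gam_cut (C : W -> Prop) (m : M) : Gam C m -> supp_on (cut C) m.
Proof.
move=> /Gam_supp[xs xsC mxs]; apply: supp_onI (supp_all_L m) mxs => c cL /xsC cC.
by rewrite mem_filter cL andbT; apply/asboolP.
Qed.

Lemma cut_Gam_gt x (n : M) : Gam (ge x) n -> supp_on (cut (gt x)) n -> Gam (gt x) n.
Proof.
move=> Gn sn; have [b|f fC fx] := @separating (cut (gt x)) [:: x].
  rewrite inE => /eqP->; rewrite mem_filter negb_and; apply/orP; left.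
  by apply/asboolP => /gtE[].
have {}fx : res x f != 0 by apply: fx; rewrite inE.
have [r r0 rf] := sn f fC.
apply: (dual_basis_torsionfree (r := r * res x f) (rsub_Gam _ _) (fl_basis flM x)) => //.
  exact: mulf_neq0.
rewrite rmorphM -scalerA.
have -> : inj (res x f) *: n = f *: n - (f - inj (res x f)) *: n.
  by rewrite scalerBl subKr.
rewrite scalerBr rf sub0r -scaleN1r; do 2!apply: coverZ.
by apply: (fl_kill flM) => //; rewrite rmorphB resK subrr.
Qed.

(** Some product of ideals of coprime pairs moves m into Gamma_(>= x): by
    [torsion_cover_pair] the torsion elements f m, with f in the product of the ideals
    of the graphs, are killed by such a product.  The pairs are then cancelled one
    after the other, using the dual basis of the flag at x. *)
Lemma cut_split x (m : M) : supp_on (cut (ge x)) m ->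
  exists2 u, Gam (ge x) u & supp_on (cut (gt x)) (m - u).
Proof.
pose Y (m : M) := exists2 u, Gam (ge x) u & supp_on (cut (gt x)) (m - u).
move=> mC; rewrite -/(Y m).
have [f fK|Ks hK kill] := @cover_seq pair_of M m (prods [seq gens y | y <- cut (ge x)]).
  apply: torsion_cover_pair; apply: mC => c.
  elim: (cut (ge x)) f fK => [|y ys IH] f; first by rewrite in_nil.
  move=> /prods_consP[g [h [gy /IH hh ->]]].
  rewrite inE rmorphM => /orP[/eqP->|/hh->]; last by rewrite mulr0.
  by rewrite (res_gens gy) mul0r.
have {}kill k : k \in prods Ks -> Y (k *: m).
  move=> kK; exists (k *: m); last by rewrite subrr; apply: supp_on0.
  exists [seq gens y | y <- cut (ge x)].
    by move=> K /mapP[y]; rewrite mem_filter => /andP[/asboolP ? _ ->]; exists y.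
  by move=> f fK; rewrite scalerA mulrC -scalerA; apply: kill.
elim: Ks hK m mC kill => [|K Ks IH] hK m mC kill.
  by rewrite -[m]scale1r; apply: kill; rewrite inE.
have {IH}h b : b \in K -> Y (b *: m).
  move=> bK; apply: IH => [K' K's| |k kK].
  - by apply: hK; rewrite inE K's orbT.
  - exact: supp_onZ.
  by rewrite scalerA mulrC; apply: kill; apply: mem_prods_cons.
have [|b1 [b2 [cop EK]]] := hK K; first by rewrite inE eqxx.
have [|u1 G1 D1] := h (inj b1); first by rewrite EK inE eqxx.
have [|u2 G2 D2] := h (inj b2); first by rewrite EK !inE eqxx orbT.
have [||w Gw Dw] := dual_basis_coprime (u := u2) (v := u1) (rsub_Gam _ _)
    (rsub_Gam _ _) _ (fl_basis flM x) cop G2 G1.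
- exact: Gam_gt_ge.
- apply: cut_Gam_gt.
    by apply: (rsubB (rsub_Gam _ _)); apply: coverZ.
  have := supp_onB (supp_onZ (inj b2) D1) (supp_onZ (inj b1) D2).
  rewrite !scalerBr !scalerA [inj b2 * inj b1]mulrC opprB addrC addrA.
  by rewrite subrK.
exists w => //; apply: (@supp_on_rad _ _ b1); first by case: cop.
rewrite scalerBr; apply: (rsub_trans (rsub_on _ _) D1).
exact: Gam_cut.
Qed.

(** By [torsion_refine] a torsion element supported on Gr(x) is covered by torsion
    elements supported on graphs of smaller height, and this has to stop. *)
Lemma flag_torsion0 (h : W -> nat) (m : M) :
  (forall x y, gt x y -> (h y < h x)%N) -> torsion m -> m = 0.
Proof.
move=> hh tm; suff [[|K Ks] hK kill] : cover (fun _ => False) m.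
- by rewrite -[m]scale1r kill ?inE.
- by case: (hK K); rewrite inE eqxx.
apply: (cover_refine (fl_supp flM m)) => f K [x _ ->] kx.
move: (torsionZ f tm) kx; move: (f *: m) => {f tm}.
elim: {x}_.+1 {-2}x (ltnSn (h x)) => // N IH x hx {}m tm kx.
apply: (cover_refine (torsion_gt tm (Gam_ge_one kx))) => f K' [y /hh xy ->] ky.
by apply: (IH y) => //; [apply: leq_trans xy _|apply: torsionZ].
Qed.

End OneModule.

Section FlagComplex.
Variable X : ungraded_complex.
Hypothesis flX : forall i, flag_like (X i).
Hypothesis acX : forall x, acyclic_on (X := X) (fun i => @Gam (gt x) (X i)) (fun i => @Gam (ge x) (X i)).

Lemma Gam_ud (C : W -> Prop) i (m : X i) : Gam C m -> Gam C (ud X i m).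
Proof.
move=> [Ks hK h]; exists Ks => // f /h E.
by have := congr1 (ud X i) E; rewrite linear0 (linearZ_LR (ud X i)).
Qed.

Lemma good_cut x : good (@sfam X (cut (gt x))) (@sfam X (cut (ge x))).
Proof.
have g : good (X := X) (fun i => @Gam (gt x) (X i)) (fun i => @Gam (ge x) (X i)).
  by split=> // i; apply: (fl_basis (flX i)).
apply: (good_push (f := fun i m => m)) g; split=> //; rewrite /sfam.
- by move=> i; apply: rsub_Gam.
- by move=> i; apply: rsub_Gam.
- by move=> i m; apply: Gam_gt_ge.
- by move=> i; apply: rsub_on.
- by move=> i; apply: rsub_on.
- move=> i m; apply: supp_on_sub => c; rewrite !mem_filter => /andP[/asboolP/gtE[cx _] ->].
  by rewrite andbT; apply/asboolP.
- by move=> i m; apply: Gam_ud.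
- by move=> i m; apply: Gam_ud.
- by move=> i m; apply: supp_on_ud.
- by move=> i m; apply: Gam_cut.
- by move=> i m Gm; split; [apply: cut_Gam_gt|apply: Gam_cut].
by move=> i k; apply: cut_split.
Qed.

(** At the entry x of L the flag gives the subquotient for the y with gt x y.  The
    other entries behind x are unrelated to x, and adding them to the list does not
    change the subquotient. *)
Lemma good_chain_flag : uniq L ->
  (forall L1 x C, L = L1 ++ x :: C ->
    (forall y, y \in C -> gt x y \/ unrel y x) /\
    (forall y, y \in L -> gt x y -> y \in C)) ->
  good_chain X L.
Proof.
move=> uL hL.
have main L1 x C : L = L1 ++ x :: C -> good_at X x C.
  move=> EL; have [hC1 hC2] := hL _ _ _ EL.
  have xL : x \in L by rewrite EL mem_cat inE eqxx orbT.
  have g0 : good_at X x (cut (gt x)).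
    have := good_cut x; rewrite /good_at.
    rewrite (@sfam_eq X (cut (ge x)) (x :: cut (gt x))) // => c.
    rewrite inE !mem_filter; have [->|ne] := eqVneq c x.
      by rewrite xL andbT; apply/asboolP.
    congr (_ && _); apply/asboolP/asboolP => [h|/gtE[]//]; apply/gtE; split=> //.
    exact/eqP.
  have g1 ys : {subset ys <= C} -> (forall y, y \in ys -> ~ gt x y) ->
      good_at X x (ys ++ cut (gt x)).
    elim: ys => [|y ys IH] sub ny //.
    have yC : y \in C by apply: sub; rewrite inE eqxx.
    have [xy|u] := hC1 y yC; first by case: (ny y) => //; rewrite inE eqxx.
    rewrite cat_cons; apply: good_at_cons u _; apply: IH => z zs.
      by apply: sub; rewrite inE zs orbT.
    by apply: ny; rewrite inE zs orbT.
  have /good_at_eq : [seq y <- C | ~~ `[< gt x y >]] ++ cut (gt x) =i C.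
    move=> c; rewrite mem_cat !mem_filter; apply/orP/idP => [[/andP[]//|/andP[]]|cC].
      by move=> /asboolP h cL; apply: hC2.
    have cL : c \in L by rewrite EL mem_cat inE cC !orbT.
    by rewrite cL cC !andbT; case: asboolP => _; [right|left].
  apply; apply: g1 => y; rewrite mem_filter => /andP[] //.
  by move=> /asboolP.
elim: {1 3}L [::] (erefl L : [::] ++ L = L) => [|x C IH] L1 EL //=; split.
  by apply: (main L1).
by apply: (IH (rcons L1 x)); rewrite cat_rcons.
Qed.

End FlagComplex.
End FlagModule.
End Gamma.
End GraphModules.

(** * Finite covers of a support *)

Section MkPrime.
Variables (A : comNzRingType) (X : A -> Prop).
Hypotheses (X0 : X 0) (X1 : ~ X 1).
Hypothesis XD : forall a u v, X u -> X v -> X (a * u + v).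
Hypothesis XP : forall u v, X (u * v) -> X u \/ X v.

(** The proofs are arguments, so that the ideal structures below can be inferred
    from the term. *)
Definition prime_of & X 0 & ~ X 1 & (forall a u v, X u -> X v -> X (a * u + v))
  & (forall u v, X (u * v) -> X u \/ X v) : {pred A} := fun f => `[< X f >].
Let p := prime_of X0 X1 XD XP.

Fact prime_of_ideal : idealr_closed p.
Proof.
split; [exact/asboolP|by apply/asboolPn|].
by move=> a u v /asboolP hu /asboolP hv; apply/asboolP/XD.
Qed.

Fact prime_of_prime : prime_idealr_closed p.
Proof.
by move=> u v /asboolP/XP[h|h]; apply/orP; [left|right]; apply/asboolP.
Qed.

HB.instance Definition _ := isIdealr.Build A p prime_of_ideal.
HB.instance Definition _ := isPrimeIdealrClosed.Build A p prime_of_prime.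

Lemma ex_prime_of : exists P : prime_idealr A, forall f, f \in P <-> X f.
Proof. by exists p => f; split => [/asboolP|/asboolP]. Qed.

End MkPrime.

Section PrimeCover.
Variables (A : comNzRingType) (P : seq A -> Prop) (M : lmodType A) (m : M).

(** The ideal generated by X and the annihilator of m. *)
Definition genid (X : A -> Prop) (f : A) := exists2 s : seq (A * A),
  (forall c, c \in s -> X c.2) & f *: m = (\sum_(c <- s) c.1 * c.2) *: m.

Lemma genid_sub (X Y : A -> Prop) f : (forall g, X g -> Y g) -> genid X f -> genid Y f.
Proof. by move=> h [s hs E]; exists s => // c /hs/h. Qed.

Lemma genid_in (X : A -> Prop) f : X f -> genid X f.
Proof.
move=> Xf; exists [:: (1, f)] => [c|]; first by rewrite inE => /eqP->.
by rewrite big_seq1 mul1r.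
Qed.

Lemma genidD X a f g : genid X f -> genid X g -> genid X (a * f + g).
Proof.
move=> [s hs Es] [t ht Et].
exists ([seq (a * c.1, c.2) | c <- s] ++ t) => [c|].
  by rewrite mem_cat => /orP[/mapP[d /hs ? ->]|/ht].
rewrite big_cat big_map !scalerDl -scalerA Es Et; congr (_ + _).
by rewrite scalerA mulr_sumr; congr (_ *: _); apply: eq_bigr => c _; rewrite mulrA.
Qed.

Lemma genid0 X : genid X 0.
Proof. by exists [::]; rewrite // big_nil. Qed.

Lemma genidM X a f : genid X f -> genid X (a * f).
Proof. by move=> h; rewrite -[_ * _]addr0; apply: genidD (genid0 _). Qed.

Lemma genid_sum X (s : seq (A * A)) : (forall c, c \in s -> genid X c.2) ->
  genid X (\sum_(c <- s) c.1 * c.2).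
Proof.
elim: s => [|c s IH] h; first by rewrite big_nil; apply: genid0.
rewrite big_cons; apply: genidD; first by apply: h; rewrite inE eqxx.
by apply: IH => d ds; apply: h; rewrite inE ds orbT.
Qed.

Lemma genid_idem X f : genid (genid X) f -> genid X f.
Proof.
move=> [s hs E]; have [t ht Et] := genid_sum hs.
by exists t => //; rewrite E.
Qed.

Definition covid X := exists2 Ks, (forall K, K \in Ks -> P K) &
  forall f, f \in prods Ks -> genid X f.

(** Compactness of the support.  If no product of members of P kills m, take by
    Zorn a set X maximal among those for which no such product lies in the ideal
    generated by X and the annihilator of m.  Then X is a prime ideal that contains
    the annihilator of m and none of the members of P. *)
Lemma prime_cover :
  (forall Q : prime_idealr A, (forall f, f *: m = 0 -> f \in Q) ->
     exists2 K, P K & forall f, f \in K -> f \in Q) -> cover P m.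
Proof.
move=> h; apply: contrapT => ncov.
have [|X [nX maxX]] := @classical_sets.Zorn_bigcup A (fun X => ~ covid X).
  move=> F FP tot [Ks hK h1].
  have [[X0 FX0]|nF] := pselect (exists X, F X); last first.
    apply: ncov; exists Ks => // f /h1[[|c s] hs ->]; first by rewrite big_nil scale0r.
    by have [|Y FY _] := hs c; [rewrite inE eqxx|case: nF; exists Y].
  have fin1 (s : seq (A * A)) : (forall c, c \in s -> exists2 X, F X & X c.2) ->
      exists2 X, F X & forall c, c \in s -> X c.2.
    elim: s => [|c s IH] hs; first by exists X0.
    have [d ds|X FX hX] := IH; first by apply: hs; rewrite inE ds orbT.
    have [|Y FY Yc] := hs c; first by rewrite inE eqxx.
    case: (tot X Y FX FY) => sub; [exists Y|exists X] => // d;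
      rewrite inE => /orP[/eqP->|/hX] //; exact: sub.
  have fin2 (s : seq A) : (forall f, f \in s -> exists2 X, F X & genid X f) ->
      exists2 X, F X & forall f, f \in s -> genid X f.
    elim: s => [|f s IH] hs; first by exists X0.
    have [d ds|X FX hX] := IH; first by apply: hs; rewrite inE ds orbT.
    have [|Y FY Yc] := hs f; first by rewrite inE eqxx.
    by case: (tot X Y FX FY) => sub; [exists Y|exists X] => // d;
      rewrite inE => /orP[/eqP->|/hX] //; apply: (genid_sub sub).
  have [f /h1[s hs E]|X FX hX] := fin2 (prods Ks).
    have [c /hs[Y FY Yc]|Y FY hY] := fin1 s; first by exists Y.
    by exists Y => //; exists s.
  by apply: (FP X FX); exists Ks.
have idX f : genid X f -> X f.
  move=> gf; apply: contrapT => nXf; apply: (maxX (genid X)).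
    by split=> [g|sub]; [apply: genid_in|apply: nXf; apply: sub].
  move=> [Ks hK hh]; apply: nX; exists Ks => // g /hh; exact: genid_idem.
have X1 : ~ X 1.
  by move=> X1; apply: nX; exists [::] => // f; rewrite inE => /eqP->; apply: genid_in.
have ext f : ~ X f -> covid (fun g => X g \/ g = f).
  move=> nXf; apply: contrapT => nc; apply: (maxX (fun g => X g \/ g = f)) => //.
  by split=> [g|sub]; [left|apply: nXf; apply: sub; right].
have XD a u v : X u -> X v -> X (a * u + v).
  by move=> hu hv; apply: idX; apply: genidD; apply: genid_in.
have XM a u : X u -> X (a * u) by move=> hu; apply: idX; apply/genidM/genid_in.
have decomp f g : genid (fun g => X g \/ g = f) g -> exists a x, X x /\ g *: m = (a * f + x) *: m.
  move=> [s hs ->]; elim: s hs => [|c s IH] hs.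
    by exists 0, 0; split; [apply: idX; apply: genid0|rewrite big_nil mul0r addr0].
  have [d ds|a [x [Xx E]]] := IH; first by apply: hs; rewrite inE ds orbT.
  rewrite big_cons scalerDl E -scalerDl; have [|Xc|->] := hs c; first by rewrite inE eqxx.
    exists a, (c.1 * c.2 + x); split; last by congr (_ *: _); ring.
    by apply: idX; apply: genidD; apply: genid_in.
  by exists (c.1 + a), x; split=> //; congr (_ *: _); ring.
have XP u v : X (u * v) -> X u \/ X v.
  move=> Xuv; apply: contrapT => /not_orP[/ext[Ks hK1 hK2] /ext[Ls hL1 hL2]].
  apply: nX; exists (Ks ++ Ls) => [K|f]; first by rewrite mem_cat => /orP[/hK1|/hL1].
  move=> /prods_catP[g [k [/hK2/decomp[a [x [Xx Ex]]] /hL2/decomp[b [y [Xy Ey]]] ->]]].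
  have Xz : X ((a * u) * y + ((b * v + y) * x + (a * b) * (u * v))).
    by apply: (XD) => //; apply: (XD) => //; apply: XM.
  have [s hs Es] := genid_in Xz; exists s => //; rewrite -Es.
  rewrite -scalerA Ey scalerA mulrC -scalerA Ex scalerA; congr (_ *: _); ring.
have X0 : X 0 by apply: idX; apply: genid0.
have [Q QX] := ex_prime_of X0 X1 XD XP.
have [f fm|K PK KQ] := h Q.
  apply/QX/idX; exists [::] => //; by rewrite big_nil scale0r.
apply: nX; exists [:: K] => [K'|f]; first by rewrite inE => /eqP->.
move=> /prods_consP[g [k [gK hk ->]]]; rewrite mulrC; apply: genidM.
by apply: genid_in; apply/QX/KQ.
Qed.

End PrimeCover.

(** * Polynomial rings: coprime linear forms, splitting along a reflection *)

Lemma mul_diff (T : comNzRingType) (p q a c : T) :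
  p * q - a * c = q * (p - a) + a * (q - c).
Proof. by ring. Qed.

Lemma coprime_pair_eq (T : idomainType) (a c a' c' : T) :
  a = a' -> c = c' -> coprime_pair a' c' -> coprime_pair a c.
Proof. by move=> -> ->. Qed.

Section Polynomials.
Variable k : fieldType.

Lemma mpoly_ring_ind m (P : {mpoly k[m]} -> Prop) :
  (forall c, P c%:MP) -> (forall i, P 'X_i) ->
  (forall p q, P p -> P q -> P (p + q)) -> (forall p q, P p -> P q -> P (p * q)) ->
  forall p, P p.
Proof.
move=> hC hX hD hM p; rewrite [p]mpolyE.
apply: (big_ind P) => //; first by rewrite -mpolyC0.
move=> u _; rewrite -mul_mpolyC mpolyXE_id; apply: (hM) => //.
apply: (big_ind P) => //; first by rewrite -mpolyC1.
move=> i _; elim: (u i) => [|e IH]; first by rewrite expr0 -mpolyC1.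
by rewrite exprS; apply: (hM).
Qed.

Lemma mpoly_rmorph_eq m (B : pzRingType) (f g : {rmorphism {mpoly k[m]} -> B}) :
  (forall c, f c%:MP = g c%:MP) -> (forall i, f 'X_i = g 'X_i) -> f =1 g.
Proof.
move=> hC hX; apply: mpoly_ring_ind => // p q hp hq.
  by rewrite !rmorphD hp hq.
by rewrite !rmorphM hp hq.
Qed.

Lemma comp_XU m m' (t : 'I_m -> {mpoly k[m']}) i :
  comp_mpoly [tuple t j | j < m] 'X_i = t i.
Proof. by rewrite comp_mpolyXU -tnth_nth tnth_mktuple. Qed.

(** Two independent linear forms l, l' are coprime.  The substitution sg eliminates a
    variable by means of l, so that p and sg p agree modulo l.  From l u = l' v one
    gets sg l' * sg v = 0, with sg l' nonzero by independence. *)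
Lemma linear_forms_coprime m (c d : 'I_m -> k) :
  (exists i, c i != 0) -> (forall a, exists i, d i != a * c i) ->
  coprime_pair (\sum_i c i *: 'X_i : {mpoly k[m]}) (\sum_i d i *: 'X_i).
Proof.
move=> [i0 ci0] ind; set l := \sum_i _; set l' := \sum_i d i *: _.
have coef (e : 'I_m -> k) j : (\sum_i e i *: 'X_i : {mpoly k[m]})@_U_(j) = e j.
  rewrite raddf_sum (bigD1 j) //= mcoeffZ mcoeffXU eqxx mulr1 big1 ?addr0 // => i ne.
  by rewrite mcoeffZ mcoeffXU (negPf ne) mulr0.
pose t i : {mpoly k[m]} := 'X_i - ((i == i0)%:R / c i0) *: l.
pose sg : {rmorphism {mpoly k[m]} -> {mpoly k[m]}} := comp_mpoly [tuple t j | j < m].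
have sgl (e : 'I_m -> k) : sg (\sum_i e i *: 'X_i) = \sum_i e i *: 'X_i - (e i0 / c i0) *: l.
  rewrite /sg rmorph_sum /=.
  rewrite (eq_bigr (fun i => e i *: 'X_i - (e i * ((i == i0)%:R / c i0)) *: l)); last first.
    by move=> i _; rewrite comp_mpolyZ comp_XU /t scalerBr scalerA.
  rewrite sumrB -scaler_suml; congr (_ - _ *: _).
  rewrite (bigD1 i0) //= eqxx big1 ?addr0 ?div1r // => i /negPf->.
  by rewrite mul0r mulr0.
have sgE p : exists q, p - sg p = l * q.
  elim/mpoly_ring_ind: p => [c0|i|p q [p' hp] [q' hq]|p q [p' hp] [q' hq]].
  - by exists 0; rewrite /sg /= comp_mpolyC subrr mulr0.
  - exists (((i == i0)%:R / c i0)%:MP); rewrite /sg /= comp_XU /t opprB addrC subrK.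
    by rewrite [RHS]mulrC mul_mpolyC.
  - by exists (p' + q'); rewrite rmorphD mulrDr -hp -hq opprD addrACA.
  exists (p' * q + sg p * q'); rewrite rmorphM.
  by rewrite mulrDr mulrA -hp mulrCA -hq; ring.
split.
  by apply: contraNneq ci0 => /(congr1 (mcoeff U_(i0)%MM)); rewrite coef mcoeff0 => ->.
move=> u v E; have sl : sg l = 0.
  by rewrite sgl divff // scale1r subrr.
have sl' : sg l' != 0.
  rewrite sgl; have [i] := ind (d i0 / c i0).
  apply: contraNneq => /(congr1 (mcoeff U_(i)%MM)).
  by rewrite mcoeffB mcoeffZ !coef mcoeff0 => /eqP; rewrite subr_eq0.
have : sg l' * sg v = 0 by rewrite -rmorphM -E rmorphM sl mul0r.
move/eqP; rewrite mulf_eq0 (negPf sl') => /eqP sv.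
by have [q] := sgE v; rewrite sv subr0; exists q.
Qed.

Section Split.
Hypothesis two_neq0 : (2%:R : k) != 0.
Variables (m : nat) (sg : {rmorphism {mpoly k[m]} -> {mpoly k[m]}}) (a : {mpoly k[m]}).
Hypothesis sgC : forall c, sg c%:MP = c%:MP.
Hypothesis sgX : forall i, exists c, 'X_i - sg 'X_i = a * c%:MP.
Hypothesis sga : sg a = - a.
Hypothesis a0 : a != 0.

Lemma mp2 : (2%:R : {mpoly k[m]}) != 0.
Proof. by rewrite -mpolyC_nat mpolyC_eq0. Qed.

(** Here q is half the divided difference of p along the equation a of a reflection. *)
Lemma split_diff p : exists q, p - sg p = 2%:R * a * q.
Proof.
elim/mpoly_ring_ind: p => [c|i|p q [p' hp] [q' hq]|p q [p' hp] [q' hq]].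
- by exists 0; rewrite sgC subrr mulr0.
- have [c E] := sgX i; exists ((c / 2%:R)%:MP).
  rewrite E -mulrA [RHS]mulrCA; congr (_ * _).
  by rewrite -mpolyC_nat -mpolyCM mulrC divfK.
- by exists (p' + q'); rewrite rmorphD mulrDr -hp -hq opprD addrACA.
exists (p' * q + sg p * q'); rewrite rmorphM.
by rewrite mulrDr mulrA -hp mulrCA -hq; ring.
Qed.

Lemma split_involutive p : sg (sg p) = p.
Proof.
elim/mpoly_ring_ind: p => [c|i|p q hp hq|p q hp hq].
- by rewrite !sgC.
- have [c E] := sgX i.
  have E2 : sg 'X_i = 'X_i - a * c%:MP by rewrite -E subKr.
  by rewrite E2 rmorphB rmorphM /= sga sgC E2; ring.
- by rewrite !rmorphD hp hq.
by rewrite !rmorphM hp hq.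
Qed.

Lemma split_ex p : exists uv : {mpoly k[m]} * {mpoly k[m]},
  [/\ sg uv.1 = uv.1, sg uv.2 = uv.2 & p = uv.1 + a * uv.2].
Proof.
have [q E] := split_diff p; exists (p - a * q, q) => /=; rewrite subrK.
have sp : sg p = p - 2%:R * a * q by rewrite -E subKr.
have sq : sg q = q.
  have := congr1 sg E; rewrite rmorphB split_involutive !rmorphM rmorph_nat /= sga.
  move=> E2; have : 2%:R * a * (q - sg q) = 0.
    have -> : 2%:R * a * (q - sg q) = 2%:R * a * q + 2%:R * - a * sg q by ring.
    by rewrite -E -E2 addrA subrK subrr.
  move/eqP; rewrite !mulf_eq0 (negPf mp2) (negPf a0) /= subr_eq0 => /eqP E3.
  by rewrite -E3.
by split=> //; rewrite rmorphB rmorphM /= sga sq sp; ring.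
Qed.

Lemma split_uniq u v : sg u = u -> sg v = v -> u + a * v = 0 -> u = 0 /\ v = 0.
Proof.
move=> su sv E; have := congr1 sg E.
rewrite rmorphD rmorphM /= su sv sga rmorph0 => E2.
have : 2%:R * a * v = 0.
  have -> : 2%:R * a * v = (u + a * v) - (u + - a * v) by ring.
  by rewrite E E2 subrr.
move/eqP; rewrite !mulf_eq0 (negPf mp2) (negPf a0) /= => /eqP v0.
by move: E; rewrite v0 mulr0 addr0.
Qed.

End Split.
End Polynomials.

(** * The graphs of a reflection faithful representation *)

Opaque dimv.

Section Geometry.
Variables (k : fieldType) (W : groupType) (S : {pred W}) (V : vectType k).
Variable rho : W -> 'End(V).
Hypothesis hk : 2%N \notin [pchar k].
Hypothesis hS : coxeter_system S.
Hypothesis hrho : reflection_faithful S rho.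

Local Notation n := (\dim {:V}).
Local Notation R := {mpoly k[n]}.
Local Notation A := {mpoly k[n + n]}.
Local Notation b := (vbasis {:V}).
Local Notation bb j := (b`_(nat_of_ord j)).

Lemma two_neq0 : (2%:R : k) != 0.
Proof. by apply: contraNneq hk => h; rewrite inE /= h. Qed.

Definition form_poly (theta : V -> k) : R := \sum_j theta (bb j) *: 'X_j.

Lemma lf_eq f g : f =1 g -> form_poly f = form_poly g.
Proof. by move=> E; apply: eq_bigr => j _; rewrite E. Qed.

Lemma vbasisE v : v = \sum_i coord b i v *: (bb i).
Proof. by rewrite -coord_vbasis ?memvf. Qed.

Lemma coord_b (i j : 'I_n) : coord b i (bb j) = (i == j)%:R.
Proof. by rewrite coord_free ?(basis_free (vbasisP _)) // eq_sym. Qed.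

Lemma lf_coord i : form_poly (coord b i) = 'X_i.
Proof.
rewrite /form_poly (bigD1 i) //= coord_b eqxx scale1r big1 ?addr0 // => j ne.
by rewrite coord_b eq_sym (negPf ne) scale0r.
Qed.

Lemma lf_coeff f j : (form_poly f)@_U_(j) = f (bb j).
Proof.
rewrite raddf_sum (bigD1 j) //= mcoeffZ mcoeffXU eqxx mulr1 big1 ?addr0 // => i ne.
by rewrite mcoeffZ mcoeffXU (negPf ne) mulr0.
Qed.

Lemma lf0_eq (f : {linear V -> k^o}) : form_poly f = 0 -> forall v, f v = 0.
Proof.
move=> E v; rewrite (vbasisE v) linear_sum big1 // => i _.
by rewrite linearZ /= -lf_coeff E mcoeff0 scaler0.
Qed.

Definition actM x : {rmorphism R -> R} :=
  comp_mpoly [tuple form_poly (fun v => coord b i (rho x^-1%g v)) | i < n].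

Lemma actE x r : act rho x r = actM x r.
Proof. by []. Qed.

Lemma act_X x i : actM x 'X_i = form_poly (fun v => coord b i (rho x^-1%g v)).
Proof. by rewrite /actM /= comp_XU. Qed.

Lemma act_C x c : actM x c%:MP = c%:MP.
Proof. exact: comp_mpolyC. Qed.

Opaque actM.

Lemma act_lf x (f : {linear V -> k^o}) :
  actM x (form_poly f) = form_poly (fun v => f (rho x^-1%g v)).
Proof.
rewrite {1}/form_poly rmorph_sum.
rewrite (eq_bigr (fun i => f (bb i) *: form_poly (fun v => coord b i (rho x^-1%g v)))); last first.
  by move=> i _; rewrite -mul_mpolyC rmorphM /= act_C act_X mul_mpolyC.
under eq_bigr do rewrite /form_poly scaler_sumr.
rewrite exchange_big; apply: eq_bigr => j _ /=.
rewrite [in RHS](vbasisE (rho x^-1%g (bb j))) linear_sum scaler_suml.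
by apply: eq_bigr => i _; rewrite (linearZ_LR f) scalerA mulrC.
Qed.

Lemma rho1 v : rho 1%g v = v.
Proof. by case: hrho => -[-> _] _ _; rewrite id_lfunE. Qed.

Lemma rhoM x y v : rho (x * y)%g v = rho x (rho y v).
Proof. by case: hrho => -[_ ->] _ _; rewrite comp_lfunE. Qed.

Lemma actM_mul x y r : actM (x * y)%g r = actM x (actM y r).
Proof.
apply: (mpoly_rmorph_eq (g := actM x \o actM y)) => [c|i] /=; first by rewrite !act_C.
rewrite !act_X; have := @act_lf x (coord b i \o rho y^-1%g) => /= ->.
by apply: lf_eq => v; rewrite invgM rhoM.
Qed.

Lemma actM_1 r : actM 1%g r = r.
Proof.
apply: (mpoly_rmorph_eq (g := idfun)) => [c|i] /=; first by rewrite act_C.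
by rewrite act_X -[RHS]lf_coord; apply: lf_eq => v; rewrite invg1 rho1.
Qed.

Lemma actMK x : cancel (actM x) (actM x^-1%g).
Proof. by move=> r; rewrite -actM_mul mulVg actM_1. Qed.

Lemma actMVK x : cancel (actM x^-1%g) (actM x).
Proof. by move=> r; rewrite -actM_mul mulgV actM_1. Qed.

Definition injM : {rmorphism R -> A} := comp_mpoly [tuple 'X_(rshift n i) | i < n].
Definition injL : {rmorphism R -> A} := comp_mpoly [tuple 'X_(lshift n i) | i < n].

Lemma injM_C c : injM c%:MP = c%:MP. Proof. exact: comp_mpolyC. Qed.
Lemma injL_C c : injL c%:MP = c%:MP. Proof. exact: comp_mpolyC. Qed.
Lemma injM_X i : injM 'X_i = 'X_(rshift n i). Proof. by rewrite /injM /= comp_XU. Qed.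
Lemma injL_X i : injL 'X_i = 'X_(lshift n i). Proof. by rewrite /injL /= comp_XU. Qed.
Opaque injM injL.

(** Restriction to Gr(x), normalised by the second projection instead of the first,
    which makes it right-linear. *)
Definition resM x : {rmorphism A -> R} := actM x^-1%g \o
  comp_mpoly [tuple match split i with inl j => 'X_j | inr j => act rho x 'X_j end
             | i < n + n].

Lemma resME x f : resM x f = actM x^-1%g (res_Gr rho x f).
Proof. by []. Qed.

Opaque resM.

Lemma resM_eq0 x f : resM x f = 0 <-> res_Gr rho x f = 0.
Proof.
rewrite resME; split=> [E|->]; last by rewrite rmorph0.
by rewrite -(actMVK x (res_Gr rho x f)) E rmorph0.
Qed.

Lemma resM_C x c : resM x c%:MP = c%:MP.
Proof. by rewrite resME /res_Gr comp_mpolyC act_C. Qed.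

Lemma resM_L x i : resM x 'X_(lshift n i) = actM x^-1%g 'X_i.
Proof.
rewrite resME /res_Gr comp_XU; congr (actM _ _).
by case: (splitP (lshift n i)) => j /= E; [congr 'X_(_); apply: val_inj|have := ltn_ord i; lia].
Qed.

Lemma resM_R x i : resM x 'X_(rshift n i) = 'X_i.
Proof.
rewrite resME /res_Gr comp_XU.
case: (splitP (rshift n i)) => j /= E; first by have := ltn_ord j; lia.
by rewrite actE actMK; congr 'X_(_); apply: val_inj => /=; lia.
Qed.

Lemma resMK x r : resM x (injM r) = r.
Proof.
apply: (mpoly_rmorph_eq (g := idfun) (f := resM x \o injM)) => [c|i] /=.
  by rewrite injM_C resM_C.
by rewrite injM_X resM_R.
Qed.

Lemma resM_injL x r : resM x (injL r) = actM x^-1%g r.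
Proof.
apply: (mpoly_rmorph_eq (g := actM x^-1%g) (f := resM x \o injL)) => [c|i].
  by rewrite /= injL_C resM_C act_C.
by rewrite /= injL_X resM_L.
Qed.

Lemma ord_split (P : 'I_(n + n) -> Prop) : (forall i, P (lshift n i)) ->
  (forall i, P (rshift n i)) -> forall i, P i.
Proof. by move=> hl hr i; rewrite -(splitK i); case: (split i). Qed.

(** An equation of Gr(x): the i-th coordinate of v - x w at the point (v, w). *)
Definition gen x (i : 'I_n) : A := 'X_(lshift n i) - injM (actM x^-1%g 'X_i).
Definition gensM x := [seq gen x i | i <- enum 'I_n].

Lemma res_gen x y i : resM y (gen x i) = actM y^-1%g 'X_i - actM x^-1%g 'X_i.
Proof. by rewrite rmorphB resMK resM_L. Qed.

Lemma res_gensM x g : g \in gensM x -> resM x g = 0.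
Proof. by move=> /mapP[i _ ->]; rewrite res_gen subrr. Qed.

(** Modulo the equations of Gr(x) the left variables become functions of the right
    ones. *)
Lemma gensMP x f : exists2 s : seq (A * A),
  (forall c, c \in s -> c.2 \in gensM x) & f - injM (resM x f) = \sum_(c <- s) c.1 * c.2.
Proof.
elim/mpoly_ring_ind: f => [c|i|p q [s hs hp] [t ht hq]|p q [s hs hp] [t ht hq]].
- exists [::]; rewrite // big_nil resM_C; apply/eqP; rewrite subr_eq0 eq_sym.
  by rewrite injM_C.
- elim/ord_split: i => i.
    exists [:: (1, gen x i)] => [c|].
      by rewrite inE => /eqP->; apply/mapP; exists i; rewrite // mem_enum.
    by rewrite big_seq1 mul1r resM_L.
  by exists [::]; rewrite // big_nil resM_R injM_X subrr.
- exists (s ++ t) => [c|]; first by rewrite mem_cat => /orP[/hs|/ht].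
  by rewrite big_cat !rmorphD /= -hp -hq opprD addrACA.
exists ([seq (q * c.1, c.2) | c <- s] ++ [seq (injM (resM x p) * c.1, c.2) | c <- t]) => [c|].
  by rewrite mem_cat => /orP[/mapP[d /hs ? ->]|/mapP[d /ht ? ->]].
rewrite big_cat !big_map /=.
under eq_bigr do rewrite -mulrA.
under [X in _ = _ + X]eq_bigr do rewrite -mulrA.
rewrite -!mulr_sumr -hp -hq !rmorphM.
exact: mul_diff.
Qed.

Lemma res_gen_lf x y i : resM y (gen x i) = form_poly (fun v => coord b i (rho y v - rho x v)).
Proof.
rewrite res_gen !act_X !invgK -sumrB; apply: eq_bigr => j _.
by rewrite linearB scalerBl.
Qed.

Lemma rho_ne x y : x != y -> exists i, exists v, coord b i (rho y v - rho x v) != 0.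
Proof.
move=> ne; apply: contrapT => h.
have : rho x = rho y.
  apply/lfunP => v; apply/eqP; rewrite eq_sym -subr_eq0; apply/eqP.
  rewrite (vbasisE (_ - _)) big1 // => i _.
  have [->|c] := eqVneq (coord b i (rho y v - rho x v)) 0; first by rewrite scale0r.
  by case: h; exists i, v.
by case: hrho => _ inj _ /inj/eqP; rewrite (negPf ne).
Qed.

Lemma sepM x y : x != y -> exists2 f, resM x f = 0 & resM y f != 0.
Proof.
move=> /rho_ne[i [v c]]; exists (gen x i); first by rewrite res_gen subrr.
rewrite res_gen_lf; apply: contraNneq c => E.
have D w : (rho y - rho x)%VF w = rho y w - rho x w by rewrite add_lfunE opp_lfunE.
pose f : {linear V -> k^o} := coord b i \o (rho y - rho x)%VF.
have Ef : form_poly f = 0 by rewrite -[RHS]E; apply: lf_eq => w; rewrite /f /= D.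
have Ev := lf0_eq Ef v; rewrite -D; apply/eqP; exact: Ev.
Qed.

(** On Gr(y) the equations of Gr(x) are the coordinates of (y - x) v.  If all of them
    were multiples of one linear form, y - x would have rank one, x^-1 y would fix a
    hyperplane, and would be a reflection. *)
Lemma unrelM x y : x != y -> ~~ dep S x y -> unrel resM x y.
Proof.
move=> ne nd; have [i0 [v0 c0]] := rho_ne ne.
have Dh w : (rho y - rho x)%VF w = rho y w - rho x w by rewrite add_lfunE opp_lfunE.
pose th i : {linear V -> k^o} := coord b i \o (rho y - rho x)%VF.
have thE i v : th i v = coord b i (rho y v - rho x v) by rewrite /= Dh.
have lfE i : resM y (gen x i) = form_poly (th i).
  by rewrite res_gen_lf; apply: lf_eq => v; rewrite thE.
have key : (exists j, forall a, exists i : 'I_n, th j (bb i) != a * th i0 (bb i)) ->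
    unrel resM x y.
  move=> [j ind]; exists (gen x i0), (gen x j); split; [by rewrite res_gen subrr|by rewrite res_gen subrr|].
  apply: (coprime_pair_eq (lfE i0) (lfE j)).
  apply: (@linear_forms_coprime k n (fun i => th i0 (bb i)) (fun i => th j (bb i))) => //.
  apply: contrapT => h; move: c0; rewrite -thE => /negP; apply; apply/eqP.
  apply: (lf0_eq (f := th i0)); rewrite /form_poly big1 // => i _.
  have [->|c] := eqVneq (th i0 (bb i)) 0; first by rewrite scale0r.
  by case: h; exists i.
apply: contrapT => nu.
have {nu key}h j : exists a, forall v, th j v = a * th i0 v.
  have /contrapT[a ha] : ~ ~ exists a, forall i : 'I_n, th j (bb i) = a * th i0 (bb i).
    move=> h2; apply: nu; apply: key; exists j => a; apply: contrapT => h3; apply: h2.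
    by exists a => i; apply: contrapT => /eqP h4; apply: h3; exists i.
  exists a => v; rewrite (vbasisE v) !linear_sum mulr_sumr; apply: eq_bigr => i _.
  by rewrite !linearZ_LR ha /= mulrCA.
pose D := (rho y - rho x)%VF.
have /choice[c hc] := h.
pose w := \sum_i c i *: (bb i).
have Dx v : D v = th i0 v *: w.
  rewrite (vbasisE (D v)) scaler_sumr; apply: eq_bigr => i _.
  by rewrite -[coord b i (D v)]/(th i v) hc scalerA mulrC.
have imD : (\dim (limg D) <= 1)%N.
  apply: leq_trans (_ : \dim <[w]> <= 1)%N; last by rewrite dim_vline; case: eqP.
  by apply/dimvS/subvP => u /memv_imgP[v _ ->]; rewrite Dx; apply/vlineP; exists (th i0 v).
have kerD : lker D = fixedSpace (rho (x^-1 * y)%g).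
  apply/vspaceP => v; rewrite memv_ker Dh subr_eq0; apply/eqP/fixedSpaceP; rewrite rhoM.
    by move=> ->; rewrite -rhoM mulVg rho1.
  by move=> E; rewrite -[in RHS]E -rhoM mulgV rho1.
have dims := limg_ker_dim D fullv; rewrite capfv kerD in dims.
have fixn : fixedSpace (rho (x^-1 * y)%g) != fullv.
  apply/negP => /eqP E; have : v0 \in fixedSpace (rho (x^-1 * y)%g) by rewrite E memvf.
  by rewrite -kerD memv_ker => /eqP Dv; move: c0; rewrite -Dh -/D Dv linear0 eqxx.
have lt : (\dim (fixedSpace (rho (x^-1 * y)%g)) < \dim {:V})%N.
  rewrite ltn_neqAle dimvS ?subvf // andbT; apply: contraNneq fixn => E.
  by rewrite eqEdim subvf E leqnn.
have : reflection S (x^-1 * y)%g.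
  case: hrho => _ _ /(_ (x^-1 * y)%g)[refl _]; apply: refl.
  by move: dims imD lt; move: (\dim _) (\dim _) (\dim _) => d1 d2 d3; lia.
case=> z [s [sS E]]; move: nd => /negP; apply; apply/asboolP.
exists (x * z)%g, s; split=> //.
rewrite invgM !mulgA -(mulgA x z) -(mulgA x) -E !mulgA mulgV mul1g; by [].
Qed.

(** s - 1 has rank one, so s v = v + th(v) v0, and th is the equation of the
    hyperplane fixed by s. *)
Lemma reflection_form s : s \in S -> exists al : R,
  [/\ al != 0, actM s al = - al & forall i, exists c, 'X_i - actM s 'X_i = al * c%:MP].
Proof.
move=> sS; have ss : (s * s = 1)%g := gen_involutive hS sS.
pose f := (rho s - \1)%VF.
have fE v : f v = rho s v - v by rewrite add_lfunE opp_lfunE id_lfunE.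
have dimf : \dim (limg f) = 1%N.
  have := limg_ker_dim f fullv; rewrite capfv.
  have rs : reflection S s by exists 1%g, s; rewrite mul1g invg1 mulg1.
  case: hrho => _ _ /(_ s)[_ /(_ rs) <-].
  by rewrite /fixedSpace -/f; move: (\dim _) (\dim _) => d1 d2; lia.
pose v0 := vpick (limg f).
have v00 : v0 != 0 by rewrite vpick0 -dimv_eq0 dimf.
have limf : limg f = <[v0]>%VS.
  apply/eqP; rewrite eq_sym eqEdim dimf dim_vline v00 andbT.
  by rewrite -memvE memv_pick.
have [i1 ci1] : exists i, coord b i v0 != 0.
  apply: contrapT => h; move/eqP: v00; apply; rewrite (vbasisE v0) big1 // => i _.
  have [->|c] := eqVneq (coord b i v0) 0; first by rewrite scale0r.
  by case: h; exists i.
pose th0 (v : V) : k^o := coord b i1 (f v) / coord b i1 v0.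
have th_lin : linear th0.
  by move=> a u v; rewrite /th0 !linearP /= mulrDl -mulrA.
pose th : {linear V -> k^o} := mklin th_lin.
have thE v : f v = th v *: v0.
  have : f v \in limg f by rewrite memv_img ?memvf.
  by rewrite limf => /vlineP[a Ea]; rewrite /= /th0 /linear_of Ea linearZ /= mulfK.
exists (form_poly th); split.
- apply/eqP => /lf0_eq h.
  have : v0 \in limg f by rewrite memv_pick.
  by move=> /memv_imgP[u _ E]; move/eqP: v00; apply; rewrite E thE h scale0r.
- rewrite act_lf (gen_inv hS sS) -mulN1r -mpolyC1 -mpolyCN mul_mpolyC /form_poly scaler_sumr.
  apply: eq_bigr => j _; rewrite scalerA mulN1r; congr (_ *: _).
  rewrite /= /linear_of /th0 -mulNr -linearN; congr (coord b i1 _ / _).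
  by rewrite !fE -rhoM ss rho1 opprB.
move=> i; exists (- coord b i v0).
rewrite act_X (gen_inv hS sS) -lf_coord -sumrB mulrC mul_mpolyC /form_poly scaler_sumr.
apply: eq_bigr => j _; rewrite scalerA -scalerBl; congr (_ *: _).
rewrite -linearB -opprB -fE thE linearN linearZ /=.
by rewrite mulNr mulrC.
Qed.

Section OneReflection.
Variable s : W.
Hypothesis sS : s \in S.

Definition refl_form : R := sval (cid (reflection_form sS)).
Local Notation al := refl_form.

Lemma refl_form_neq0 : al != 0.
Proof. by rewrite /al; case: cid => ? []. Qed.

Lemma act_refl_form : actM s al = - al.
Proof. by rewrite /al; case: cid => ? []. Qed.

Lemma act_diff i : exists c, 'X_i - actM s 'X_i = al * c%:MP.
Proof. by rewrite /al; case: cid => ? []. Qed.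

Definition sLM : {rmorphism A -> A} := comp_mpoly
  [tuple match split i with inl j => injL (actM s 'X_j) | inr j => 'X_(rshift n j) end
    | i < n + n].

Lemma sLM_C c : sLM c%:MP = c%:MP.
Proof. exact: comp_mpolyC. Qed.

Lemma sLM_L i : sLM 'X_(lshift n i) = injL (actM s 'X_i).
Proof.
rewrite /sLM /= comp_XU; case: (splitP (lshift n i)) => j /= E.
  by congr (injL (actM _ 'X_(_))); apply: val_inj.
by have := ltn_ord i; lia.
Qed.

Lemma sLM_R i : sLM 'X_(rshift n i) = 'X_(rshift n i).
Proof.
rewrite /sLM /= comp_XU; case: (splitP (rshift n i)) => j /= E.
  by have := ltn_ord j; lia.
by congr 'X_(_); apply: val_inj => /=; lia.
Qed.

Opaque sLM.

Lemma sLM_inj r : sLM (injM r) = injM r.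
Proof.
apply: (mpoly_rmorph_eq (f := sLM \o injM)) => [c|i].
  by rewrite /= injM_C sLM_C.
by rewrite /= injM_X sLM_R.
Qed.

Lemma sLM_injL r : sLM (injL r) = injL (actM s r).
Proof.
apply: (mpoly_rmorph_eq (f := sLM \o injL) (g := injL \o actM s)) => [c|i].
  by rewrite /= act_C injL_C sLM_C.
by rewrite /= injL_X sLM_L.
Qed.

Lemma injL_inj : injective injL.
Proof.
move=> p q /(congr1 (resM 1%g)); rewrite !resM_injL.
exact: (can_inj (actMVK 1%g)).
Qed.

Definition alpha : A := injL al.

Lemma alpha_neq0 : alpha != 0.
Proof. by rewrite /alpha -(rmorph0 injL) (inj_eq injL_inj) refl_form_neq0. Qed.

Lemma sLM_alpha : sLM alpha = - alpha.
Proof. by rewrite /alpha sLM_injL act_refl_form rmorphN. Qed.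

Lemma sLM_diff i : exists c, 'X_i - sLM 'X_i = alpha * c%:MP.
Proof.
elim/ord_split: i => i; last by exists 0; rewrite sLM_R subrr mulr0.
have [c E] := act_diff i; exists c.
by rewrite sLM_L -injL_X -rmorphB E rmorphM /= injL_C.
Qed.

Lemma sLM_dec f : exists uv : A * A,
  [/\ sLM uv.1 = uv.1, sLM uv.2 = uv.2 & f = uv.1 + alpha * uv.2].
Proof.
exact: (split_ex two_neq0 sLM_C sLM_diff sLM_alpha alpha_neq0).
Qed.

Lemma sLM_uniq u v : sLM u = u -> sLM v = v -> u + alpha * v = 0 -> u = 0 /\ v = 0.
Proof.
exact: (split_uniq two_neq0 sLM_alpha alpha_neq0).
Qed.

Lemma act_dec r : exists uv : R * R,
  [/\ actM s uv.1 = uv.1, actM s uv.2 = uv.2 & r = uv.1 + al * uv.2].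
Proof.
exact: (split_ex two_neq0 (act_C s) act_diff act_refl_form refl_form_neq0).
Qed.

Definition tw x : W := (s * x)%g.

Lemma twK : involutive tw.
Proof. by move=> x; rewrite /tw (gen_mulK hS sS). Qed.

Lemma resM_sLM x f : resM x (sLM f) = resM (tw x) f.
Proof.
have hC c : resM x (sLM c%:MP) = resM (tw x) c%:MP.
  exact: etrans (congr1 (resM x) (sLM_C c)) (etrans (resM_C x c) (esym (resM_C _ c))).
have hX i : resM x (sLM 'X_i) = resM (tw x) 'X_i.
  elim/ord_split: i => i; last first.
    exact: etrans (congr1 (resM x) (sLM_R i)) (etrans (resM_R x i) (esym (resM_R _ i))).
  apply: etrans (congr1 (resM x) (sLM_L i)) _.
  apply: etrans (resM_injL x _) (esym (etrans (resM_L _ i) _)).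
  by rewrite /tw invgM (gen_inv hS sS) actM_mul.
exact: (mpoly_rmorph_eq (f := resM x \o sLM) (g := resM (tw x)) hC hX f).
Qed.

Lemma resM_tw x f : resM (tw x) f = 0 -> resM x (sLM f) = 0.
Proof. exact: etrans (resM_sLM x f). Qed.

Lemma resM_tw_alpha x : resM (tw x) alpha = - resM x alpha.
Proof.
apply: etrans (esym (resM_sLM x _)) _.
exact: etrans (congr1 (resM x) sLM_alpha) (rmorphN (resM x) _).
Qed.

Lemma resM_alpha2 x : resM x alpha + resM x alpha != 0.
Proof.
rewrite -mulr2n -mulr_natl mulf_neq0 ?mp2 ?two_neq0 //.
rewrite /alpha resM_injL -(rmorph0 (actM x^-1%g)).
by rewrite (inj_eq (can_inj (actMVK x))) refl_form_neq0.
Qed.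

End OneReflection.
End Geometry.

Local Opaque dimv injM injL actM resM sLM.

(** * Direct sums of graded bimodules *)

Section DirectSums.
Variables (k : fieldType) (n : nat).
Local Notation A := {mpoly k[n + n]}.
Implicit Types M N : gbimod k n.

Section QuotientMap.
Variables (M : gbimod k n) (U : gsubmod M).
Fact gquo_pi_linear : linear (gquo_pi U : M -> gquo U).
Proof. by move=> f m m'; rewrite raddfD /= gquo_piZ. Qed.
Fact gquo_pi_gpr i m :
  gpr i (mklin gquo_pi_linear m) = mklin gquo_pi_linear (gpr i m).
Proof. exact: gquo_prE. Qed.
Definition gquo_proj : ghom M (gquo U) := GHom gquo_pi_gpr.
End QuotientMap.

Section Sum.
Variables (I : eqType) (N : I -> gbimod k n) (M : gbimod k n).
Hypothesis dsM : is_direct_sum N M.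

Definition ghom_cast i j (e : i = j) : ghom (N i) (N j) :=
  match e in _ = j' return ghom (N i) (N j') with erefl => ghom_id (N i) end.

Definition ghom_delta j i : ghom (N i) (N j) :=
  match i =P j with
  | ReflectT e => ghom_cast e
  | ReflectF _ => ghom0 (N i) (N j)
  end.

Lemma ghom_delta_same i m : ghom_delta i i m = m.
Proof. by rewrite /ghom_delta; case: eqP => // e; rewrite (eq_axiomK e). Qed.

Lemma ghom_delta_ne i j m : i != j -> ghom_delta j i m = 0.
Proof. by rewrite /ghom_delta; case: eqP. Qed.

(** The universal property gives the projections.  That the summands span M is seen by
    comparing the projection onto M modulo their span with the zero map. *)
Lemma direct_sum_proj : exists (io : forall i, ghom (N i) M)
    (p : forall i, ghom M (N i)),
  [/\ forall i m, p i (io i m) = m,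
      forall i j m, i != j -> p j (io i m) = 0
    & forall m, exists s, [/\ uniq s, forall i, i \notin s -> p i m = 0
        & m = \sum_(i <- s) io i (p i m)]].
Proof.
have [io univ] := dsM; exists io.
have /dep_choice[p pP] j : exists p : ghom M (N j),
    forall i m, p (io i m) = ghom_delta j i m.
  by have [p [hp _]] := univ (N j) (fun i => ghom_delta j i); exists p.
exists p; have pio i m : p i (io i m) = m by rewrite pP ghom_delta_same.
have pio0 i j m : i != j -> p j (io i m) = 0 by move=> ne; rewrite pP ghom_delta_ne.
split=> // m.
pose T := {i : I & gcarrier (N i)}; pose el i (u : N i) : T := existT _ i u.
pose ev (c : T) := io (projT1 c) (projT2 c).
pose U : {pred M} := fun m => `[< exists s : seq T, m = \sum_(c <- s) ev c >].
have Uc : submod_closed U.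
  split=> [|f u v /asboolP[s ->] /asboolP[t ->]]; first by apply/asboolP; exists [::]; rewrite big_nil.
  apply/asboolP; exists ([seq el _ (f *: projT2 c) | c : T <- s] ++ t).
  rewrite big_cat big_map scaler_sumr; congr (_ + _).
  by apply: eq_bigr => c _; rewrite /ev /= linearZ.
have Ug i u : u \in U -> gpr i u \in U.
  move=> /asboolP[s ->]; apply/asboolP.
  exists [seq el _ (gpr i (projT2 c)) | c : T <- s].
  by rewrite gpr_bigsum big_map; apply: eq_bigr => c _; rewrite /ev /= gfunP.
pose GU := GSubmod Uc Ug.
have [psi [_ uniq_psi]] := univ (gquo GU) (fun i => ghom0 (N i) (gquo GU)).
have E1 : gquo_proj GU =1 psi.
  apply: uniq_psi => i u; rewrite [RHS]/= -[RHS](raddf0 (gquo_pi GU)).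
  apply/eqP; rewrite [_ == _]gquo_eq subr0; apply/asboolP; exists [:: el i u].
  by rewrite big_seq1.
have E2 : ghom0 M (gquo GU) =1 psi by exact: uniq_psi.
have : gquo_pi GU m = gquo_pi GU 0.
  by rewrite raddf0; have := E1 m; rewrite -E2.
move/eqP; rewrite gquo_eq subr0 => /asboolP[s Es].
exists (undup [seq projT1 c | c <- s]); split; first exact: undup_uniq.
  move=> i; rewrite mem_undup => ni; rewrite Es linear_sum big_seq big1 // => c cs.
  apply: pio0; apply: contraNneq ni => <-; exact: map_f.
have F i : io i (p i m) = \sum_(c <- s) io i (p i (ev c)).
  by rewrite {1}Es linear_sum linear_sum.
rewrite (eq_bigr _ (fun i _ => F i)) {1}Es.
rewrite exchange_big /= [LHS]big_seq [RHS]big_seq; apply: eq_bigr => c cs.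
rewrite (bigD1_seq (projT1 c)) ?undup_uniq ?mem_undup ?map_f //=.
rewrite pio big1 ?addr0 // => i ne; rewrite pio0 ?linear0 //.
by rewrite eq_sym.
Qed.

End Sum.
End DirectSums.

(** * From flags of bimodules to chains of graphs *)

Section Flags.
Variables (k : fieldType) (W : groupType) (S : {pred W}) (V : vectType k).
Variable rho : W -> 'End(V).
Hypothesis hk : 2%N \notin [pchar k].
Hypothesis hS : coxeter_system S.
Hypothesis hrho : reflection_faithful S rho.

Local Notation n := (\dim {:V}).
Local Notation R := {mpoly k[n]}.
Local Notation A := {mpoly k[n + n]}.
Local Notation inj := (injM V).
Local Notation res := (resM rho).
Local Notation gens := (gensM rho).
Implicit Types (M : gbimod k n) (C : W -> Prop).

(** The implication from the left to the right is the compactness of the support. *)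
Lemma supported_Gam C M (m : M) : supported rho C m <-> Gam gens C m.
Proof.
split=> [h|[Ks hK kill] P annP].
  apply: prime_cover => Q annQ; have [x [Cx hx]] := h Q annQ.
  exists (gens x); first by exists x.
  move=> f fx; apply: hx; apply: (resM_eq0 hrho x f).1; exact: (res_gensM hk hrho fx).
have PM (f g : A) : f * g \in P -> f \in P \/ g \in P.
  by rewrite prime_idealrM => /orP.
have [K KKs KP] : exists2 K, K \in Ks & forall f, f \in K -> f \in P.
  apply: contrapT => h.
  have [F FK FP] : exists2 F, F \in prods Ks & F \notin P.
    elim: Ks h {hK kill} => [|K Ks IH] h; first by exists 1; rewrite ?inE // idealr1.
    have [[K' K's hK']|F FK FP] := IH.
      by apply: h; exists K' => //; rewrite inE K's orbT.
    have [g gK gP] : exists2 g, g \in K & g \notin P.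
      apply: contrapT => h'; apply: h; exists K; first by rewrite inE eqxx.
      by move=> f fK; apply/negPn/negP => fP; apply: h'; exists f.
    exists (g * F); first exact: mem_prods_cons.
    by apply/negP => /PM[|]; apply/negP.
  by move/negP: FP; apply; apply: annP; apply: kill.
have [x Cx EK] := hK K KKs; exists x; split=> // f.
move=> /(resM_eq0 hrho x f).2 fx; have [s hs E] := gensMP hk hrho x f.
move: E; rewrite fx rmorph0 subr0 => ->; rewrite big_seq; apply: rpred_sum => c cs.
have cP : c.2 \in P by apply: KP; rewrite EK; exact: hs.
by rewrite prime_idealrM cP orbT.
Qed.

Section Quotients.
Variables ge gt : W -> W -> Prop.
Hypothesis gt_ge : forall x y, gt x y -> ge x y.

Section ModuleQuotient.
Variables (x : W) (M : gbimod k n).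
Local Notation Q := (GammaQ rho (ge x) (gt x) M).
Local Notation G := (Gamma rho (ge x) M).

(** A total function on M, sending the sections off Gr(ge x) to 0. *)
Definition to_quo (m : M) : Q :=
  gquo_pi (GammaQ_sub rho (ge x) (gt x) M) (insubd (0 : G) m).

Lemma val_insubd_Gam (m : M) : Gam gens (ge x) m -> gsub_val (insubd (0 : G) m) = m.
Proof. by move=> /supported_Gam h; apply: insubdK; apply/asboolP. Qed.

Lemma to_quo_eq (u : G) m : gsub_val u = m ->
  to_quo m = gquo_pi (GammaQ_sub rho (ge x) (gt x) M) u.
Proof. by move=> <-; rewrite /to_quo valKd. Qed.

Lemma to_quo_surj (q : Q) : exists2 m, Gam gens (ge x) m & q = to_quo m.
Proof.
have [u ->] := gquo_surj q; exists (gsub_val u); last by rewrite (to_quo_eq (u := u)).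
by apply/supported_Gam; have /asboolP := valP u.
Qed.

Lemma to_quoD m m' : Gam gens (ge x) m -> Gam gens (ge x) m' ->
  to_quo (m + m') = to_quo m + to_quo m'.
Proof.
move=> h h'; rewrite -[RHS]raddfD; apply: to_quo_eq.
by rewrite /= !val_insubd_Gam.
Qed.

Lemma to_quoZ f m : Gam gens (ge x) m -> to_quo (f *: m) = f *: to_quo m.
Proof.
move=> h; rewrite -[RHS]gquo_piZ; apply: to_quo_eq.
by rewrite /= val_insubd_Gam.
Qed.

Lemma to_quo_eq0 m : Gam gens (ge x) m -> to_quo m = 0 <-> Gam gens (gt x) m.
Proof.
move=> h; rewrite /to_quo -[X in _ = X](raddf0 (gquo_pi (GammaQ_sub rho (ge x) (gt x) M))).
have E : (gquo_pi (GammaQ_sub rho (ge x) (gt x) M) (insubd (0 : G) m) ==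
   gquo_pi (GammaQ_sub rho (ge x) (gt x) M) 0) = (m \in Gamma_mem rho (gt x) (M:=M)).
  by rewrite gquo_eq subr0 -[in RHS](val_insubd_Gam h).
split=> [/eqP|/supported_Gam h']; first by rewrite E => /asboolP/supported_Gam.
by apply/eqP; rewrite E; apply/asboolP.
Qed.

Lemma Rx_scaleE f (u : Rx rho x) : f *: u = (res_Gr rho x f * (u : R) : Rx rho x).
Proof. by []. Qed.

Lemma Rx_inj (u : R) : inj (actM rho x^-1%g u) *: ((1 : R) : Rx rho x) = u.
Proof.
rewrite Rx_scaleE mulr1.
have := resMK hk hrho x (actM rho x^-1%g u); rewrite resME => /(congr1 (actM rho x)).
by rewrite !(actMVK hrho).
Qed.

Lemma Rx_right (r : R) (u : Rx rho x) :
  actM rho x^-1%g (inj r *: u : Rx rho x) = r * actM rho x^-1%g (u : R).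
Proof.
rewrite Rx_scaleE rmorphM -resME; congr (_ * _); exact: (resMK hk hrho).
Qed.

(** The generators 1 of the summands R_x, and the projections onto the summands,
    brought back to the right action by x^-1, form a dual basis. *)
Lemma quo_flag : sum_of_shifts_of_Rx rho x Q ->
  dual_basis inj (@Gam _ _ gens (gt x) M) (@Gam _ _ gens (ge x) M) /\
  (forall f (m : M), res x f = 0 -> Gam gens (ge x) m -> Gam gens (gt x) (f *: m)).
Proof.
move=> [I [d ds]].
have [io [p [pio pio0 gen]]] := @direct_sum_proj k n (classicType I) _ Q ds.
have GD (C : W -> Prop) (m m' : M) : Gam gens C m -> Gam gens C m' -> Gam gens C (m + m').
  exact: coverD.
have GZ (C : W -> Prop) f (m : M) : Gam gens C m -> Gam gens C (f *: m).
  exact: coverZ.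
have tqB m m' : Gam gens (ge x) m -> Gam gens (ge x) m' ->
    to_quo (m - m') = to_quo m - to_quo m'.
  move=> h h'; rewrite -scaleN1r to_quoD //; last exact: GZ.
  by rewrite to_quoZ // scaleN1r.
split; last first.
  move=> f m fx Gm; apply/to_quo_eq0; first exact: GZ.
  rewrite to_quoZ //; have [s [_ _ ->]] := gen (to_quo m).
  rewrite scaler_sumr big1 // => i _; rewrite -linearZ.
  have -> : f *: p i (to_quo m) = 0.
    rewrite [LHS](Rx_scaleE f (p i (to_quo m))).
    by rewrite ((resM_eq0 hrho x f).1 fx) mul0r.
  exact: linear0.
have /choice[e eP] i : exists m, Gam gens (ge x) m /\ io i ((1 : R) : Rx rho x) = to_quo m.
  by have [m ? ?] := to_quo_surj (io i ((1 : R) : Rx rho x)); exists m.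
exists (classicType I), e, (fun i m => actM rho x^-1%g (p i (to_quo m))); split.
- by move=> i; case: (eP i).
- by move=> i m m' Gm Gm'; rewrite to_quoD // linearD rmorphD.
- by move=> i r m Gm; rewrite to_quoZ // linearZ; apply: Rx_right.
- move=> i m Gm; have -> : to_quo m = 0.
    by apply/to_quo_eq0 => //; apply: cover_sub Gm => K [y /gt_ge]; exists y.
  by rewrite linear0 rmorph0.
move=> m Gm; have [s [us s0 E]] := gen (to_quo m).
exists s; split=> //; first by move=> i /s0->; rewrite rmorph0.
have Gs : Gam gens (ge x) (\sum_(i <- s) inj (actM rho x^-1%g (p i (to_quo m))) *: e i).
  apply: (big_ind (@Gam _ _ gens (ge x) M)) => [||i _]; [exact: cover0|exact: GD|].
  by apply: GZ; case: (eP i).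
have GB : Gam gens (ge x) (m - \sum_(i <- s) inj (actM rho x^-1%g (p i (to_quo m))) *: e i).
  by apply: GD => //; rewrite -scaleN1r; apply: GZ.
apply/to_quo_eq0 => //; rewrite tqB //.
have tqS (t : seq (classicType I)) (F : classicType I -> M) : (forall i, Gam gens (ge x) (F i)) ->
    to_quo (\sum_(i <- t) F i) = \sum_(i <- t) to_quo (F i).
  move=> GF; elim: t => [|i t IH].
    by rewrite !big_nil; apply/to_quo_eq0; apply: cover0.
  rewrite !big_cons to_quoD ?IH //.
  by apply: (big_ind (@Gam _ _ gens (ge x) M)) => // ; [exact: cover0|exact: GD].
rewrite tqS; last by move=> i; apply: GZ; case: (eP i).
rewrite {1}E; apply/eqP; rewrite subr_eq0; apply/eqP; apply: eq_bigr => i _.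
have [Ge Ee] := eP i; rewrite to_quoZ // -Ee -linearZ; congr (io i _).
by rewrite [RHS](Rx_inj (p i (to_quo m))).
Qed.

End ModuleQuotient.

Lemma GammaQ_homE x (M N : gbimod k n) (f : ghom M N) (m : M) :
  Gam gens (ge x) m ->
  GammaQ_hom rho (ge x) (gt x) f (to_quo x m) = to_quo x (f m).
Proof.
move=> Gm; rewrite /to_quo.
set u := insubd _ m; have Eu : gsub_val u = m by apply: val_insubd_Gam.
have E := @gquo_funE _ _ _ _ (Gamma_hom rho (ge x) f) (GammaQ_sub rho (ge x) (gt x) M)
  (GammaQ_sub rho (ge x) (gt x) N) (@GammaQ_map _ _ _ rho (ge x) (gt x) M N f) u.
apply: etrans E _; apply/esym; apply: to_quo_eq.
by rewrite /= Eu.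
Qed.

Definition uc (F : complex k n) : ungraded_complex A :=
  @UCx A (fun i => gcarrier (F i)) (fun i => gfun (cd F i)) (fun i m => cd_cd m).

Lemma uc_bounded F : ubounded (uc F).
Proof. exact: cbounded. Qed.

Lemma quo_acyclic x F :
  homotopic_to_zero (GammaQ_complex rho (ge x) (gt x) F) ->
  acyclic_on (X := uc F) (fun i => @Gam _ _ gens (gt x) (F i))
    (fun i => @Gam _ _ gens (ge x) (F i)).
Proof.
move=> [h hE] i m Gm dm.
have Gdm : Gam gens (ge x) (cd F (i + 1) m).
  by apply: cover_sub dm => K [y /gt_ge]; exists y.
have Ed : GammaQ_hom rho (ge x) (gt x) (cd F (i + 1)) (to_quo x m) = 0.
  by rewrite GammaQ_homE //; apply/to_quo_eq0.
have [v Gv Ev] := to_quo_surj (h i (to_quo x m)).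
exists v => //.
have E : to_quo x m = to_quo x (cd F i v).
  have := hE i (to_quo x m); rewrite /= subr0 Ed linear0 addr0 => ->.
  by rewrite Ev GammaQ_homE.
have Gdv : Gam gens (ge x) (cd F i v).
  have [Ks hK kill] := Gv; exists Ks => // f /kill E'.
  by rewrite -linearZ E' linear0.
have GN : Gam gens (ge x) (- (cd F i v)) by rewrite -scaleN1r; apply: coverZ.
apply/(to_quo_eq0 (x := x)); first exact: coverD.
rewrite to_quoD // -scaleN1r to_quoZ // scaleN1r E subrr.
by [].
Qed.

Lemma common_support (F : complex k n) : (forall i, finite_support rho (F i)) ->
  exists L : seq W, forall i (m : F i), Gam gens (fun x => x \in L) m.
Proof.
move=> fs; have [b hb] := cbounded F.
have /choice[X hX] i : exists X : seq W, forall m : F i, supported rho (fun x => x \in X) m.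
  by have [X hX] := fs i; exists X.
pose s := [seq j%:Z - b%:Z | j <- iota 0 (b + b).+1].
exists (flatten [seq X i | i <- s]) => i m.
have [le|lt] := leqP `|i|%N b; last by rewrite (hb i lt m); apply: cover0.
have is_s : i \in s.
  apply/mapP; exists (absz (i + b%:Z)%R); last by lia.
  by rewrite mem_iota; lia.
have /supported_Gam := hX i m; apply: cover_sub => K [x xX ->]; exists x => //.
by apply/flattenP; exists (X i) => //; apply: map_f.
Qed.

Section Chain.
Hypothesis ge_refl : forall x, ge x x.
Hypothesis gtE : forall x y, gt x y <-> ge x y /\ y <> x.
Hypothesis gt_chain : forall x y z, gt x y -> gt y z ->
  [\/ unrel res x y, unrel res y z | unrel res x z].

Definition flag M := [/\ finitely_generated M, finite_support rho M
    & forall x, sum_of_shifts_of_Rx rho x (GammaQ rho (ge x) (gt x) M)].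

Variable F : complex k n.
Hypothesis flF : termwise flag F.
Hypothesis acF : forall x, homotopic_to_zero (GammaQ_complex rho (ge x) (gt x) F).

Lemma flag_flag_like L : (forall i (m : F i), Gam gens (fun x => x \in L) m) ->
  forall i, flag_like inj res gens ge gt L (F i).
Proof.
move=> hL i; have [_ _ fl] := flF i; split.
- exact: hL.
- by move=> x; case: (quo_flag (fl x)).
by move=> x f m; case: (quo_flag (fl x)) => _; apply.
Qed.

(** The hypothesis on L says that it is ordered compatibly with gt, except that
    unrelated elements may be placed freely. *)
Lemma flag_chain L : (forall i (m : F i), Gam gens (fun x => x \in L) m) ->
  uniq L ->
  (forall (L1 : seq W) x (C : seq W), L = L1 ++ x :: C ->
    (forall y, y \in C -> gt x y \/ unrel res y x) /\
    (forall y, y \in L -> gt x y -> y \in C)) ->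
  supp_all inj res (uc F) L /\ good_chain inj res (uc F) L.
Proof.
move=> hL uL arr; have fl := flag_flag_like hL; split.
  move=> i m; exact: (supp_all_L (resMK hk hrho) (sepM hk hrho) (gensMP hk hrho)
    (fun x g => @res_gensM _ _ _ _ _ hk hrho x g) ge_refl gtE (fl i)).
exact: (good_chain_flag (X := uc F) (resMK hk hrho) (sepM hk hrho) (gensMP hk hrho)
    (fun x g => @res_gensM _ _ _ _ _ hk hrho x g) ge_refl gtE gt_chain fl
    (fun x => quo_acyclic (acF x)) uL arr).
Qed.

Lemma flag_torsionfree (L : seq W) (h : W -> nat) :
  (forall i (m : F i), Gam gens (fun x => x \in L) m) ->
  (forall x y, gt x y -> (h y < h x)%N) ->
  forall i (m : F i), torsion inj m -> m = 0.
Proof.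
move=> hL hh i m.
exact: (flag_torsion0 ge_refl (flag_flag_like hL i) hh).
Qed.

End Chain.
End Quotients.
End Flags.

(** * Soergel bimodules as retracts of iterated doublings *)

Section MkAdditive.
Variables (Z Z' : zmodType) (f : Z -> Z').
Hypothesis fB : {morph f : x y / x - y}.
Definition additive_of & {morph f : x y / x - y} := f.
HB.instance Definition _ := GRing.isZmodMorphism.Build Z Z' (additive_of fB) fB.
Definition mkadd : {additive Z -> Z'} := additive_of fB.
Lemma zmod_morphD x y : f (x + y) = f x + f y.
Proof. exact: (raddfD mkadd). Qed.
End MkAdditive.

Section Soergel.
Variables (k : fieldType) (W : groupType) (S : {pred W}) (V : vectType k).
Variable rho : W -> 'End(V).
Hypothesis hk : 2%N \notin [pchar k].
Hypothesis hS : coxeter_system S.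
Hypothesis hrho : reflection_faithful S rho.

Local Notation n := (\dim {:V}).
Local Notation R := {mpoly k[n]}.
Local Notation A := {mpoly k[n + n]}.
Local Notation inj := (injM V).
Local Notation injl := (injL V).
Local Notation res := (resM rho).
Local Notation gens := (gensM rho).
Implicit Types (M N : gbimod k n).

Lemma lactE M r (m : M) : lact r m = injl r *: m.
Proof. by []. Qed.

Lemma ractE M r (m : M) : ract m r = inj r *: m.
Proof. by []. Qed.

Lemma graph_regular : graph_module res 1%g (regular rho).
Proof.
exists ((1 : R) : regular rho) => [u|f].
  exists (inj (actM rho 1^-1%g (u : R))); apply/esym; exact: (Rx_inj hk hrho 1%g (u : R)).
split=> [E|E]; first by apply/(resM_eq0 hrho); rewrite -[LHS]mulr1.
by rewrite Rx_scaleE ((resM_eq0 hrho 1%g f).1 E) mul0r.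
Qed.

Lemma regular_ract (u : regular rho) r : ract u r = (r * (u : R) : regular rho).
Proof.
rewrite ractE Rx_scaleE; congr (_ * _).
have := resMK hk hrho 1%g r; rewrite resME => /(congr1 (actM rho 1%g)).
by rewrite (actMVK hrho) (actM_1 hrho).
Qed.

Lemma regular_lact (u : regular rho) r : lact r u = (r * (u : R) : regular rho).
Proof.
rewrite lactE Rx_scaleE; congr (_ * _).
have := resM_injL rho hk 1%g r; rewrite resME => /(congr1 (actM rho 1%g)).
by rewrite !(actMVK hrho).
Qed.

Section Double.
Variable s : W.
Hypothesis sS : s \in S.

Local Notation al := (refl_form hk hS hrho sS).

Definition dS (N : lmodType A) : lmodType A :=
  dmod (sLM_dec hk hS hrho sS) (@sLM_uniq _ _ _ _ _ hk hS hrho _ sS) (sLM_alpha hk hS hrho sS) N.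

Definition dSx (X : ungraded_complex A) : ungraded_complex A :=
  dcx (sLM_dec hk hS hrho sS) (@sLM_uniq _ _ _ _ _ hk hS hrho _ sS) (sLM_alpha hk hS hrho sS) X.

Section InvariantAction.
Variable N : lmodType A.

Lemma dS_inv r (y : dS N) : actM rho s r = r -> injl r *: y = (injl r *: y.1, injl r *: y.2).
Proof.
by move=> ir; apply: dscale_inv; rewrite (sLM_injL rho hk sS) ir.
Qed.

Lemma dS_pair r (a : N) : actM rho s r = r ->
  injl r *: ((a, 0) : dS N) = ((injl r *: a, 0) : dS N).
Proof. by move=> ir; rewrite dS_inv //= scaler0. Qed.

Lemma dS_pair_inj r (a : N) : inj r *: ((a, 0) : dS N) = ((inj r *: a, 0) : dS N).
Proof.
rewrite [LHS](dscale_inv (_ : dS N) (sLM_inj rho hk sS r)) /= scaler0.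
by [].
Qed.

Lemma dS_pairD (a a' : N) : ((a + a', 0) : dS N) = ((a, 0) : dS N) + ((a', 0) : dS N).
Proof. by congr pair; rewrite /= addr0. Qed.

Lemma dS_injl r : exists u v : R, [/\ actM rho s u = u, actM rho s v = v, r = u + al * v
  & forall a : N, injl r *: ((a, 0) : dS N) = (injl u *: a, injl v *: a)].
Proof.
have [[u v] /= [iu iv E]] := act_dec hk hS hrho sS r.
exists u, v; split=> // a.
have Ev : injl v *: ((a, 0) : dS N) = ((injl v *: a, 0) : dS N) by apply: dS_pair.
have Eu : injl u *: ((a, 0) : dS N) = ((injl u *: a, 0) : dS N) by apply: dS_pair.
rewrite E rmorphD rmorphM scalerDl -scalerA Ev Eu (dscale_alpha (_ : dS N)) /= scaler0.
by congr pair; rewrite ?addr0 ?add0r.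
Qed.

Lemma dS_alpha (a : N) : injl al *: ((a, 0) : dS N) = (0, a).
Proof. by rewrite (dscale_alpha (_ : dS N)) /= scaler0. Qed.

End InvariantAction.

Section Tensor.
Variables (T0 B N M : gbimod k n).
Hypothesis hT0 : is_tensor (invariant rho s) (regular rho) (regular rho) T0.
Hypothesis isoB : giso B (gshift T0 1).
Hypothesis hM : is_tensor (fun _ => True) B N M.

(** B_s (x)_R N is R (x)_(R^s) R (x)_R N up to a shift.  The map io sends r (x) r' (x) y
    to r times the pair (r' y, 0), and p sends (a, b) to
    1 (x) 1 (x) a + alpha (x) 1 (x) b. *)
Lemma tensor_iso : exists (io : {linear M -> dS N}) (p : {linear dS N -> M}),
  cancel io p.
Proof.
have [f0 [[[f0Dl f0Dr] f0b] f0l f0r _ univ0]] := hT0.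
have [g [g' [gK gK']]] := isoB.
have [f [[[fDl fDr] fb] fl fr _ univ]] := hM.
pose tB (b : B) : T0 := g b; pose Bt (t : T0) : B := g' t.
have tBK t : tB (Bt t) = t by apply: gK'.
have BtK b : Bt (tB b) = b by apply: gK.
have tBD b b' : tB (b + b') = tB b + tB b' by apply: (linearD g).
have tBZ c b : tB (c *: b) = c *: tB b by apply: (linearZ_LR g).
have BtD b b' : Bt (b + b') = Bt b + Bt b' by apply: (linearD g').
have BtZ c b : Bt (c *: b) = c *: Bt b by apply: (linearZ_LR g').
pose b0 (x : N) (r r' : regular rho) : dS N :=
  injl (r : R) *: ((injl (r' : R) *: x, 0) : dS N).
have pairM (a r : R) (y : N) : actM rho s a = a ->
    injl r *: ((injl a *: y, 0) : dS N) = injl (a * r) *: ((y, 0) : dS N).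
  move=> ia; rewrite rmorphM mulrC -[RHS]scalerA; congr (_ *: _).
  exact/esym/dS_pair.
have /choice[U U_spec] x : exists u : {additive T0 -> dS N},
    (forall r r', u (f0 r r') = b0 x r r') /\
    (forall u' : {additive T0 -> dS N}, (forall r r', u' (f0 r r') = b0 x r r') -> u' =1 u).
  have [||u [hu uu]] := univ0 (dS N) (b0 x); last by exists u.
  - split=> [r r2 r'|r r' r2]; rewrite /b0.
      by rewrite -scalerDl -rmorphD.
    by rewrite -scalerDr -dS_pairD -scalerDl -rmorphD.
  move=> a r r' ia; rewrite /b0 regular_ract regular_lact.
  apply: etrans (esym (pairM a r (injl (r' : R) *: x) ia)) _.
  by rewrite rmorphM scalerA.
have UE x r r' : U x (f0 r r') = b0 x r r' by case: (U_spec x).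
have T0_ext (Z : zmodType) (p q : T0 -> Z) : {morph p : x y / x - y} ->
    {morph q : x y / x - y} -> (forall r r', p (f0 r r') = q (f0 r r')) -> p =1 q.
  move=> pB qB E t; have pD := zmod_morphD pB.
  have [||u [hu uu]] := univ0 Z (fun r r' => p (f0 r r')).
  - by split=> [*|*]; rewrite ?f0Dl ?f0Dr pD.
  - by move=> a r r' ia; rewrite f0b.
  have -> : p t = u t by apply: (uu (mkadd pB)).
  by apply/esym; apply: (uu (mkadd qB)) => r r'; apply/esym/E.
have M_ext (Z : zmodType) (p q : M -> Z) : {morph p : x y / x - y} ->
    {morph q : x y / x - y} -> (forall b x, p (f b x) = q (f b x)) -> p =1 q.
  move=> pB qB E t; have pD := zmod_morphD pB.
  have [||u [hu uu]] := univ Z (fun r r' => p (f r r')).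
  - by split=> [*|*]; rewrite ?fDl ?fDr pD.
  - by move=> a r r' ia; rewrite fb.
  have -> : p t = u t by apply: (uu (mkadd pB)).
  by apply/esym; apply: (uu (mkadd qB)) => r r'; apply/esym/E.
have UB x : {morph U x : t t' / t - t'} by apply: raddfB.
have UD x x' t : U (x + x') t = U x t + U x' t.
  apply: (T0_ext _ (U (x + x')) (fun t => U x t + U x' t)) => [|u v|r r'].
  - exact: UB.
  - by rewrite !UB opprD addrACA.
  by rewrite !UE /b0 scalerDr dS_pairD scalerDr.
have Ul r x t : U x (injl r *: t) = injl r *: U x t.
  apply: (T0_ext _ (fun t => U x (injl r *: t)) (fun t => injl r *: U x t)) => [u v|u v|q q'].
  - by rewrite scalerBr UB.
  - by rewrite UB scalerBr.
  rewrite -lactE -f0l regular_lact !UE /b0.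
  by rewrite rmorphM -scalerA.
have Ur r x t : U (inj r *: x) t = inj r *: U x t.
  apply: (T0_ext _ (U (inj r *: x)) (fun t => inj r *: U x t)) => [|u v|q q'].
  - exact: UB.
  - by rewrite UB scalerBr.
  rewrite !UE /b0 [injl _ *: (inj r *: x)]scalerA mulrC -scalerA -dS_pair_inj.
  by rewrite !scalerA mulrC.
have Ub a x t : U x (inj a *: t) = U (injl a *: x) t.
  apply: (T0_ext _ (fun t => U x (inj a *: t)) (U (injl a *: x))) => [u v||q q'].
  - by rewrite scalerBr UB.
  - exact: UB.
  rewrite -ractE -f0r regular_ract !UE /b0 rmorphM mulrC -scalerA.
  by [].
have [||io0 [ioE _]] := univ (dS N) (fun b x => U x (tB b)).
- by split=> [b b' x|b x x']; rewrite ?tBD ?raddfD ?UD.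
- by move=> a b x _; rewrite ractE tBZ Ub lactE.
have ioB : {morph io0 : x y / x - y} by apply: raddfB.
have io_scale c : (forall b x, io0 (c *: f b x) = c *: io0 (f b x)) ->
    forall m, io0 (c *: m) = c *: io0 m.
  move=> h; apply: (M_ext _ (fun m => io0 (c *: m)) (fun m => c *: io0 m)) => [u v|u v|b x].
  - by rewrite scalerBr ioB.
  - by rewrite ioB scalerBr.
  exact: h.
have io_l r m : io0 (injl r *: m) = injl r *: io0 m.
  by apply: io_scale => b x; rewrite -lactE -fl !ioE lactE tBZ Ul.
have io_r r m : io0 (inj r *: m) = inj r *: io0 m.
  by apply: io_scale => b x; rewrite -ractE -fr !ioE ractE Ur.
have ioZ c m : io0 (c *: m) = c *: io0 m.
  elim/mpoly_ring_ind: c m => [c|i|p q hp hq|p q hp hq] m.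
  - by rewrite -injL_C io_l.
  - elim/ord_split: i => i; first by rewrite -injL_X io_l.
    by rewrite -injM_X io_r.
  - by rewrite !scalerDl raddfD hp hq.
  by rewrite -!scalerA hp hq.
have io_lin : linear io0 by move=> c m m'; rewrite raddfD ioZ.
pose b1 := Bt (f0 (1 : R) (1 : R)); pose ba := Bt (f0 (al : R) (1 : R)).
pose p0 (y : dS N) : M := f b1 y.1 + f ba y.2.
have p0D y y' : p0 (y + y') = p0 y + p0 y' by rewrite /p0 !fDr addrACA.
have p0N y : p0 (- y) = - p0 y.
  by apply: (addrI (p0 y)); rewrite -p0D !subrr; apply: (addrI (p0 0)); rewrite -p0D !addr0.
have p0B : {morph p0 : x y / x - y} by move=> x y; rewrite p0D p0N.
have io_p0 y : io0 (p0 y) = y.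
  rewrite raddfD !ioE /tB /b1 /ba; rewrite /tB in tBK; rewrite !tBK !UE /b0.
  rewrite rmorph1 !scale1r dS_alpha; case: y => a b /=.
  by congr pair; rewrite /= ?addr0 ?add0r.
have p0_io m : p0 (io0 m) = m.
  apply: (M_ext _ (fun m => p0 (io0 m)) id) => [u v|u v|b x] //.
    by rewrite ioB p0B.
  rewrite ioE -{2}(BtK b); move: (tB b) => t.
  have fN b2 x2 : f (- b2) x2 = - f b2 x2.
    by apply: (addrI (f b2 x2)); rewrite -fDl !subrr; apply: (addrI (f 0 x2)); rewrite -fDl !addr0.
  apply: (T0_ext _ (fun t => p0 (U x t)) (fun t => f (Bt t) x)) => [u v|u v|q q'].
  - by rewrite UB p0B.
  - by rewrite BtD -scaleN1r BtZ scaleN1r fDl fN.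
  rewrite UE /b0; have [u [v [iu iv Eq ->]]] := dS_injl N (q : R).
  have ff (w c : R) y : invariant rho s w -> f (Bt (f0 c (1 : R))) (injl w *: (injl (q' : R) *: y)) =
      f (Bt (f0 (w * c : R) q')) y.
    move=> iw; rewrite scalerA -rmorphM -lactE -fb // ractE -BtZ -ractE -f0r.
    rewrite regular_ract mulr1; congr (f (Bt _) y).
    apply: etrans (congr1 (f0 c) (esym (regular_lact q' w))) _.
    by rewrite -f0b // regular_ract.
  rewrite /p0 /= ff // ff // -fDl -BtD -f0Dl Eq mulr1.
  by rewrite [v * al]mulrC.
have p_lin : linear p0.
  move=> c y y'; rewrite p0D; congr (_ + _).
  by rewrite -{1}(io_p0 y) -ioZ p0_io.
by exists (mklin io_lin), (mklin p_lin).
Qed.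

End Tensor.
End Double.
End Soergel.

Section SoergelTest.
Variables (k : fieldType) (W : groupType) (S : {pred W}) (V : vectType k).
Variable rho : W -> 'End(V).
Hypothesis hk : 2%N \notin [pchar k].
Hypothesis hS : coxeter_system S.
Hypothesis hrho : reflection_faithful S rho.

Local Notation n := (\dim {:V}).
Local Notation R := {mpoly k[n]}.
Local Notation A := {mpoly k[n + n]}.
Local Notation inj := (injM V).
Local Notation res := (resM rho).

Section SoergelInduction.
Variables (P : ungraded_complex A -> Prop) (E : ungraded_complex A -> lmodType A -> Prop).
Hypothesis P_double : forall s (sS : s \in S) X, P X -> P (dSx hk hS hrho sS X).
Hypothesis E_double : forall s (sS : s \in S) X N,
  E (dSx hk hS hrho sS X) N -> E X (dS hk hS hrho sS N).
Hypothesis E_regular : forall X, P X -> E X (regular rho).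
Hypothesis E_retract : forall X (N B : lmodType A) (io : {linear N -> B}) (p : {linear B -> N}),
  cancel io p -> E X B -> E X N.
Hypothesis E_sum : forall X (B : lmodType A) (I : finType) (N : I -> lmodType A)
  (io : forall i, {linear N i -> B}) (p : forall i, {linear B -> N i}),
  (forall b, b = \sum_i io i (p i b)) -> (forall i, E X (N i)) -> E X B.

Lemma bott_samelson_test l B : bott_samelson S rho l B -> forall X, P X -> E X B.
Proof.
elim=> [M [f [g [fK _]]] X PX|s {}l B' N M sS [T [hT isoB]] _ IH hM X PX].
  exact: (@E_retract X M (regular rho) f g fK (E_regular PX)).
have [io [p ioK]] := tensor_iso hk hS hrho sS hT isoB hM.
exact: E_retract ioK (E_double (IH _ (P_double sS PX))).
Qed.

(** The induction on the construction of a Soergel bimodule, for a property P of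
    complexes that is stable under doubling and a property E of pairs that can be
    transposed along the adjunction. *)
Lemma soergel_test M X : soergel S rho M -> P X -> E X M.
Proof.
move=> [I [N [d [hN ds]]]] PX.
have [io [p [_ _ gen]]] := direct_sum_proj ds.
apply: (@E_sum X M I (fun i => gshift (N i) (d i)) (fun i => io i) (fun i => p i)).
  move=> b; have [s [us s0 {1}->]] := gen b.
  rewrite big_uniq //=; apply: big_rmcond => i /s0->.
  exact: linear0.
move=> i; have [l [B [bB [M' dsB]]]] := hN i.
have [io' [p' [pK _ _]]] := direct_sum_proj dsB.
exact: (@E_retract X (N i) B (io' true) (p' true) (pK true) (bott_samelson_test bB PX)).
Qed.

End SoergelInduction.

Section Arranged.
Variable ok : rel W.

Definition arranged (X : ungraded_complex A) := exists L : seq W,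
  [/\ uniq L, pairwise ok L, supp_all inj res X L & good_chain inj res X L].

Hypothesis okP : forall x y, ok x y -> ok y x -> ~~ dep S x y.

(** Entries off the support contribute nothing ([good_chain_filter]), and the others
    are brought into the new order by exchanges ([good_chain_perm]). *)
Lemma arranged_extend X (L B : seq W) : uniq L -> pairwise ok L ->
  supp_all inj res X L -> good_chain inj res X L ->
  {subset L <= B} -> uniq B -> pairwise ok B ->
  supp_all inj res X B /\ good_chain inj res X B.
Proof.
move=> uL pL sL gL LB uB pB; split.
  by move=> i m; apply: supp_on_sub LB (sL i m).
apply: (good_chain_filter (resMK hk hrho) (sepM hk hrho) sL).
apply: (good_chain_perm (resMK hk hrho) (sepM hk hrho) (ok := ok) _ uL pL _ _ gL).
- by move=> x y ne xy yx; apply: (unrelM hk hrho ne); apply: okP.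
- exact: pairwise_filter.
apply: uniq_perm => //; first exact: filter_uniq.
by move=> x; rewrite mem_filter; case xL: (x \in L); rewrite //= LB.
Qed.

Hypothesis ok_blocks : forall s, s \in S -> forall X : seq W, exists zs,
  [/\ {subset X <= sblocks s zs}, uniq (sblocks s zs) & pairwise ok (sblocks s zs)].

Lemma arranged_double s (sS : s \in S) X : arranged X -> arranged (dSx hk hS hrho sS X).
Proof.
move=> [L [uL pL sL gL]]; have [zs [Lzs uzs pzs]] := ok_blocks sS L.
have [sz gz] := arranged_extend uL pL sL gL Lzs uzs pzs.
exists (sblocks s zs); split=> //.
  apply: dcx_supp_all sz.
  - exact: (sLM_inj rho hk sS).
  - by move=> x f; apply: (resM_tw hk hS hrho sS).
  - exact: (resM_alpha2 hk hS hrho sS).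
  exact: (stable_blocks (twK hS sS)).
apply: (@good_chain_double _ _ _ _ _ _ (tw s) _ _ _ _ _ _ _ _ _ _ X zs gz).
- exact: (resMK hk hrho).
- exact: (sLM_inj rho hk sS).
- exact: (twK hS sS).
- by move=> x f; apply: (resM_tw hk hS hrho sS).
- exact: (resM_tw_alpha hk hS hrho sS).
exact: (resM_alpha2 hk hS hrho sS).
Qed.

End Arranged.

Lemma blocksN s (sS : s \in S) (X : seq W) : exists zs,
  [/\ {subset X <= sblocks s zs}, uniq (sblocks s zs) & pairwise (okN hS) (sblocks s zs)].
Proof.
have [zs [Xzs uzs pzs]] := block_arrangement hS sS X.
exists (rev [seq (s * z)%g | z <- zs]).
rewrite -(sblocks_rev hS sS) rev_uniq; split=> //.
  by move=> x /Xzs; rewrite mem_rev.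
by rewrite (pairwise_rev (r' := okD hS)) // => x y; rewrite /okN /okD dep_sym.
Qed.

Definition utorsionfree (X : ungraded_complex A) := forall i (m : X i), torsion inj m -> m = 0.

(** The unit of W is the shortest element, so it may come first in an arrangement by
    increasing length. *)
Lemma ext_soergel X M : ubounded X -> arranged (okD hS) X -> soergel S rho M -> ext_exact X M.
Proof.
move=> bX aX hM.
apply: (@soergel_test (fun X => ubounded X /\ arranged (okD hS) X) (@ext_exact A)) hM _ => //.
- move=> s sS {bX aX}X [bX aX]; split; first exact: dcx_bounded.
  by apply: arranged_double aX => [x y|]; [apply: okDP | apply: block_arrangement].
- by move=> s sS Y N; apply: ext_exact_double.
- move=> {bX aX}X [bX [L [uL pL sL gL]]].
  have [L2 [u2 LL2 /lex_arrangement p2]] := sorted_list hS L.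
  have [|s2 g2] := arranged_extend (ok := okD hS) _ uL pL sL gL LL2 u2 p2.
    by move=> x y; apply: okDP.
  apply: (ext_exact_graph (resMK hk hrho) (sepM hk hrho) (x := 1%g) (C := L2)) => //.
  - by case/andP: u2.
  - by case: g2.
  exact: (graph_regular hk hrho).
- by move=> Y N B io p ioK; apply: ext_exact_retract ioK.
by move=> Y B I N io p; apply: ext_exact_sum.
Qed.

Lemma good_chain_last X L (x : W) : good_chain inj res X (rcons L x) -> good_at inj res X x [::].
Proof. by elim: L => [[]|y L IH [_ /IH]]. Qed.

(** The unit of W may come last in an arrangement by decreasing length. *)
Lemma lift_soergel X M : utorsionfree X -> arranged (okN hS) X -> soergel S rho M -> lift_exact M X.
Proof.
move=> bX aX hM.
apply: (@soergel_test (fun X => utorsionfree X /\ arranged (okN hS) X)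
  (fun X N => @lift_exact A N X)) hM _ => //.
- move=> s sS {bX aX}X [bX aX]; split.
    move=> i m /(torsion_double (sLM_inj rho hk sS) m)[/bX m1 /bX m2].
    by case: m m1 m2 => a b /= -> ->.
  by apply: arranged_double aX => [x y|]; [apply: okNP | apply: blocksN].
- by move=> s sS Y N; apply: lift_exact_double.
- move=> {bX aX}X [bX [L [uL pL sL gL]]].
  have [L2 [u2 LL2 /lex_arrangement p2]] := sorted_list hS L.
  have [||||s2 g2] := arranged_extend (ok := okN hS) (B := rev (1%g :: L2)) _ uL pL sL gL.
  - by move=> x y; apply: okNP.
  - by move=> x /LL2; rewrite mem_rev.
  - by rewrite rev_uniq.
  - by rewrite (pairwise_rev (r' := okD hS)) // => x y; rewrite /okN /okD dep_sym.
  apply: (lift_exact_graph (x := 1%g) bX _ (graph_regular hk hrho)).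
  by rewrite rev_cons in g2; exact: good_chain_last g2.
- by move=> Y N B io p ioK; apply: lift_exact_retract ioK.
by move=> Y B I N io p; apply: lift_exact_sum.
Qed.

End SoergelTest.

(** * The Bruhat order *)

Section BruhatFlags.
Variables (k : fieldType) (W : groupType) (S : {pred W}) (V : vectType k).
Variable rho : W -> 'End(V).
Hypothesis hk : 2%N \notin [pchar k].
Hypothesis hS : coxeter_system S.
Hypothesis hrho : reflection_faithful S rho.

Local Notation n := (\dim {:V}).
Local Notation res := (resM rho).
Local Notation len := (len hS).

(** No three elements differ pairwise by reflections, by parity. *)
Lemma unrel_triple (x y z : W) : x != y -> y != z -> x != z ->
  [\/ unrel res x y, unrel res y z | unrel res x z].
Proof.
move=> xy yz xz.
have [dxy|] := boolP (dep S x y); last by move=> /(unrelM hk hrho xy); constructor 1.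
have [dyz|] := boolP (dep S y z); last by move=> /(unrelM hk hrho yz); constructor 2.
have [dxz|] := boolP (dep S x z); last by move=> /(unrelM hk hrho xz); constructor 3.
by case: (dep_triple hS dxy dyz dxz).
Qed.

Lemma bruhat_lt_len x y : bruhat_le S x y -> y <> x -> (len x < len y)%N.
Proof. by move=> /(bruhat_len hS)[->|]. Qed.

Lemma bruhat_or_unrel x y : (len x <= len y)%N -> x != y ->
  (bruhat_le S x y /\ y <> x) \/ unrel res y x.
Proof.
move=> le ne; have [d|nd] := boolP (dep S x y).
  left; split; last by move=> E; rewrite E eqxx in ne.
  by apply: (dep_bruhat d); rewrite ltn_neqAle (dep_len hS d).
by right; apply: (unrelM hk hrho); [rewrite eq_sym | rewrite dep_sym].
Qed.

Lemma bruhat_or_unrelN x y : (len y <= len x)%N -> x != y ->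
  (bruhat_le S y x /\ y <> x) \/ unrel res y x.
Proof.
move=> le ne; have [d|nd] := boolP (dep S y x).
  left; split; last by move=> E; rewrite E eqxx in ne.
  by apply: (dep_bruhat d); rewrite ltn_neqAle (dep_len hS d).
by right; apply: (unrelM hk hrho _ nd); rewrite eq_sym.
Qed.

Lemma Delta_arranged F : Delta_exact S rho F -> arranged rho (okD hS) (uc F).
Proof.
move=> [flF acF].
have [|L0 hL0] := common_support hk hrho (F := F); first by move=> i; case: (flF i).
have [L [uL L0L sL]] := sorted_list hS L0.
exists (1%g :: L); have [|||||||] := @flag_chain _ _ _ _ _ hk hrho (bruhat_ge S) (bruhat_gt S) _ _ _ _ F flF acF (1%g :: L) => //.
- by move=> x y [].
- exact: Bruhat_refl.
- move=> x y z [xy nxy] [yz nyz]; apply: unrel_triple.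
  + by apply/eqP => E; apply: nxy.
  + by apply/eqP => E; apply: nyz.
  apply/eqP => E; subst z.
  by have := ltn_trans (bruhat_lt_len xy nxy) (bruhat_lt_len yz nyz); rewrite ltnn.
- move=> i m; apply: cover_sub (hL0 i m) => K [x xL0 ->]; exists x => //; exact: L0L.
- move=> L1 x C EL; rewrite EL in uL sL *.
  move: sL uL; rewrite pairwise_cat cat_uniq /= => /and3P[/allrelP pc _ /andP[/allP xC _]].
  move=> /and3P[_ _ /andP[nxC _]]; split=> [y yC|y].
    apply: bruhat_or_unrel; first exact: xC.
    by apply: contraNneq nxC => ->.
  rewrite mem_cat inE => /or3P[yL1|/eqP->|//] [xy nxy] //.
  have := bruhat_lt_len xy nxy; rewrite ltnNge.
  by have := pc y x yL1 (mem_head _ _); rewrite /by_length => ->.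
by move=> sup ch; split=> //; apply: lex_arrangement.
Qed.

Lemma Nabla_arranged G : Nabla_exact S rho G ->
  arranged rho (okN hS) (uc G) /\ utorsionfree (uc G).
Proof.
move=> [flG acG].
have [|L0 hL0] := common_support hk hrho (F := G); first by move=> i; case: (flG i).
have [L' [uL L0L sL]] := sorted_list hS L0.
set L := rev (1%g :: L').
have uL2 : uniq L by rewrite rev_uniq.
have pL : pairwise (fun x y => len y <= len x)%N L.
  by rewrite (pairwise_rev (r' := by_length hS)).
have hL i (m : G i) : Gam (gensM rho) (fun x => x \in L) m.
  apply: cover_sub (hL0 i m) => K [x xL0 ->]; exists x => //.
  by rewrite mem_rev; apply: L0L.
split; last first.
  have := @flag_torsionfree _ _ _ _ _ hk hrho (bruhat_below S) (bruhat_lt S) _ _ G flG L len hL.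
  apply=> //; first by move=> x y [].
    exact: Bruhat_refl.
  by move=> x y [yx ne]; apply: (bruhat_lt_len yx); exact: nesym.
exists L; have [|||||||] := @flag_chain _ _ _ _ _ hk hrho (bruhat_below S) (bruhat_lt S) _ _ _ _ G flG acG L => //.
- by move=> x y [].
- exact: Bruhat_refl.
- move=> x y z [xy nxy] [yz nyz]; apply: unrel_triple.
  + by apply/eqP => E; apply: nxy.
  + by apply/eqP => E; apply: nyz.
  apply/eqP => E; subst z.
  have := ltn_trans (bruhat_lt_len xy (nesym nxy)) (bruhat_lt_len yz (nesym nyz)).
  by rewrite ltnn.
- move=> L1 x C EL; rewrite EL in uL2 pL *.
  move: pL uL2; rewrite pairwise_cat cat_uniq /= => /and3P[/allrelP pc _ /andP[/allP xC _]].
  move=> /and3P[_ _ /andP[nxC _]]; split=> [y yC|y].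
    apply: bruhat_or_unrelN; first exact: xC.
    by apply: contraNneq nxC => ->.
  rewrite mem_cat inE => /or3P[yL1|/eqP->|//] [yx nyx] //.
  have := bruhat_lt_len yx (nesym nyx); rewrite ltnNge.
  by have /= := pc y x yL1 (mem_head _ _) => ->.
move=> sup ch; split=> //.
rewrite (pairwise_rev (r' := okD hS)); first exact: lex_arrangement.
by move=> x y; rewrite /okN /okD dep_sym.
Qed.

End BruhatFlags.

(** * Degree-zero parts and homotopies *)

Section DegreeZero.
Variables (k : fieldType) (n : nat).
Implicit Types M N P : gbimod k n.

Lemma gpr_ext M (m m' : M) : (forall i, gpr i m = gpr i m') -> m = m'.
Proof.
move=> E; apply/eqP; rewrite -subr_eq0; apply/eqP.
have [s [_ ->]] := gpr_sum (m - m').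
by rewrite big1 // => i _; rewrite gprB E subrr.
Qed.

(** The sum of the maps that take the component of degree i to the component of
    degree i of its image.  A scalar which is homogeneous commutes with it, and these
    generate the ring. *)
Lemma degree_zero_part M N (psi : {linear M -> N}) : exists g : ghom M N,
  forall i m, gpr i (g m) = gpr i (psi (gpr i m)).
Proof.
have /choice[g gE] m : exists z, forall i, gpr i z = gpr i (psi (gpr i m)).
  have [s [us Em]] := gpr_sum m.
  exists (\sum_(j <- s) gpr j (psi (gpr j m))) => i; rewrite gpr_bigsum.
  under eq_bigr => j _ do rewrite gpr_gpr.
  have [si|si] := boolP (i \in s).
    rewrite (big_rem i) //= eqxx big_seq big1 ?addr0 // => j.
    by rewrite mem_rem_uniq // inE eq_sym => /andP[/negPf-> _].
  have -> : gpr i m = 0.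
    rewrite Em gpr_bigsum big_seq big1 // => j js; rewrite gpr_gpr.
    by case: eqP => // E; rewrite E js in si.
  rewrite linear0 gpr0 big_seq big1 // => j js.
  by case: eqP => // E; rewrite E js in si.
have gD m m' : g (m + m') = g m + g m'.
  by apply: gpr_ext => i; rewrite gprD !gE gprD linearD gprD.
have gZh (e : nat) (a : {mpoly k[n + n]}) m : a \is e.-homog -> g (a *: m) = a *: g m.
  move=> ha; apply: gpr_ext => i.
  by rewrite gE !(gpr_shiftZ _ _ ha) linearZ (gpr_shiftZ _ _ ha) gE.
have gZ (a : {mpoly k[n + n]}) m : g (a *: m) = a *: g m.
  elim/mpoly_ring_ind: a m => [c|i|p q hp hq|p q hp hq] m.
  - apply: (gZh 0%N); rewrite -[c%:MP]mulr1 mul_mpolyC; apply: dhomogZ; exact: dhomog1.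
  - by apply: (gZh 1%N); rewrite dhomogX; apply/eqP/mdeg1.
  - by rewrite !scalerDl gD hp hq.
  by rewrite -!scalerA hp hq.
have g_lin : linear g by move=> a m m'; rewrite gD gZ.
have gP i m : gpr i (mklin g_lin m) = mklin g_lin (gpr i m).
  apply: gpr_ext => j; rewrite /= gpr_gpr [RHS]gE gpr_gpr.
  by case: eqP => [->|_]; [exact: gE | rewrite linear0 gpr0].
by exists (GHom gP).
Qed.

Lemma graded_factor_right M N P (phi : ghom M N) (d : ghom M P) (psi : {linear P -> N}) :
  (forall m, phi m = psi (d m)) -> exists g : ghom P N, forall m, phi m = g (d m).
Proof.
move=> E; have [g gE] := degree_zero_part psi; exists g => m.
by apply: gpr_ext => i; rewrite gE (gfunP d) -E -(gfunP phi) gpr_gpr eqxx.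
Qed.

Lemma graded_factor_left M N P (phi : ghom M N) (d : ghom P N) (psi : {linear M -> P}) :
  (forall m, phi m = d (psi m)) -> exists g : ghom M P, forall m, phi m = d (g m).
Proof.
move=> E; have [g gE] := degree_zero_part psi; exists g => m.
by apply: gpr_ext => i; rewrite (gfunP d) gE -(gfunP d) -E -(gfunP phi) gpr_gpr eqxx.
Qed.

Lemma ghom_sub_comp M N P (f : ghom M N) (u : ghom M P) (v : ghom P N) :
  exists g : ghom M N, forall m, g m = f m - v (u m).
Proof.
have g_lin : linear (fun m => f m - v (u m)).
  by move=> a m m'; rewrite (linearP f) (linearP u) (linearP v) scalerBr opprD addrACA.
have gP i m : gpr i (mklin g_lin m) = mklin g_lin (gpr i m).
  by rewrite /= gprB !gfunP.
by exists (GHom gP).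
Qed.

Lemma dependent_update (T : int -> Type) (h : forall i, T i) j (x : T j) :
  exists h' : forall i, T i, h' j = x /\ forall i, i != j -> h' i = h i.
Proof.
exists (fun i => if j =P i is ReflectT e then ecast z (T z) e x else h i).
split=> [|i ne]; first by case: eqP => // e; rewrite eq_axiomK.
by case: eqP => // e; rewrite e eqxx in ne.
Qed.

Section Homotopies.
Variables (F B : complex k n) (f : chain_map F B).

Definition homotopy_at (h : forall i, ghom (F (i + 1)) (B i)) (i : int) := forall m : F (i + 1),
  f (i + 1) m = cd B i (h i m) + h (i + 1) (cd F (i + 1) m).

Lemma homotopy_trivial h i : (forall m : F (i + 1), m = 0) -> homotopy_at h i.
Proof.
move=> F0 m; rewrite (F0 m) (linear0 (f (i + 1))) (linear0 (cd F (i + 1))).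
by rewrite (linear0 (h i)) (linear0 (cd B i)) (linear0 (h (i + 1))) addr0.
Qed.

Lemma null_homotopic : (exists h : forall i, ghom (F (i + 1)) (B i), forall i, homotopy_at h i) ->
  homotopic f (chain0 F B).
Proof. by move=> [h hE]; exists h => i m; rewrite [LHS]subr0; exact: hE. Qed.

(** Once f_(j+1) = d h_j + h_(j+1) d is known, the defect f_(j+2) - d h_(j+1) kills
    the boundaries, so it factors through the differential; the factor is h_(j+2). *)
Lemma homotopy_up :
  (forall (i j : int) (phi : ghom (F (i + 1)) (B j)), (forall m, phi (cd F i m) = 0) ->
    exists psi : ghom (F (i + 1 + 1)) (B j), forall m, phi m = psi (cd F (i + 1) m)) ->
  homotopic f (chain0 F B).
Proof.
move=> ext; apply: null_homotopic.
have [b F0] := cbounded F.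
have triv h i : (b < `|(i + 1)%R|)%N -> homotopy_at h i.
  by move=> lt; apply: homotopy_trivial; apply: F0.
suff [h hE] : exists h : forall i, ghom (F (i + 1)) (B i),
    forall i, (i < - b%:Z - 1 + (b + b + 2)%N%:Z) -> homotopy_at h i.
  exists h => i; have [lt|ge] := leP (- b%:Z - 1 + (b + b + 2)%N%:Z) i; last exact: hE.
  by apply: triv; lia.
elim: (b + b + 2)%N => [|N [h hE]].
  exists (fun i => ghom0 _ _) => i lt; apply: triv; lia.
set j := - b%:Z - 1 + N%:Z - 1.
have Ej : j + 1 = - b%:Z - 1 + N%:Z by rewrite /j; ring.
have [phi phiE] := ghom_sub_comp (f (j + 1 + 1)) (h (j + 1)) (cd B (j + 1)).
have [|psi psiE] := ext (j + 1) (j + 1 + 1) phi.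
  move=> m; rewrite phiE cmapP (hE j) ?linearD ?cd_cd ?add0r ?subrr //.
  by rewrite -Ej; lia.
have [h' [h'j h'E]] := dependent_update h psi.
exists h' => i lt.
have [Ei|ne] := eqVneq i (j + 1).
  subst i => m; rewrite h'j -psiE phiE h'E; first by rewrite subrKC.
  by apply/eqP; lia.
move=> m; rewrite !h'E; [apply: hE | |]; lia.
Qed.

(** Once f_(j+2) = d h_(j+1) + h_(j+2) d is known, the defect f_(j+1) - h_(j+1) d
    takes values in the cycles; its lift along the differential is h_j. *)
Lemma homotopy_down :
  (forall (i j : int) (phi : ghom (F j) (B (i + 1))), (forall m, cd B (i + 1) (phi m) = 0) ->
    exists psi : ghom (F j) (B i), forall m, phi m = cd B i (psi m)) ->
  homotopic f (chain0 F B).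
Proof.
move=> lift; apply: null_homotopic.
have [b F0] := cbounded F.
have triv h i : (b < `|(i + 1)%R|)%N -> homotopy_at h i.
  by move=> lt; apply: homotopy_trivial; apply: F0.
suff [h hE] : exists h : forall i, ghom (F (i + 1)) (B i),
    forall i, (b%:Z - (b + b + 2)%N%:Z <= i) -> homotopy_at h i.
  exists h => i; have [ge|lt] := leP (b%:Z - (b + b + 2)%N%:Z) i; first exact: hE.
  by apply: triv; lia.
elim: (b + b + 2)%N => [|N [h hE]].
  exists (fun i => ghom0 _ _) => i lt; apply: triv; lia.
set j := b%:Z - N.+1%:Z.
have [phi phiE] := ghom_sub_comp (f (j + 1)) (cd F (j + 1)) (h (j + 1)).
have [|psi psiE] := lift j (j + 1) phi.
  move=> m; rewrite phiE linearB -cmapP (hE (j + 1)) ?cd_cd ?linear0 ?addr0 ?subrr //.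
  by rewrite /j; lia.
have [h' [h'j h'E]] := dependent_update h psi.
exists h' => i le.
have [Ei|ne] := eqVneq i j.
  subst i => m; rewrite h'j -psiE phiE h'E; first by rewrite subrK.
  by apply/eqP; lia.
move=> m; rewrite !h'E; [apply: hE | |]; lia.
Qed.

End Homotopies.
End DegreeZero.

Theorem corollary3p6 (k : fieldType) (hk : 2%N \notin [pchar k])
    (W : groupType) (S : {pred W}) (hS : coxeter_system S)
    (V : vectType k) (rho : W -> 'End(V)) (hrho : reflection_faithful S rho)
    (F G : complex k (\dim {:V})) :
  (termwise (Delta_flag S rho) F /\ Delta_exact S rho F /\
     termwise (soergel S rho) G) \/
  (termwise (soergel S rho) F /\
     termwise (Nabla_flag S rho) G /\ Nabla_exact S rho G) ->
  HomK_zero F G.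
Proof.
case=> [[_ [exF sG]]|[sF [_ exG]]] d f.
  apply: homotopy_up => i j phi phi0.
  have aF := Delta_arranged hk hS hrho exF.
  have [psi psiE] := ext_soergel hk hrho (uc_bounded F) aF (sG j) (phi := phi) phi0.
  exact: (@graded_factor_right _ _ _ _ _ phi (cd F (i + 1)) psi psiE).
apply: homotopy_down => i j phi phi0.
have [aG tG] := Nabla_arranged hk hS hrho exG.
have [psi psiE] := lift_soergel hk hrho tG aG (sF j) (phi := phi) phi0.
exact: (@graded_factor_left _ _ _ _ _ phi (cd (cshift G d) i) psi psiE).
Qed.
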